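(* Let $p,s$ be real numbers with $p$ positive and irrational, and let $l\ge1$. For $i=1,\dots,l$ let $b_i=\lfloor s-p(i-1)\rfloor-\lfloor s-pi\rfloor$ and $c_i=s-p(i-1)-\lfloor s-p(i-1)\rfloor$, and let $\sigma\in S_l$ be the permutation such that $\sigma(1),\dots,\sigma(l)$ are in the same relative order as $c_l,\dots,c_1$. Then for all non-negative integers $u,v$ there is an identity of formal power series in $t$ \[ \mathcal H_{(b_1+u,b_2,\dots,b_{l-1},b_l-v)}(x)=\sum_{a_1,\dots,a_{l-1}\ge0}t^{a_1+\cdots+a_{l-1}}\,\mathcal L^{\sigma}_{((b_l,\dots,b_1)+(-v,a_{l-1},\dots,a_1))/(a_{l-1},\dots,a_1,-u)}(x;q). \]
   Context: Let $\mathbf k=\mathbb Q(q,t)$. $S_l$ acts on $\mathbb Z^l$ by $w(\lambda)=(\lambda_{w^{-1}(1)},\dots,\lambda_{w^{-1}(l)})$ and on $\mathbf k[x_1^{\pm1},\dots,x_l^{\pm1}]$ by $w(x_i)=x_{w(i)}$, so $w(x^\lambda)=x^{w(\lambda)}$. $s_i=(i,i+1)$. Demazure–Lusztig operators: $T_i=q\,s_i+(1-q)\frac{1}{1-x_{i+1}/x_i}(s_i-1)$; they generate a Hecke algebra action with $(T_i-q)(T_i+1)=0$, and $T_w=T_{i_1}\cdots T_{i_m}$ for any reduced word $w=s_{i_1}\cdots s_{i_m}$. For $\lambda\in\mathbb Z^l$ let $\lambda_+$ be its weakly decreasing rearrangement and $E_\lambda(x;q)=q^{-\ell(w)}T_wx^{\lambda_+}$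 for any $w$ with $w(\lambda_+)=\lambda$ (independent of choice). $\mathrm{Inv}(\mu)=\{(i,j):i<j,\mu_i>\mu_j\}$; for a permutation $\pi$, $\mathrm{Inv}(\pi)=\mathrm{Inv}(\pi(1),\dots,\pi(l))$; $\mathrm{Inv}(\lambda+\epsilon\rho)=\{(i,j):i<j,\lambda_i\ge\lambda_j\}$. Twisted polynomials: $E^\pi_\lambda(x;q)=q^{|\mathrm{Inv}(\pi^{-1})\cap\mathrm{Inv}(\lambda+\epsilon\rho)|}T_{\pi^{-1}}^{-1}E_{\pi^{-1}(\lambda)}(x;q)$; for each $\pi$ these form a basis of $\mathbf k[x^{\pm1}]$. Characters: for dominant $\lambda$ ($\lambda_1\ge\dots\ge\lambda_l$) $\chi_\lambda$ is the irreducible $\mathrm{GL}_l$ character (equal to $s_\lambda(x_1,\dots,x_l)$ if $\lambda_l\ge0$). Weyl symmetrization $\boldsymbol\sigma(f)=\sum_{w\in S_l}w\bigl(f/\prod_{i<j}(1-x_j/x_i)\bigr)$. $\mathbf H_{q,t}(\phi)=\boldsymbol\sigma\Bigl(\phi\frac{\prod_{i<j}(1-qt\,x_i/x_j)}{\prod_{i<j}(1-q\,x_i/x_j)(1-t\,x_i/x_j)}\Bigr)$ with denominators expanded as geometric series, giving a formal power series in $q,t$ with coefficients virtual characters. $\mathcal H_{\mathbf b}(x)=\mathbf H_{q,t}\bigl(x^{\mathbf b}/\prod_{i=1}^{l-1}(1-qt\,x_i/x_{i+1})\bigr)$ (expanded likewise). LLT series: for $\pi\in S_l$, $\alpha,\beta\in\mathbb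 Z^l$, $\mathcal L^\pi_{\beta/\alpha}(x;q)=\sum_\lambda c_\lambda\chi_\lambda$ (over dominant $\lambda$), where $c_\lambda$ is the coefficient of $E^{\pi^{-1}}_\beta(x;q^{-1})$ in the expansion of $\chi_\lambda\cdot E^{\pi^{-1}}_\alpha(x;q^{-1})$ in the basis $\{E^{\pi^{-1}}_\mu(x;q^{-1})\}_{\mu\in\mathbb Z^l}$. *)

(* Defs.v *)
From HB Require Import structures.
From mathcomp Require Import all_boot all_order all_fingroup all_algebra.
From mathcomp Require Import finmap mpoly.
From mathcomp Require Import boolp classical_sets reals.

Set Implicit Arguments.
Unset Strict Implicit.
Unset Printing Implicit Defensive.

Import Order.TTheory GRing.Theory Num.Theory.
Local Open Scope ring_scope.

(* Positions in weights, variables and permutations are 0-based.  The product  *)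
(* of 'S_l is (v * w)%g x = w (v x), so the composite v o w is (w * v)%g.      *)

Section Coordinates.
Variables (F A : nzRingType) (cst : F -> A) (I : choiceType) (B : I -> A).

(* The coefficient of B i in the expansion of f in the family B, with scalars  *)
(* acting through cst.  It is meaningful when B is linearly independent and f  *)
(* is in its span (the junk value is 0).                                       *)
Definition coef_in (f : A) (i : I) : F :=
  xget [fsfun] [set c : {fsfun I -> F with 0} |
    f = \sum_(j <- finsupp c) cst (c j) * B j]%classic i.

End Coordinates.

Definition weight (l : nat) := {ffun 'I_l -> int}.

Definition wt (l : nat) (s : seq int) : weight l := [ffun i : 'I_l => s`_i].

Definition dominant (l : nat) (lam : weight l) : bool :=
  [forall i : 'I_l, forall j : 'I_l, (i <= j)%N ==> (lam j <= lam i)].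

Definition domweight (l : nat) := {lam : weight l | dominant lam}.

Section Weights.
Variable l : nat.
Implicit Types (lam : weight l) (w : 'S_l) (i : 'I_l).

Definition wact w lam : weight l := [ffun i => lam ((w^-1)%g i)].

Definition wplus lam : weight l :=
  wt l (sort >=%R [seq lam i | i <- enum 'I_l]).

Definition Inv_perm w : {set 'I_l * 'I_l} :=
  [set ij : 'I_l * 'I_l | (ij.1 < ij.2)%N & (w ij.2 < w ij.1)%N].

(* Inv (lam + epsilon rho), epsilon infinitesimal *)
Definition Inv_eps lam : {set 'I_l * 'I_l} :=
  [set ij : 'I_l * 'I_l | (ij.1 < ij.2)%N & lam ij.2 <= lam ij.1].

Definition ell w : nat := #|Inv_perm w|.

(* The letter i stands for the simple reflection tperm i (ordS i), where       *)
(* i.+1 < l, so that ordS i (a cyclic successor) is i.+1.  The word            *)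
(* [:: i_1; ..; i_m] stands for the composite s_(i_1) o .. o s_(i_m).          *)
Definition simple i : bool := (i.+1 < l)%N.

Definition word_perm (s : seq 'I_l) : 'S_l :=
  foldr (fun i w => (w * tperm i (ordS i))%g) 1%g s.

End Weights.

(* Laurent polynomials in x_1, .., x_l are handled inside the field of         *)
(* rational functions, where the fractions below make sense as written.        *)
Notation ratfun F l := {fraction {mpoly F[l]}}.

Section RationalFunctions.
Variables (F : fieldType) (l : nat).
Notation K := (ratfun F l).
Implicit Types (f : K) (lam : weight l) (w : 'S_l) (i j : 'I_l).

Definition rcst (c : F) : K := FracField.tofrac (c%:MP : {mpoly F[l]}).

Definition rx i : K := FracField.tofrac ('X_i : {mpoly F[l]}).

Definition rmon lam : K := \prod_i rx i ^ lam i.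

(* The field automorphism x_i |-> x_(w i), applied to a numerator and a         *)
(* denominator of f.                                                           *)
Definition ract w f : K :=
  let z := generic_quotient.repr f in
  FracField.tofrac (msym w \n_z) / FracField.tofrac (msym w \d_z).

Definition weyl_sym f : K :=
  \sum_(w : 'S_l)
    ract w (f / \prod_(ij : 'I_l * 'I_l | (ij.1 < ij.2)%N)
                  (1 - rx ij.2 / rx ij.1)).

(* Weyl's character formula, in the bialternant form                           *)
(*   det (x_i ^ (lam_j + l - j)) / det (x_i ^ (l - j)),   1 <= i, j <= l,      *)
(* which is the usual definition of s_lam (x_1, .., x_l) when lam_l >= 0.      *)
Definition alternant lam : K :=
  \det (\matrix_(i < l, j < l) (rx i ^ (lam j + (rev_ord j)%:Z))).

Definition chi (lam : domweight l) : K := alternant (val lam) / alternant 0.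

Section Hecke.
Variable q : F.

Definition T_simple i f : K :=
  rcst q * ract (tperm i (ordS i)) f
  + rcst (1 - q) / (1 - rx (ordS i) / rx i) * (ract (tperm i (ordS i)) f - f).

(* T_w is computed from some reduced word of w, i.e. a word of length ell w.   *)
Definition T_perm w f : K :=
  if [pick s : (ell w).-tuple 'I_l | all (@simple l) s & word_perm s == w]
  is Some s then foldr T_simple f s else f.

Definition T_perm_inv w f : K := xget 0 [set g | T_perm w g = f]%classic.

Definition E_pol lam : K :=
  if [pick w : 'S_l | wact w (wplus lam) == lam] is Some w
  then rcst q ^- ell w * T_perm w (rmon (wplus lam)) else 0.

Definition E_twist (pi : 'S_l) lam : K :=
  rcst q ^+ #|Inv_perm pi^-1 :&: Inv_eps lam|
  * T_perm_inv pi^-1 (E_pol (wact pi^-1 lam)).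

End Hecke.

(* The coefficient of chi_lam in L^pi_(beta/alpha)(x; q).  The substitution of *)
(* q^-1 for q in E^(pi^-1) also affects the operators T_w.                     *)
Definition LLT (q : F) (pi : 'S_l) (beta alpha : weight l)
    (lam : domweight l) : F :=
  coef_in rcst (E_twist q^-1 pi^-1) (chi lam * E_twist q^-1 pi^-1 alpha) beta.

End RationalFunctions.

(* Formal power series in q and t: f m n is the coefficient of q^m t^n.        *)
Definition fps (A : Type) := nat -> nat -> A.

Section PowerSeries.
Variable A : nzRingType.
Implicit Types (f g : fps A) (y : A).

Definition fps_const y : fps A :=
  fun m n => if (m == 0%N) && (n == 0%N) then y else 0.

Definition fps_mul f g : fps A := fun m n =>
  \sum_(i < m.+1) \sum_(j < n.+1) f i j * g (m - i)%N (n - j)%N.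

(* 1 - q t y *)
Definition one_sub_qt y : fps A := fun m n =>
  if (m == 0%N) && (n == 0%N) then 1
  else if (m == 1%N) && (n == 1%N) then - y else 0.

(* 1 / (1 - q y), 1 / (1 - t y) and 1 / (1 - q t y) *)
Definition geom_q y : fps A := fun m n => if n == 0%N then y ^+ m else 0.
Definition geom_t y : fps A := fun m n => if m == 0%N then y ^+ n else 0.
Definition geom_qt y : fps A := fun m n => if m == n then y ^+ m else 0.

End PowerSeries.

Section Catalanimals.
Variable l : nat.
Notation K := (ratfun rat l).

Definition H_op (phi : fps K) : fps K := fun m n =>
  weyl_sym
    (fps_mul phi
       (\big[@fps_mul K / fps_const 1]_(ij : 'I_l * 'I_l | (ij.1 < ij.2)%N)
          let y := rx rat ij.1 / rx rat ij.2 in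
          fps_mul (one_sub_qt y) (fps_mul (geom_q y) (geom_t y)))
       m n).

Definition H_ser (b : weight l) : fps K :=
  H_op (fps_mul (fps_const (rmon rat b))
          (\big[@fps_mul K / fps_const 1]_(i < l | simple i)
             geom_qt (rx rat i / rx rat (ordS i)))).

End Catalanimals.

(* k = Q(q, t), as the field of fractions of Q[q][t] (the outer variable is t). *)
Notation Qqt := {fraction {poly {poly rat}}}.

Definition ratq (P : {poly rat}) : Qqt := FracField.tofrac P%:P.

Definition qvar : Qqt := ratq 'X.

(* z in k lies in Q(q) and h 0 + h 1 q + h 2 q^2 + .. is its expansion:        *)
(* z = P / D and D h = P in Q[[q]].                                            *)
Definition q_expansion (z : Qqt) (h : nat -> rat) : Prop :=
  exists P D : {poly rat}, [/\ D != 0, z = ratq P / ratq D &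
    forall m : nat, \sum_(i < m.+1) D`_i * h (m - i)%N = P`_m].

(* Equality of a power series in q, t whose coefficients are virtual GL_l      *)
(* characters with a power series in t whose coefficients are formal sums      *)
(* over k of irreducible characters (g n lam is the coefficient of t^n chi_lam)*)
Definition series_eq (l : nat) (f : fps (ratfun rat l))
    (g : nat -> domweight l -> Qqt) : Prop :=
  forall (n : nat) (lam : domweight l),
    q_expansion (g n lam)
      (fun m => coef_in (@rcst rat l) (@chi rat l) (f m n) lam).

Section Line.
Variables (R : realType) (p s : R).

(* 1 <= i here *)
Definition line_b (i : nat) : int :=
  Num.floor (s - p * (i%:R - 1)) - Num.floor (s - p * i%:R).

Definition line_c (i : nat) : R :=
  s - p * (i%:R - 1) - (Num.floor (s - p * (i%:R - 1)))%:~R.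

End Line.

(* The coefficient of t^n chi_lam in                                           *)
(*   sum_a t^|a| L^sigma_(((b_l, .., b_1) + (- v, a_(l-1), .., a_1))           *)
(*                        / (a_(l-1), .., a_1, - u))                           *)
(* for b = [:: b_1; ..; b_l], where a runs over the (l-1)-tuples of naturals.  *)
Definition LLT_sum (l : nat) (sigma : 'S_l) (b : seq int) (u v : nat)
    (n : nat) (lam : domweight l) : Qqt :=
  \sum_(a : l.-1.-tuple 'I_n.+1 | (\sum_(i <- a) i)%N == n)
    let a_rev := rev [seq (nat_of_ord i)%:Z | i <- a] in
    LLT qvar sigma (wt l (rev b) + wt l (- v%:Z :: a_rev))
                   (wt l (rcons a_rev (- u%:Z))) lam.

(* Main.v *)
(** Write E_(lam,c) for E^(pi^-1)_lam(x; q^-1), where pi has the same relative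
    order as an injective word c of real numbers.

    E_(lam,c) is built from a dominant monomial by the operators U_i = q T_i, with
    T_i taken at q^-1, and V_i = U_i + q - 1, with U_i V_i = q.
    They are self-adjoint for the form sending (f, g) to the constant term of
    f g prod_(i < j) (1 - x_i / x_j) / (1 - q x_i / x_j), and this makes E_(lam,c)
    and E_(-mu,-c) dual bases.  So L^pi_(beta/alpha) has as its coefficient of
    chi_lam the value of the form on chi_lam E_(alpha,c) and E_(-beta,-c).

    Duality in l - 1 variables gives the Cauchy identity
      prod_(i < j) (1 - q X_i / y_j) / prod_(i <= j) (1 - X_i / y_j)
        = sum_a E_(a,c)(X) E_(-a,-c)(y),
    to be used with X_i = t x_i and y_j = x_(j + 1).  Two facts turn its terms into
    products of polynomials in l variables: a new last entry which is minimal, or a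
    new first entry which is maximal, contributes a monomial; and E_(lam,c) only
    changes by a monomial when lam_k + c_k is translated by a constant, if the
    entries of c differ by less than 1.  For the weights b and the words c cut out
    by a line of slope p, a translation by p relates the exponents -beta to
    (v, -a) and the reversed word to its shift.  The resulting generating function
    of E_(alpha,c) E_(-beta,-c) is the product in the definition of the
    Catalanimal, after x_i |-> 1 / x_(l + 1 - i).

    Power series in q and t are truncated, so that geometric series are finite. *)
From HB Require Import structures.
Require Import Defs.
From mathcomp Require Import all_boot all_order all_fingroup all_algebra.
From mathcomp Require Import finmap mpoly monalg.
From mathcomp Require Import boolp classical_sets reals.
From mathcomp Require Import ring lra zify.

Set Implicit Arguments.
Unset Strict Implicit.
Unset Printing Implicit Defensive.

Import Order.TTheory GRing.Theory Num.Theory.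
Local Open Scope ring_scope.

(** The form needs expansions in powers of q, and is used where q and t are nilpotent, whereas the
    E_lambda are defined over a field in which q is inverted. No single ring serves both purposes.
    So the E_lambda are characterized by recursions in U_i and V_i ([hecke_family]); with the
    normalization U_i = q T_i these contain no negative power of q. Such a family exists over Q[q],
    embedded in the field, and its image under any ring homomorphism is again such a family.
    Triangularity, duality, the Cauchy identity and translation are deduced from the recursions
    alone, over commutative rings.

    As the leading coefficients are 1, multiplication by chi_lam can be expanded over Q[q]. The LLT
    coefficients are thus polynomials in q, and the coefficient of q^m t^N may be compared after
    killing q^(m + 1) and t^(N + 1).

    Twists are encoded by real words rather than by permutations because translation concerns the
    actual numbers lam_k + c_k, although E depends on the order of the c_k only. *)

Local Notation ract := Defs.ract.

(** * Inversions and adjacent transpositions *)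

Arguments ordS : simpl never.
Arguments word_perm : simpl never.

Notation adj i := (tperm i (ordS i)).

Lemma val_ordS n (i : 'I_n) : simple i -> ordS i = i.+1 :> nat.
Proof. by move=> si; rewrite /ordS /= modn_small. Qed.

Lemma ord_eqE n (a b : 'I_n) : (a == b) = (a == b :> nat).
Proof. by []. Qed.

Lemma adj_val n (i a : 'I_n) : simple i ->
  nat_of_ord (adj i a) =
    (if a == i :> nat then i.+1 else if a == i.+1 :> nat then nat_of_ord i else nat_of_ord a).
Proof.
move=> si; case: tpermP => [->|->|].
- by rewrite eqxx val_ordS.
- by rewrite val_ordS // eqxx; case: eqP => //; lia.
move=> /eqP; rewrite ord_eqE => /negPf -> /eqP.
by rewrite ord_eqE val_ordS // => /negPf ->.
Qed.

Lemma adj_lt n (i a b : 'I_n) : simple i -> ~~ ((a == i) && (b == ordS i)) ->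
  ~~ ((a == ordS i) && (b == i)) -> (adj i a < adj i b)%N = (a < b)%N.
Proof.
move=> si; rewrite !ord_eqE val_ordS //= !adj_val //.
move: (a : nat) (b : nat) (i : nat) => x y z.
case: (x =P z) => ?; case: (x =P z.+1) => ?; case: (y =P z) => ?; case: (y =P z.+1) => ? //=; lia.
Qed.

Lemma adj_far n (i j : 'I_n) : simple i -> simple j -> (i.+1 < j)%N ->
  [/\ adj i j = j, adj i (ordS j) = ordS j, adj j i = i & adj j (ordS i) = ordS i].
Proof.
by move=> si sj ij; split; rewrite tpermD // ord_eqE ?val_ordS //=; lia.
Qed.

Lemma adj_comm n (i j : 'I_n) : simple i -> simple j -> (i.+1 < j)%N ->
  (adj i * adj j = adj j * adj i)%g.
Proof. by move=> si sj ij; have [_ _ d1 d2] := adj_far si sj ij; rewrite conjgC tpermJ d1 d2. Qed.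

Lemma adj_near n (i : 'I_n) : simple i -> simple (ordS i) ->
  adj i (ordS (ordS i)) = ordS (ordS i) /\ adj (ordS i) i = i.
Proof.
move=> si sj; have v : ordS (ordS i) = i.+2 :> nat by rewrite !val_ordS.
by split; rewrite tpermD // ord_eqE ?v ?val_ordS //=; lia.
Qed.

Lemma adj_braid n (i : 'I_n) : simple i -> simple (ordS i) ->
  (adj i * adj (ordS i) * adj i = adj (ordS i) * adj i * adj (ordS i))%g.
Proof.
move=> si sj; have [t1 t2] := adj_near si sj.
transitivity (adj (ordS i) ^ adj i)%g; first by rewrite conjgE tpermV mulgA.
transitivity (adj i ^ adj (ordS i))%g; last by rewrite conjgE tpermV mulgA.
by rewrite !tpermJ t1 t2 tpermR tpermL.
Qed.

(** The swap permutes the ordered pairs of positions other than (i, i + 1), so only that pair can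
    change the count. The relation is arbitrary because both inversion numbers and the exponent of q
    in [E_twist] are counted this way. *)
Lemma card_pairs_adj n (R : rel 'I_n) i : simple i -> ~~ R i (ordS i) ->
  #|[set p : 'I_n * 'I_n | (p.1 < p.2)%N & R (adj i p.1) (adj i p.2)]| =
  (R (ordS i) i + #|[set p : 'I_n * 'I_n | (p.1 < p.2)%N & R p.1 p.2]|)%N.
Proof.
move=> si Ri; rewrite (cardsD1 (i, ordS i)) inE /= modn_small // ltnSn.
rewrite tpermL tpermR; congr (_ + _)%N.
have adj2K : involutive (fun p : 'I_n * 'I_n => (adj i p.1, adj i p.2)).
  by case=> a b /=; rewrite !tpermK.
rewrite -(card_imset _ (inv_inj adj2K)); apply: eq_card => -[a b].
rewrite -[(a, b)](adj2K (a, b)) mem_imset ?adj2K; last exact: inv_inj.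
rewrite !inE /=; have [/andP[/eqP -> /eqP ->]|ab] := boolP ((a == i) && (b == ordS i)).
  rewrite tpermL tpermR (negPf Ri) andbF val_ordS //.
  by rewrite (ltnNge i.+1) leqnSn andbF.
have [/andP[/eqP -> /eqP ->]|ba] := boolP ((a == ordS i) && (b == i)).
  by rewrite tpermL tpermR eqxx val_ordS // (ltnNge i.+1) leqnSn.
have -> : ((adj i a, adj i b) != (i, ordS i)).
  apply: contraNneq ba => -[/(congr1 (adj i)) + /(congr1 (adj i))].
  by rewrite !tpermK tpermL tpermR => -> ->; rewrite !eqxx.
by rewrite !tpermK adj_lt.
Qed.

Section Ninv.
Variables (d : Order.disp_t) (T : porderType d) (n : nat).
Implicit Types (g : 'I_n -> T) (i : 'I_n).

(** The values lie in any partial order: natural numbers give the length of a permutation, integers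
    the measure behind [weight_ind], real numbers the one behind [line_ind]. *)
Definition invs g : {set 'I_n * 'I_n} :=
  [set ij : 'I_n * 'I_n | (ij.1 < ij.2)%N & (g ij.2 < g ij.1)%O].
Definition ninv g := #|invs g|.

Lemma ninv_swap g i : simple i -> (g i < g (ordS i))%O ->
  ninv (g \o adj i) = (ninv g).+1.
Proof.
move=> si gi; rewrite /ninv /invs.
rewrite (card_pairs_adj (R := fun a b => (g b < g a)%O)) ?gi //.
by rewrite Order.POrderTheory.lt_gtF.
Qed.

Lemma adj_mono g : (forall i, simple i -> (g i <= g (ordS i))%O) ->
  forall a b : 'I_n, (a <= b)%N -> (g a <= g b)%O.
Proof.
move=> gS a b; move: {2}(b - a)%N (erefl (b - a)%N) => m; elim: m b => [|m IH] b.
  by move=> /eqP; rewrite subn_eq0 => ba ab; have /val_inj -> : a = b :> nat by lia.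
move=> mE ab; have b1 : (b.-1 < n)%N by have := ltn_ord b; lia.
pose c := Ordinal b1; have sc : simple c by rewrite /simple /=; have := ltn_ord b; lia.
have -> : b = ordS c by apply: ord_inj; rewrite val_ordS //=; lia.
by apply: (Order.POrderTheory.le_trans (IH c _ _) (gS c sc)); rewrite /=; lia.
Qed.
End Ninv.

(** Both v and its inverse are increasing, and an increasing permutation moves no point down. *)
Lemma ninv_eq0_perm n (v : 'S_n) : (forall i, simple i -> (v i < v (ordS i))%N) -> v = 1%g.
Proof.
move=> vS; have v_mono (a b : 'I_n) : (a < b)%N -> (v a < v b)%N.
  move=> ab; have := @adj_mono _ nat n (fun i => (v i : nat)) _ a b (ltnW ab).
  rewrite leEnat => /(_ _) le_ab; rewrite ltn_neqAle le_ab ?andbT; last first.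
    by move=> i /vS/ltnW.
  by rewrite val_eqE (inj_eq perm_inj) -val_eqE neq_ltn ab.
have v'_mono (a b : 'I_n) : (a < b)%N -> ((v^-1)%g a < (v^-1)%g b)%N.
  move=> ab; rewrite ltnNge leq_eqVlt val_eqE (inj_eq perm_inj) -val_eqE.
  rewrite (gtn_eqF ab) /=; apply/negP => /v_mono; rewrite !permKV; lia.
have ge_id (u : 'S_n) : (forall a b : 'I_n, (a < b)%N -> (u a < u b)%N) ->
    forall a : 'I_n, (a <= u a)%N.
  move=> u_mono a; case: a => a an; elim: a an => [//|a IH] an /=.
  have an' : (a < n)%N by lia.
  by apply: (leq_ltn_trans (IH an')); apply: u_mono; rewrite /=.
apply/permP => a; rewrite perm1; apply: ord_inj; apply/eqP; rewrite eqn_leq.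
rewrite ge_id // andbT; have := ge_id _ v'_mono (v a); rewrite permK //.
Qed.

Lemma ell_inv n (w : 'S_n) : ell w^-1 = ell w.
Proof.
have inj2 : injective (fun p : 'I_n * 'I_n => (w p.2, w p.1)).
  by move=> [a b] [a' b'] /= [/perm_inj -> /perm_inj ->].
rewrite /ell -[RHS](card_imset _ inj2); apply: eq_card => -[a b].
rewrite -[a](permKV w) -[b](permKV w).
rewrite -[X in _ = (X \in _)]/((fun p : 'I_n * 'I_n => (w p.2, w p.1)) ((w^-1)%g b, (w^-1)%g a)).
by rewrite mem_imset // !inE /= !permK !permKV andbC.
Qed.

Lemma ell_ninv n (w : 'S_n) : ell w = ninv (fun i => (w i : nat)).
Proof. by []. Qed.

(** * Reduced words and Matsumoto's theorem *)

Section Words.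
Variable n : nat.
Implicit Types (s r : seq 'I_n) (v w : 'S_n).

Lemma ell_adjl w i : simple i -> (w i < w (ordS i))%N -> ell (adj i * w) = (ell w).+1.
Proof.
move=> si wi; rewrite ell_ninv -(@ninv_swap _ nat n (fun i => (w i : nat)) i) //.
by apply: eq_card => -[a b]; rewrite !inE /= !permM.
Qed.

Lemma ell_adjl_desc w i : simple i -> (w (ordS i) < w i)%N ->
  ell w = (ell (adj i * w)).+1.
Proof.
move=> si wi; rewrite -(@ell_adjl _ i) // ?permM ?tpermL ?tpermR //.
by rewrite mulgA tperm2 mul1g.
Qed.

Lemma perm_ascdesc w i : simple i -> (w i < w (ordS i))%N \/ (w (ordS i) < w i)%N.
Proof.
move=> si; case: (ltngtP (w i) (w (ordS i))) => [||/val_inj/perm_inj e]; [by left|by right|].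
by have := val_ordS si; rewrite -e; lia.
Qed.

Lemma ell_adjl_le w i : simple i -> (ell (adj i * w) <= (ell w).+1)%N.
Proof.
move=> si; case: (perm_ascdesc w si) => wi; first by rewrite ell_adjl.
by have := ell_adjl_desc si wi; lia.
Qed.

Lemma word_perm_nil : word_perm [::] = 1%g :> 'S_n.
Proof. by []. Qed.

Lemma word_perm_cons i s : word_perm (i :: s) = (word_perm s * adj i)%g.
Proof. by []. Qed.

Lemma word_perm_rcons i s : word_perm (rcons s i) = (adj i * word_perm s)%g.
Proof. by elim: s => [|j s IH]; rewrite /word_perm /= ?mul1g ?mulg1 // -!/(word_perm _) IH mulgA. Qed.

Lemma word_permV_cons i s : ((word_perm (i :: s))^-1 = adj i * (word_perm s)^-1)%g.
Proof. by rewrite word_perm_cons invMg tpermV. Qed.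

Lemma ell_word s : all (@simple n) s -> (ell (word_perm s) <= size s)%N.
Proof.
elim: s => [_|i s IH /andP[si /IH ell_s]] /=.
  rewrite -ell_inv word_perm_nil invg1 ell_ninv /ninv eq_card0 // => -[a b].
  by rewrite !inE /= !perm1; lia.
rewrite -ell_inv word_permV_cons; apply: (leq_trans (ell_adjl_le _ si)).
by rewrite ell_inv ltnS.
Qed.

(** Inverses appear because prepending a letter multiplies the inverse on the left, where [ell_adjl]
    reads off the change of length from two neighbouring values. *)
Lemma reduced_word_inv v : exists s,
  [/\ all (@simple n) s, (word_perm s)^-1 = v & size s = ell v]%g.
Proof.
move: {2}(ell v) (erefl (ell v)) => m; elim/ltn_ind: m v => m IH v mE.
have [[i [si vi]]|no_desc] := pselect (exists i, simple i /\ (v (ordS i) < v i)%N).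
  have ev := ell_adjl_desc si vi.
  have [|s [ss sv se]] := IH (ell (adj i * v)) _ (adj i * v)%g erefl; first by lia.
  exists (i :: s); rewrite /= si ss se ev; split=> //.
  by rewrite word_permV_cons sv mulgA tperm2 mul1g.
have v1 : v = 1%g.
  apply: ninv_eq0_perm => i si; case: (perm_ascdesc v si) => // vi.
  by case: no_desc; exists i.
exists [::]; split; rewrite //= ?word_perm_nil ?invg1 ?v1 //.
by have := @ell_word [::] isT; rewrite word_perm_nil /=; lia.
Qed.

Lemma reduced_cons i s w : all (@simple n) (i :: s) -> word_perm (i :: s) = w ->
    size (i :: s) = ell w ->
  ((w^-1)%g (ordS i) < (w^-1)%g i)%N /\ size s = ell (word_perm s).
Proof.
move=> /andP[si ss] <- /= se; have := ell_word ss.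
move: se; rewrite -ell_inv word_permV_cons -[in X in _ -> X](ell_inv).
case: (perm_ascdesc (word_perm s)^-1 si) => wi.
  by rewrite ell_adjl // !permM tpermL tpermR => -[<-]; split.
by move: (ell_adjl_desc si wi); rewrite ell_inv; lia.
Qed.

Section Matsumoto.
Variables (X : Type) (T : 'I_n -> X -> X).
Hypothesis T_comm : forall i j x, simple i -> simple j -> (i.+1 < j)%N ->
  T i (T j x) = T j (T i x).
Hypothesis T_braid : forall i x, simple i -> simple (ordS i) ->
  T i (T (ordS i) (T i x)) = T (ordS i) (T i (T (ordS i) x)).

(** Induction on the length. If the first letters differ, both are descents of the inverse, and the
    permutation also has reduced words starting with either side of the commutation or braid
    relation. Each given word is compared by induction with the one sharing its first letter. *)
Theorem Matsumoto s s' x : all (@simple n) s -> all (@simple n) s' ->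
    word_perm s = word_perm s' -> size s = ell (word_perm s) ->
    size s' = ell (word_perm s) ->
  foldr T x s = foldr T x s'.
Proof.
move: {2}(size s) (erefl (size s)) => m; elim/ltn_ind: m s s' => m IH s s' mE.
case: s mE => [|i s] mE; case: s' => [//|j s'] /= => a1 a2 pE e1 e2.
- by rewrite -e1 in e2.
- by rewrite -e1 in e2.
wlog ij : i j s s' a1 a2 pE e1 e2 mE / (i <= j)%N.
  move=> wl; have [ij|/ltnW ji] := leqP i j; first exact: wl.
  by symmetry; apply: wl => //; rewrite -?pE //; move: mE => /=; lia.
have [wi si'] := reduced_cons a1 erefl e1.
have [wj sj'] : ((word_perm (i :: s))^-1%g (ordS j) < (word_perm (i :: s))^-1%g j)%N /\ size s' = ell (word_perm s').
  by apply: (@reduced_cons j s') => //.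
have /andP[si ss] := a1; have /andP[sj ss'] := a2.
have [eij|nij] := eqVneq i j.
  subst j; congr (T i _); apply: (IH (size s)) => //; first by rewrite -mE.
    by apply: (mulIg (adj i)); rewrite -!word_perm_cons.
  by move: e2; rewrite /= -e1 => -[->].
have {nij} ij' : (i < j)%N by rewrite ltn_neqAle ij andbT.
set v := ((word_perm (i :: s))^-1)%g in wi wj.
have ps : ((word_perm s)^-1 = adj i * v)%g.
  by rewrite /v word_permV_cons mulgA tperm2 mul1g.
have ps' : ((word_perm s')^-1 = adj j * v)%g.
  by rewrite /v (pE : word_perm (i :: s) = word_perm (j :: s')) word_permV_cons mulgA tperm2 mul1g.
have ev : ell v = (size s).+1 by rewrite /v ell_inv -e1.
have szE : size s = size s' by move: e2; rewrite -e1 => -[].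
have sE : size s = ell (adj i * v) by rewrite -ps ell_inv.
have sE' : size s' = ell (adj j * v) by rewrite -ps' ell_inv.
have jS : (i.+1 < j)%N \/ j = ordS i.
  have [|] := ltnP i.+1 j; [by left|right].
  by apply: ord_inj; rewrite val_ordS //=; lia.
have mS : m = (size s).+1 by rewrite -mE.
case: jS => [ij2|jE].
  have [ddi ddi' _ _] := adj_far si sj ij2; have comm := adj_comm si sj ij2.
  (* [r] completes both i j and j i to reduced words of the given permutation. *)
  have [r [ar rv re]] := reduced_word_inv (adj j * (adj i * v))%g.
  have d1 : ell (adj i * v) = (ell (adj j * (adj i * v))).+1.
    by apply: ell_adjl_desc => //; rewrite !permM ddi ddi'.
  have -> : foldr T x s = foldr T x (j :: r).
    apply: (IH (size s)); rewrite ?mS //= ?sj ?ar //.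
    - apply: invg_inj; rewrite !word_permV_cons rv ps.
      by rewrite !mulgA tperm2 mul1g.
    - by rewrite re -d1 -sE.
  have -> : foldr T x s' = foldr T x (i :: r).
    apply: (IH (size s')); rewrite ?mS -?szE //= ?si ?ar //.
    - apply: invg_inj; rewrite !word_permV_cons rv ps'.
      by rewrite [(adj j * (adj i * v))%g]mulgA -comm !mulgA tperm2 mul1g.
    - by rewrite szE sj'.
    - by rewrite re -d1 -sE szE sj'.
  by rewrite /= T_comm.
rewrite {}jE in sj wj ps' sE' *.
have [t1 t2] := adj_near si sj; have braid := adj_braid si sj.
set j' := ordS i in sj wi wj ps' sE' t1 t2 braid *.
(* Now [r] completes i j' i and j' i j', the two reduced words of the longest element generated by
   the two reflections. *)
have [r [ar rv re]] := reduced_word_inv (adj i * (adj j' * (adj i * v)))%g.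
have d1 : ell (adj i * v) = (ell (adj j' * (adj i * v))).+1.
  by apply: ell_adjl_desc => //; rewrite !permM t1 tpermR; apply: (ltn_trans wj).
have d2 : ell (adj j' * (adj i * v)) = (ell (adj i * (adj j' * (adj i * v)))).+1.
  by apply: ell_adjl_desc => //; rewrite !permM t2 !tpermL t1.
have ii : (adj i * (adj i * v) = v)%g by rewrite mulgA tperm2 mul1g.
have -> : foldr T x s = foldr T x (j' :: i :: r).
  apply: (IH (size s)); rewrite ?mS //= ?sj ?si ?ar //.
  - apply: invg_inj; rewrite !word_permV_cons rv ps.
    by rewrite [(adj i * (adj i * _))%g]mulgA tperm2 mul1g [(adj j' * (adj j' * _))%g]mulgA tperm2 mul1g.
  - by rewrite re -d2 -d1 -sE.
have -> : foldr T x s' = foldr T x (i :: j' :: r).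
  apply: (IH (size s')); rewrite ?mS -?szE //= ?sj ?si ?ar //.
  - apply: invg_inj; rewrite !word_permV_cons rv ps'.
    rewrite [RHS](_ : _ = (adj i * adj j' * adj i) * (adj j' * (adj i * v)))%g; last by rewrite !mulgA.
    by rewrite braid -!mulgA [(adj j' * (adj j' * _))%g]mulgA tperm2 mul1g ii.
  - by rewrite szE sj'.
  - by rewrite re -d2 -d1 -sE szE sj'.
by rewrite /= T_braid.
Qed.
End Matsumoto.
End Words.

(** * The permutation action on rational functions *)

Section Ract.
Variables (F : fieldType) (l : nat).
Notation K := (ratfun F l).
Notation tofrac := (@FracField.tofrac (mpoly.mpoly l F)).
Implicit Types (f g : K) (w : 'S_l).

Lemma frac_reprE f :
  f = tofrac \n_(generic_quotient.repr f) / tofrac \d_(generic_quotient.repr f).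
Proof.
set z := generic_quotient.repr f; have dz : \d_z != 0 by apply: denom_ratioP.
apply: (mulIf (x := tofrac \d_z)); first by rewrite tofrac_eq0.
rewrite mulfVK ?tofrac_eq0 // -[f in LHS]generic_quotient.reprK -/z.
unlock FracField.tofrac; rewrite -[LHS]FracField.pi_mul.
apply/generic_quotient.eqmodP; rewrite /= FracField.equivfE /FracField.mulf /=.
by rewrite !numden_Ratio ?mulf_neq0 ?mulr1 ?oner_neq0 // mulrC.
Qed.

Lemma msym_neq0 w (p : mpoly.mpoly l F) : p != 0 -> msym w p != 0.
Proof. by move=> p0; rewrite -(msym0 _ w) (inj_eq (@inj_msym _ _ w)). Qed.

(** [ract] is defined through a chosen representative; independence of that choice is what makes it
    a field automorphism. *)
Lemma ract_frac w p r : r != 0 ->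
  ract w (tofrac p / tofrac r) = tofrac (msym w p) / tofrac (msym w r).
Proof.
move=> r0; rewrite /Defs.ract; set z := generic_quotient.repr _.
have dz : \d_z != 0 by apply: denom_ratioP.
apply/eqP; rewrite eqr_div ?tofrac_eq0 ?msym_neq0 // -!tofracM tofrac_eq -!msymM.
rewrite (inj_eq (@inj_msym _ _ w)) -tofrac_eq !tofracM.
by rewrite -eqr_div ?tofrac_eq0 // -frac_reprE.
Qed.

Lemma ract_tofrac w p : ract w (tofrac p) = tofrac (msym w p).
Proof.
by rewrite -[tofrac p]divr1 -tofrac1 ract_frac ?oner_neq0 // msym1 tofrac1 divr1.
Qed.

Lemma tofrac_subdiv (a b c d : mpoly.mpoly l F) : b != 0 -> d != 0 ->
  tofrac a / tofrac b - tofrac c / tofrac d = tofrac (a * d - c * b) / tofrac (b * d).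
Proof.
move=> b0 d0; rewrite tofracB !tofracM -mulNr addf_div ?tofrac_eq0 //.
by rewrite mulNr.
Qed.

Lemma ract_zmod w : zmod_morphism (ract w : K -> K).
Proof.
move=> f g; rewrite [f]frac_reprE [g]frac_reprE.
move: (generic_quotient.repr f) (generic_quotient.repr g) => y z.
have dy : \d_y != 0 by apply: denom_ratioP.
have dz : \d_z != 0 by apply: denom_ratioP.
rewrite (ract_frac w _ dy) (ract_frac w _ dz) tofrac_subdiv //.
rewrite (ract_frac w _ (mulf_neq0 dy dz)) tofrac_subdiv ?msym_neq0 //.
by rewrite msymB !msymM.
Qed.

Lemma ract_monoid w : monoid_morphism (ract w : K -> K).
Proof.
split; first by rewrite -tofrac1 ract_tofrac msym1.
move=> f g; rewrite [f]frac_reprE [g]frac_reprE.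
move: (generic_quotient.repr f) (generic_quotient.repr g) => y z.
have dy : \d_y != 0 by apply: denom_ratioP.
have dz : \d_z != 0 by apply: denom_ratioP.
rewrite mulf_div -!tofracM (ract_frac w _ dy) (ract_frac w _ dz) (ract_frac w _ (mulf_neq0 dy dz)).
by rewrite mulf_div !msymM !tofracM.
Qed.

HB.instance Definition _ w := GRing.isZmodMorphism.Build K K (ract w) (ract_zmod w).
HB.instance Definition _ w := GRing.isMonoidMorphism.Build K K (ract w) (ract_monoid w).

Lemma ractM w v f : ract (w * v)%g f = ract v (ract w f).
Proof.
rewrite [f]frac_reprE; move: (generic_quotient.repr f) => y.
have dy : \d_y != 0 by apply: denom_ratioP.
by rewrite !(ract_frac _ _ dy) (ract_frac _ _ (msym_neq0 _ dy)) !msymMm.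
Qed.

Lemma ract1 f : ract 1%g f = f.
Proof.
rewrite {1}[f]frac_reprE ract_frac ?denom_ratioP // !msym1m -frac_reprE //.
Qed.

Lemma ract_rx w i : ract w (rx F i) = rx F (w i).
Proof.
rewrite /rx ract_tofrac msymX; congr (tofrac 'X_[_]).
apply/mnmP => j; rewrite mnmE !mnm1E; congr (nat_of_bool _).
by rewrite -(inj_eq (@perm_inj _ w)) permKV.
Qed.

Lemma ract_rcst w (c : F) : ract w (rcst l c) = rcst l c.
Proof.
rewrite /rcst ract_tofrac -[mpoly.mpolyC _ c]mulr1 mpoly.mul_mpolyC msymZ msym1.
by rewrite -mpoly.mul_mpolyC mulr1.
Qed.

Lemma rcst_zmod : zmod_morphism (@rcst F l).
Proof. by move=> a b; rewrite /rcst mpoly.mpolyCB tofracB. Qed.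
Lemma rcst_monoid : monoid_morphism (@rcst F l).
Proof. by split=> [|a b]; rewrite /rcst ?mpoly.mpolyC1 ?tofrac1 // mpoly.mpolyCM tofracM. Qed.
HB.instance Definition _ := GRing.isZmodMorphism.Build F K (@rcst F l) rcst_zmod.
HB.instance Definition _ := GRing.isMonoidMorphism.Build F K (@rcst F l) rcst_monoid.

Lemma rx_neq0 (i : 'I_l) : rx F i != 0.
Proof.
rewrite /rx tofrac_eq0; apply/eqP => /(congr1 (mpoly.mcoeff U_(i)%MM)) /eqP.
by rewrite mcoeffX eqxx mpoly.mcoeff0 oner_eq0.
Qed.

Lemma rx_inj : injective (@rx F l).
Proof.
move=> i j /eqP; rewrite /rx tofrac_eq => /eqP/(congr1 (mpoly.mcoeff U_(i)%MM)).
rewrite !mcoeffX !eq_mnm1 eqxx; case: (j =P i) => [-> //|_] /eqP.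
by rewrite oner_eq0.
Qed.

Lemma ract_rmon w lam : ract w (rmon F lam) = rmon F (wact w lam).
Proof.
rewrite /rmon rmorph_prod [RHS](reindex_inj (@perm_inj _ w)) /=.
apply: eq_bigr => i _; rewrite /wact ffunE permK.
by rewrite fmorphXz /= ract_rx.
Qed.

Lemma rmonD (lam mu : weight l) : rmon F (lam + mu) = rmon F lam * rmon F mu.
Proof.
rewrite /rmon -big_split; apply: eq_bigr => i _.
by rewrite ffunE expfzDr ?rx_neq0.
Qed.

Lemma rmon0 : rmon F (0 : weight l) = 1.
Proof. by rewrite /rmon big1 // => i _; rewrite ffunE expr0z. Qed.

End Ract.

(** * Permutations of weights and dominant rearrangements *)

Section WeightAction.
Variable l : nat.
Implicit Types (w v : 'S_l) (lam mu : weight l).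

Lemma wactM w v lam : wact (w * v)%g lam = wact v (wact w lam).
Proof. by apply/ffunP => i; rewrite !ffunE invMg permM. Qed.
Lemma wact1 lam : wact 1 lam = lam.
Proof. by apply/ffunP => i; rewrite ffunE invg1 perm1. Qed.
Lemma wactK w : cancel (wact w) (wact (w^-1)%g : weight l -> weight l).
Proof. by move=> lam; rewrite -wactM mulgV wact1. Qed.
Lemma wact_tperm i j lam k : wact (tperm i j) lam k = lam (tperm i j k).
Proof. by rewrite ffunE tpermV. Qed.
Lemma wactD w lam mu : wact w (lam + mu) = wact w lam + wact w mu.
Proof. by apply/ffunP => i; rewrite !ffunE. Qed.
Lemma wactN w lam : wact w (- lam) = - wact w lam.
Proof. by apply/ffunP => i; rewrite !ffunE. Qed.

Lemma dominantP lam :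
  reflect (forall i j : 'I_l, (i <= j)%N -> lam j <= lam i) (dominant lam).
Proof.
apply: (iffP forallP) => [H i j ij|H i].
  by have /forallP/(_ j)/implyP := H i; apply.
by apply/forallP => j; apply/implyP; apply: H.
Qed.

Let sortl lam := sort >=%R [seq lam i | i <- enum 'I_l].
Let size_sortl lam : size (sortl lam) = l.
Proof. by rewrite size_sort size_map size_enum_ord. Qed.

Lemma wplus_dominant lam : dominant (wplus lam).
Proof.
apply/dominantP => i j ij; rewrite !ffunE -/(sortl lam).
have srt : sorted >=%R (sortl lam) by apply: sort_sorted => a b; apply: le_total.
apply: (sorted_leq_nth _ _ 0 srt) => //.
- by move=> a b c ba cb; apply: le_trans ba.
- by move=> a; apply: lexx.
- by rewrite inE size_sortl.
- by rewrite inE size_sortl.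
Qed.

Lemma wplusP lam : exists w, wact w (wplus lam) = lam.
Proof.
have : perm_eq (sortl lam) [tuple lam i | i < l] by rewrite perm_sort.
move=> /tuple_permP[p sE]; exists p; apply/ffunP => i.
rewrite !ffunE -/(sortl lam) sE -tnth_nth !tnth_mktuple.
by rewrite permKV.
Qed.

(** Two decreasing rearrangements of one multiset coincide. *)
Lemma dominant_orbit w lam :
  dominant lam -> dominant (wact w lam) -> wact w lam = lam.
Proof.
have srt mu : dominant mu -> sorted >=%R [seq mu i | i <- enum 'I_l].
  move=> /dominantP dmu; apply/(sortedP 0) => k; rewrite size_map size_enum_ord => kl.
  have kl' : (k < l)%N by apply: ltn_trans kl.
  have nthE m (H : (m < l)%N) : [seq mu i | i <- enum 'I_l]`_m = mu (Ordinal H).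
    rewrite (nth_map (Ordinal H)) ?size_enum_ord //; congr (mu _).
    exact: (nth_ord_enum (Ordinal H) (Ordinal H)).
  by rewrite (nthE _ kl) (nthE _ kl'); apply: dmu => /=.
move=> /srt s1 /srt s2; have trr : transitive (>=%R : rel int).
  by move=> a b c ba cb; apply: le_trans ba.
have aa : antisymmetric (>=%R : rel int) by move=> a b; rewrite andbC => /le_anti.
have pe : perm_eq [seq wact w lam i | i <- enum 'I_l] [seq lam i | i <- enum 'I_l].
  have -> : [seq wact w lam i | i <- enum 'I_l] =
     [seq lam i | i <- [seq (w^-1)%g i | i <- enum 'I_l]].
    by rewrite -[RHS]map_comp; apply: eq_map => i; rewrite ffunE.
  apply: perm_map; apply: uniq_perm; last 1 first.
  - move=> i; rewrite mem_enum; apply/mapP; exists (w i); rewrite ?mem_enum //.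
    by rewrite permK.
  - by rewrite (map_inj_uniq (@perm_inj _ _)) enum_uniq.
  - exact: enum_uniq.
have nthE mu (i : 'I_l) : [seq mu i | i <- enum 'I_l]`_i = mu i :> int.
  by rewrite (nth_map i) ?size_enum_ord //; congr (mu _); apply: nth_ord_enum.
by apply/ffunP => i; rewrite -!nthE (sorted_eq trr aa s2 s1 pe).
Qed.

Lemma wplus_orbit w lam : dominant lam -> wplus (wact w lam) = lam.
Proof.
move=> dl; have [v vE] := wplusP (wact w lam).
have := wplus_dominant (wact w lam).
have -> : wplus (wact w lam) = wact (w * v^-1)%g lam by rewrite wactM -{2}vE wactK.
exact: dominant_orbit.
Qed.

End WeightAction.

(** * Demazure-Lusztig operators *)

(** Value at h of a Demazure-Lusztig operator, with f and g standing for s h and h. Keeping them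
    independent turns the Hecke relations into identities between rational expressions in a few
    field elements. *)
Definition dl (K : fieldType) (q x y f g : K) := q * f + (1 - q) / (1 - y / x) * (f - g).

Section AbstractDemazureLusztig.
Variables (K : fieldType) (q x y : K) (s : {rmorphism K -> K}).
Hypotheses (x0 : x != 0) (y0 : y != 0) (xy : x - y != 0) (yx : y - x != 0).
Hypotheses (sK : involutive s) (sq : s q = q) (sx : s x = y) (sy : s y = x).

Lemma rmorph_dl (a b f g : K) : s (dl q a b f g) = dl q (s a) (s b) (s f) (s g).
Proof. by rewrite /dl rmorphD !rmorphM fmorphV !rmorphB rmorph1 fmorph_div /= sq. Qed.

Lemma dl_quadratic f : let T f := dl q x y (s f) f in
  T (T f) = (q - 1) * T f + q * f.
Proof.
rewrite /= rmorph_dl sK sx sy /dl.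
by field; rewrite ?x0 ?y0 ?xy ?yx.
Qed.

Variables (u v : K) (t : {rmorphism K -> K}).
Hypotheses (tq : t q = q) (tx : t x = x) (ty : t y = y) (su : s u = u) (sv : s v = v).

Lemma dl_comm f : (forall f, s (t f) = t (s f)) ->
  dl q x y (s (dl q u v (t f) f)) (dl q u v (t f) f) =
  dl q u v (t (dl q x y (s f) f)) (dl q x y (s f) f).
Proof.
move=> st; rewrite rmorph_dl {2}/dl rmorphD !rmorphM fmorphV !rmorphB rmorph1 fmorph_div /=.
by rewrite su sv tq tx ty st /dl; ring.
Qed.

End AbstractDemazureLusztig.

Lemma dl_braid (K : fieldType) (q x y z : K) (s t : {rmorphism K -> K}) (f : K) :
  x != 0 -> y != 0 -> z != 0 -> x - y != 0 -> y - x != 0 ->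
  y - z != 0 -> z - y != 0 -> x - z != 0 -> z - x != 0 ->
  involutive s -> involutive t -> s q = q -> t q = q ->
  s x = y -> s y = x -> s z = z -> t x = x -> t y = z -> t z = y ->
  s (t (s f)) = t (s (t f)) ->
  let S f := dl q x y (s f) f in let T f := dl q y z (t f) f in
  S (T (S f)) = T (S (T f)).
Proof.
move=> x0 y0 z0 xy yx yz zy xz zx sK tK sq tq sx sy sz tx ty tz st S T; rewrite /S /T.
rewrite !(rmorph_dl sq, rmorph_dl tq) !(sK, tK, sx, sy, sz, tx, ty, tz) st.
move: (s (t (s f))) (t (s f)) (s (t f)) (t (s (t f))) (s f) (t f) => a b c d e g; rewrite /dl.
by field; rewrite ?x0 ?y0 ?z0 ?xy ?yx ?yz ?zy ?xz ?zx.
Qed.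

Section HeckeOperators.
Local Opaque Defs.ract rmon rx rcst.
Variables (F : fieldType) (l : nat) (q : F).
Notation K := (ratfun F l).
Notation T := (@T_simple F l q).
Implicit Types (f g : K) (i j : 'I_l) (w : 'S_l) (lam : weight l).

Lemma rx_sub_neq0 i j : i != j -> rx F i - rx F j != 0.
Proof. by move=> ij; rewrite subr_eq0 (inj_eq (@rx_inj _ _)). Qed.

Lemma ordS_neq i : simple i -> i != ordS i.
Proof. by move=> si; rewrite ord_eqE val_ordS // ltn_eqF. Qed.

Lemma T_dl i f : T i f =
  dl (rcst l q) (rx F i) (rx F (ordS i)) (ract (adj i) f) f.
Proof. by rewrite /T_simple /dl rmorphB rmorph1. Qed.

Lemma ract_adjK i : involutive (ract (adj i) : K -> K).
Proof. by move=> h; rewrite -ractM tperm2 ract1. Qed.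

Lemma T_simple_quadratic i f : simple i ->
  T i (T i f) = rcst l (q - 1) * T i f + rcst l q * f.
Proof.
move=> si; have ij := ordS_neq si.
rewrite !T_dl rmorphB rmorph1.
apply: (@dl_quadratic _ _ _ _ (ract (adj i))); rewrite ?rx_neq0 ?rx_sub_neq0 //.
- by rewrite eq_sym.
- exact: ract_adjK.
- exact: ract_rcst.
- by rewrite /= ract_rx tpermL.
- by rewrite /= ract_rx tpermR.
Qed.

Lemma T_simple_braid i f : simple i -> simple (ordS i) ->
  T i (T (ordS i) (T i f)) = T (ordS i) (T i (T (ordS i) f)).
Proof.
move=> si sj; set j := ordS i in sj *; set k := ordS j.
have ij : i != j by apply: ordS_neq.
have jk : j != k by apply: ordS_neq.
have ik : i != k by rewrite ord_eqE !val_ordS // ltn_eqF.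
have [si_k sj_i] := adj_near si sj; have braid := adj_braid si sj.
have bf : ract (adj i) (ract (adj j) (ract (adj i) f)) =
          ract (adj j) (ract (adj i) (ract (adj j) f)).
  by rewrite -!ractM !mulgA braid.
rewrite !T_dl.
have rs := rx_sub_neq0.
have ji : j != i by rewrite eq_sym.
have kj : k != j by rewrite eq_sym.
have ki : k != i by rewrite eq_sym.
have sij : ract (adj i) (rx F i) = rx F j by rewrite ract_rx tpermL.
have si' : ract (adj i) (rx F j) = rx F i by rewrite ract_rx tpermR.
have sk : ract (adj i) (rx F k) = rx F k by rewrite ract_rx si_k.
have ti : ract (adj j) (rx F i) = rx F i by rewrite ract_rx sj_i.
have tj : ract (adj j) (rx F j) = rx F k by rewrite ract_rx tpermL.
have tk : ract (adj j) (rx F k) = rx F j by rewrite ract_rx tpermR.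
exact: (@dl_braid K (rcst l q) _ _ _ (ract (adj i)) (ract (adj j)) f
  (rx_neq0 F i) (rx_neq0 F j) (rx_neq0 F k) (rs _ _ ij) (rs _ _ ji) (rs _ _ jk)
  (rs _ _ kj) (rs _ _ ik) (rs _ _ ki) (@ract_adjK i) (@ract_adjK j)
  (ract_rcst _ _) (ract_rcst _ _) sij si' sk ti tj tk bf).
Qed.

Lemma T_simple_comm i j f : simple i -> simple j -> (i.+1 < j)%N ->
  T i (T j f) = T j (T i f).
Proof.
move=> si sj ij.
have [ddi ddi' ddj ddj'] := adj_far si sj ij; have comm := adj_comm si sj ij.
rewrite !T_dl.
have e1 : ract (adj i) (rx F j) = rx F j by rewrite ract_rx ddi.
have e2 : ract (adj i) (rx F (ordS j)) = rx F (ordS j) by rewrite ract_rx ddi'.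
have e3 : ract (adj j) (rx F i) = rx F i by rewrite ract_rx ddj.
have e4 : ract (adj j) (rx F (ordS i)) = rx F (ordS i) by rewrite ract_rx ddj'.
have cf (h : K) : ract (adj i) (ract (adj j) h) = ract (adj j) (ract (adj i) h).
  by rewrite -!ractM comm.
exact: (@dl_comm K (rcst l q) _ _ (ract (adj i)) (ract_rcst _ _) _ _ (ract (adj j))
  (ract_rcst _ _) e3 e4 e1 e2 f cf).
Qed.

Hypothesis q0 : q != 0.
Notation c := (rcst l).

Lemma rcst_neq0 (a : F) : a != 0 -> rcst l a != 0.
Proof. by move=> a0; rewrite fmorph_eq0. Qed.

Lemma T_simpleZ i (a : F) f : T i (c a * f) = c a * T i f.
Proof. by rewrite /T_simple rmorphM /= ract_rcst; ring. Qed.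

(** Read off from T^2 = (q - 1) T + q. *)
Definition T_simple_inv i f : K := (T i f + c (1 - q) * f) / c q.

Lemma T_simpleK i : simple i -> cancel (T i) (T_simple_inv i).
Proof.
move=> si f; rewrite /T_simple_inv T_simple_quadratic //.
apply: (mulIf (rcst_neq0 q0)); rewrite mulfVK ?rcst_neq0 //.
by rewrite !rmorphB rmorph1; ring.
Qed.

Lemma T_simpleD i f g : T i (f + g) = T i f + T i g.
Proof. by rewrite /T_simple rmorphD /=; ring. Qed.

Lemma T_simpleVK i : simple i -> cancel (T_simple_inv i) (T i).
Proof.
move=> si f; rewrite /T_simple_inv -fmorphV mulrC T_simpleZ T_simpleD T_simpleZ.
rewrite T_simple_quadratic // fmorphV; apply: (mulfI (rcst_neq0 q0)).
rewrite mulrA mulfV ?rcst_neq0 // mul1r !rmorphB rmorph1; ring.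
Qed.

Lemma T_perm_word w s f : all (@simple l) s -> word_perm s = w -> size s = ell w ->
  T_perm q w f = foldr T f s.
Proof.
move=> ss sw se; rewrite /T_perm; case: pickP => [t /andP[ts /eqP tw]|/(_ (tcast se (in_tuple s)))].
  apply: (Matsumoto T_simple_comm T_simple_braid) => //; rewrite tw ?sw //.
  by rewrite size_tuple.
by rewrite val_tcast /= ss sw eqxx.
Qed.

Lemma reduced_word w : exists s,
  [/\ all (@simple l) s, word_perm s = w & size s = ell w].
Proof.
have [s [ss sw se]] := reduced_word_inv w^-1.
by exists s; split; rewrite // ?se ?ell_inv //; apply: invg_inj.
Qed.

Lemma T_perm_adj w i f : simple i -> (w i < w (ordS i))%N ->
  T_perm q (adj i * w) f = T_perm q w (T i f).
Proof.
move=> si wi; have [s [ss sw se]] := reduced_word w.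
rewrite (T_perm_word _ ss sw se) (@T_perm_word _ (rcons s i)).
- by rewrite foldr_rcons.
- by rewrite all_rcons si.
- by rewrite word_perm_rcons sw.
- by rewrite size_rcons se ell_adjl.
Qed.

Lemma T_permZ w (a : F) f : T_perm q w (c a * f) = c a * T_perm q w f.
Proof.
have [s [ss sw se]] := reduced_word w; rewrite !(T_perm_word _ ss sw se).
by elim: s {ss sw se} => //= i s ->; rewrite T_simpleZ.
Qed.

Lemma T_perm_bij w : bijective (T_perm q w : K -> K).
Proof.
have [s [ss sw se]] := reduced_word w.
apply: (eq_bij (f := fun f => foldr T f s)) => [|f]; last by rewrite (T_perm_word f ss sw se).
elim: s ss {sw se} => [_|i s IH /= /andP[si /IH sb]]; first by exists id.
have Tb : bijective (T i) by exists (T_simple_inv i); [apply: T_simpleK|apply: T_simpleVK].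
exact: (bij_comp Tb sb).
Qed.

Lemma T_perm_invK w f : T_perm q w (T_perm_inv q w f) = f.
Proof.
rewrite /T_perm_inv; case: xgetP => [g -> //|no].
by have [g _ gK] := T_perm_bij w; case: (no (g f)); apply: gK.
Qed.

Lemma T_permK w f : T_perm_inv q w (T_perm q w f) = f.
Proof. by apply: (bij_inj (T_perm_bij w)); rewrite T_perm_invK. Qed.

Lemma T_perm_invZ w (a : F) f : T_perm_inv q w (c a * f) = c a * T_perm_inv q w f.
Proof. by apply: (bij_inj (T_perm_bij w)); rewrite T_permZ !T_perm_invK. Qed.

Lemma T_simple_rmon i lam : simple i -> lam i = lam (ordS i) ->
  T i (rmon F lam) = c q * rmon F lam.
Proof.
move=> si lamE; have slam : wact (adj i) lam = lam.
  by apply/ffunP => k; rewrite wact_tperm; case: tpermP => [->|->|].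
by rewrite /T_simple ract_rmon slam subrr mulr0 addr0.
Qed.

(** The permutation z relating w and v fixes the dominant weight lam, so a descent i of z forces
    lam_i = lam_(i + 1). Then T_i multiplies x^lam by q, which the normalization cancels, and the
    descent can be removed from z. *)
Lemma T_perm_stab lam w v : dominant lam -> wact w lam = wact v lam ->
  c q ^- ell w * T_perm q w (rmon F lam) = c q ^- ell v * T_perm q v (rmon F lam).
Proof.
move=> dl.
have step u i : simple i -> lam i = lam (ordS i) ->
    c q ^- ell (adj i * u) * T_perm q (adj i * u) (rmon F lam) =
    c q ^- ell u * T_perm q u (rmon F lam).
  move=> si li; wlog ui : u / (u i < u (ordS i))%N.
    move=> wl; case: (perm_ascdesc u si) => ui; first exact: wl.
    rewrite -wl ?permM ?tpermL ?tpermR //.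
    by rewrite mulgA tperm2 mul1g.
  rewrite T_perm_adj // T_simple_rmon // T_permZ ell_adjl // exprS invfM.
  by rewrite mulrACA mulVf ?rcst_neq0 // mul1r.
move=> wv; pose z := (w * v^-1)%g.
have zl : wact z lam = lam by rewrite /z wactM wv wactK.
have -> : w = (z * v)%g by rewrite /z mulgKV.
move: z zl => z; clear w wv; move: {2}(ell z) (erefl (ell z)) => m.
elim/ltn_ind: m z => m IH z mE zl.
have [[i [si zi]]|no_desc] := pselect (exists i, simple i /\ (z (ordS i) < z i)%N).
  have lz k : lam (z k) = lam k by rewrite -[in LHS]zl ffunE permK.
  have li : lam i = lam (ordS i).
    apply: le_anti; rewrite -[lam i <= _]/_ -{1}(lz i) -{1}(lz (ordS i)).
    have /dominantP D := dl; rewrite (D _ _ (ltnW zi)) D // val_ordS //.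
  rewrite -(step (z * v)%g i) // mulgA; apply: (IH _ _ _ erefl).
    by rewrite -mE (ell_adjl_desc si zi).
  rewrite wactM -[RHS]zl; congr (wact z _).
  by apply/ffunP => k; rewrite wact_tperm; case: tpermP => [->|->|].
have -> : z = 1%g.
  apply: ninv_eq0_perm => i si; case: (perm_ascdesc z si) => // zi.
  by case: no_desc; exists i.
by rewrite mul1g.
Qed.

Lemma E_polE lam w : dominant lam ->
  E_pol q (wact w lam) = c q ^- ell w * T_perm q w (rmon F lam).
Proof.
move=> dl; rewrite /E_pol wplus_orbit //; case: pickP => [v /eqP vw|/(_ w)].
  exact: T_perm_stab.
by rewrite eqxx.
Qed.

Lemma E_twistE (sigma : 'S_l) lam : E_twist q sigma^-1 lam =
  c q ^+ #|Inv_perm sigma :&: Inv_eps lam| *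
    T_perm_inv q sigma (E_pol q (wact sigma lam)).
Proof. by rewrite /E_twist invgK. Qed.

(** Every inversion of sigma is counted by [Inv_eps lam], so the prefactor cancels q^(- ell sigma),
    while T_sigma cancels its inverse. *)
Lemma E_twist_dominant sigma lam : dominant lam ->
  E_twist q sigma^-1 lam = rmon F lam.
Proof.
move=> dl; rewrite E_twistE E_polE //.
have -> : Inv_perm sigma :&: Inv_eps lam = Inv_perm sigma.
  apply/finset.setIidPl/fintype.subsetP => -[i j]; rewrite !inE /= => /andP[ij _].
  by rewrite ij; apply: (dominantP _ dl); apply: ltnW.
rewrite -rmorphXn -fmorphV T_perm_invZ T_permK mulrA -rmorphM /=.
by rewrite mulfV ?rmorph1 ?mul1r // expf_neq0.
Qed.

(** Both sides come from the same [E_pol], since the swap of lam is compensated by that of sigma,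
    and T of the longer permutation is T_sigma T_i. Only the powers of q remain to be compared. *)
Lemma E_twist_adj (sigma : 'S_l) lam i : simple i -> (sigma i < sigma (ordS i))%N ->
  T i (E_twist q (adj i * sigma)^-1 (wact (adj i) lam)) =
  c q ^+ (lam i <= lam (ordS i))%R * E_twist q sigma^-1 lam.
Proof.
have e : wact (adj i) (wact (adj i) lam) = lam by rewrite -wactM tperm2 wact1.
move=> si s_i; rewrite !E_twistE wactM e.
have -> : #|Inv_perm (adj i * sigma) :&: Inv_eps (wact (adj i) lam)| =
   ((lam i <= lam (ordS i))%R + #|Inv_perm sigma :&: Inv_eps lam|)%N.
  pose R a b := (sigma b < sigma a)%N && (lam b <= lam a)%R.
  transitivity #|[set p : 'I_l * 'I_l | (p.1 < p.2)%N & R (adj i p.1) (adj i p.2)]|.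
    apply: eq_card => -[a b]; rewrite !inE /R /= !permM !wact_tperm.
    by case: (a < b)%N.
  rewrite card_pairs_adj /R ?s_i // ?negb_and -?leqNgt ?(ltnW s_i) //.
  by congr (_ + _)%N; apply: eq_card => -[a b]; rewrite !inE /=; case: (a < b)%N.
rewrite -rmorphXn T_simpleZ exprD rmorphM !rmorphXn /= -mulrA; congr (_ * (_ * _)).
apply: (bij_inj (T_perm_bij sigma)); rewrite -T_perm_adj // !T_perm_invK.
by [].
Qed.

End HeckeOperators.

(** * Group algebras *)

Lemma fsum1 (V : nmodType) (T : choiceType) (s : {fset T}) (F : T -> V) x :
    (x \notin s -> F x = 0) -> (forall y, y \in s -> y != x -> F y = 0) ->
  \sum_(y <- s) F y = F x.
Proof.
move=> Fx Fy; have [xs|xs] := boolP (x \in s).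
  rewrite (big_fsetD1 x) //= big_seq big1 ?addr0 // => y.
  by rewrite in_fsetD1 => /andP[yx ys]; apply: Fy.
rewrite Fx // big_seq big1 // => y ys; apply: Fy => //.
by apply: contraNneq xs => <-.
Qed.

Lemma fsum_delta (A : pzSemiRingType) (T : choiceType) (s : {fset T}) (F : T -> A) x :
  (x \notin s -> F x = 0) -> \sum_(y <- s) F y * (y == x)%:R = F x.
Proof.
move=> Fx; rewrite (fsum1 (x := x)) ?eqxx ?mulr1 // => y _ /negPf ->.
by rewrite mulr0.
Qed.

(** The coefficient ring is arbitrary because Q[q], truncated power series and Laurent polynomials
    in further variables all occur as coefficients. *)
Definition lau (A : comNzRingType) (W : zmodType) := {malg A[W]}.

HB.instance Definition _ (A : comNzRingType) (W : zmodType) := Choice.on (lau A W).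

(* The operations are locked: comparing unlocked ones up to conversion is costly. *)
HB.lock Definition lzero (A : comNzRingType) (W : zmodType) : lau A W := 0 : {malg A[W]}.
HB.lock Definition lopp (A : comNzRingType) (W : zmodType) (f : lau A W) : lau A W :=
  - (f : {malg A[W]}).
HB.lock Definition ladd (A : comNzRingType) (W : zmodType) (f g : lau A W) : lau A W :=
  (f : {malg A[W]}) + g.
HB.lock Definition lscale (A : comNzRingType) (W : zmodType) (a : A) (f : lau A W) : lau A W :=
  a *: (f : {malg A[W]}).

Section Module.
Variables (A : comNzRingType) (W : zmodType).
Notation L := (lau A W).

Lemma laddA : associative (@ladd A W).
Proof. by rewrite ladd.unlock; apply: addrA. Qed.
Lemma laddC : commutative (@ladd A W).
Proof. by rewrite ladd.unlock; apply: addrC. Qed.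
Lemma ladd0 : left_id (lzero A W) (@ladd A W).
Proof. by rewrite ladd.unlock lzero.unlock; apply: add0r. Qed.
Lemma laddN : left_inverse (lzero A W) (@lopp A W) (@ladd A W).
Proof. by rewrite ladd.unlock lopp.unlock lzero.unlock; apply: addNr. Qed.
HB.instance Definition _ := GRing.isZmodule.Build L laddA laddC ladd0 laddN.

Lemma lscaleA a b (f : L) : lscale a (lscale b f) = lscale (a * b) f.
Proof. by rewrite lscale.unlock; apply: scalerA. Qed.
Lemma lscale1 : left_id 1 (@lscale A W).
Proof. by rewrite lscale.unlock; apply: scale1r. Qed.
Lemma lscaleDr : right_distributive (@lscale A W) +%R.
Proof.
by move=> a f g; rewrite -[f + g]/(ladd f g) -[RHS]/(ladd _ _) lscale.unlock ladd.unlock scalerDr.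
Qed.
Lemma lscaleDl (f : L) : {morph (@lscale A W)^~ f : a b / a + b}.
Proof.
by move=> a b /=; rewrite -[RHS]/(ladd _ _) lscale.unlock ladd.unlock scalerDl.
Qed.
HB.instance Definition _ := GRing.Zmodule_isLmodule.Build A L
  lscaleA lscale1 lscaleDr lscaleDl.
End Module.

HB.lock Definition lc (A : comNzRingType) (W : zmodType) (f : lau A W) (k : W) : A :=
  monalg.mcoeff k f.
HB.lock Definition lmon (A : comNzRingType) (W : zmodType) (k : W) : lau A W :=
  mkmalgU k 1.
HB.lock Definition lsupp (A : comNzRingType) (W : zmodType) (f : lau A W) : {fset W} :=
  monalg.msupp f.
HB.lock Definition lext (A : comNzRingType) (W : zmodType) (V : lmodType A)
    (phi : W -> V) (f : lau A W) : V :=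
  \sum_(k <- lsupp f) lc f k *: phi k.
HB.lock Definition lmul (A : comNzRingType) (W : zmodType) (f g : lau A W) : lau A W :=
  lext (fun k => lext (fun k' => lmon A (k + k')) g) f.

Arguments lmon {A W} k.
Arguments lc {A W} f k.
Arguments lext {A W V} phi f.
Arguments lmul {A W} f g.

Section GroupAlgebra.
Variables (A : comNzRingType) (W : zmodType).
Implicit Types (f g h : lau A W) (k : W) (a : A).
Local Notation lmon := (@lmon A W).
Local Notation lmul := (@lmul A W).

Lemma lauP f g : lc f =1 lc g -> f = g.
Proof. by rewrite lc.unlock => fg; apply/malgP. Qed.

Lemma lcZ a f k : lc (a *: f) k = a * lc f k.
Proof. by rewrite lc.unlock -[a *: f]/(lscale a f) lscale.unlock; apply: monalg.mcoeffZ. Qed.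

Lemma lcD f g k : lc (f + g) k = lc f k + lc g k.
Proof. by rewrite lc.unlock -[f + g]/(ladd f g) ladd.unlock; apply: monalg.mcoeffD. Qed.
Lemma lcN f k : lc (- f) k = - lc f k.
Proof. by rewrite lc.unlock -[- f]/(lopp f) lopp.unlock; apply: monalg.mcoeffN. Qed.
Lemma lc0 k : lc (0 : lau A W) k = 0.
Proof. by rewrite lc.unlock -[0 : lau A W]/(lzero A W) lzero.unlock; apply: monalg.mcoeff0. Qed.
Lemma lc_sum I (r : seq I) (P : pred I) (F : I -> lau A W) k :
  lc (\sum_(i <- r | P i) F i) k = \sum_(i <- r | P i) lc (F i) k.
Proof. exact: (big_morph (lc^~ k) (fun f g => lcD f g k) (lc0 k)). Qed.

Lemma lc_mon k k' : lc (lmon k) k' = (k == k')%:R.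
Proof. by rewrite lc.unlock lmon.unlock mcoeffU. Qed.

Lemma lsuppP f k : (k \in lsupp f) = (lc f k != 0).
Proof. by rewrite lc.unlock lsupp.unlock mcoeff_neq0. Qed.

Lemma lc_out f k : k \notin lsupp f -> lc f k = 0.
Proof. by rewrite lsuppP negbK => /eqP. Qed.

Lemma lauE f : f = \sum_(k <- lsupp f) lc f k *: lmon k.
Proof.
apply: lauP => k; rewrite lc_sum; under eq_bigr do rewrite lcZ lc_mon.
by rewrite fsum_delta // => /lc_out.
Qed.

Lemma lau_ind (P : lau A W -> Prop) :
    P 0 -> (forall f g, P f -> P g -> P (f + g)) ->
    (forall f a k, lc f k != 0 -> a = lc f k -> P (a *: lmon k)) ->
  forall f, P f.
Proof.
move=> P0 PD PM f; rewrite [f]lauE big_seq.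
by apply: (big_ind P) => // k kf; apply: (PM f) => //; rewrite -lsuppP.
Qed.

Lemma lau_ind_supp (Q : W -> Prop) (P : lau A W -> Prop) :
    P 0 -> (forall f g, P f -> P g -> P (f + g)) ->
    (forall a k, Q k -> P (a *: lmon k)) ->
  forall f, (forall k, lc f k != 0 -> Q k) -> P f.
Proof.
move=> P0 PD PM f Qf; rewrite [f]lauE big_seq.
by apply: (big_ind P) => // k kf; apply: PM; apply: Qf; rewrite -lsuppP.
Qed.

Section Extension.
Variables (V : lmodType A) (phi : W -> V).

Local Notation lext := (lext phi).

Lemma lextw (d : {fset W}) f : (lsupp f `<=` d)%fset ->
  lext f = \sum_(k <- d) lc f k *: phi k.
Proof.
move=> fd; rewrite lext.unlock; apply: big_fset_incl => // k _ /lc_out ->.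
by rewrite scale0r.
Qed.

Lemma lext_is_linear : linear lext.
Proof.
move=> a f g; pose d := (lsupp f `|` lsupp g `|` lsupp (a *: f + g)%R)%fset.
rewrite !(@lextw d) ?fsubsetUr //; last 2 first.
- by rewrite /d -fsetUA fsetUCA fsubsetUl.
- by rewrite /d -fsetUA fsubsetUl.
rewrite scaler_sumr -big_split /=; apply: eq_bigr => k _.
by rewrite lcD lcZ scalerDl scalerA.
Qed.
HB.instance Definition _ := GRing.isLinear.Build A (lau A W) V *:%R lext lext_is_linear.

Lemma lext_mon k : lext (lmon k) = phi k.
Proof.
rewrite (@lextw [fset k]%fset) ?big_seq_fset1 ?lc_mon ?eqxx ?scale1r //.
by apply/fsubsetP => k'; rewrite lsuppP lc_mon inE eq_sym; have [//|_] := eqVneq k' k; rewrite mulr0n eqxx.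
Qed.
End Extension.

Lemma lmul_mon k k' : lmul (lmon k) (lmon k') = lmon (k + k').
Proof. by rewrite lmul.unlock !lext_mon. Qed.

Lemma lmul_is_linearl g : linear (lmul^~ g).
Proof. by move=> a f f'; rewrite lmul.unlock linearP. Qed.

Lemma lmulC : commutative lmul.
Proof.
move=> f g; rewrite lmul.unlock lext.unlock.
under eq_bigr do rewrite scaler_sumr.
rewrite exchange_big; apply: eq_bigr => k _; rewrite scaler_sumr.
by apply: eq_bigr => k' _; rewrite !scalerA mulrC addrC.
Qed.

Lemma lmulP a f f' g : lmul (a *: f + f') g = a *: lmul f g + lmul f' g.
Proof. exact: lmul_is_linearl. Qed.
Lemma lmul0 f : lmul 0 f = 0. Proof. by rewrite lmul.unlock linear0. Qed.
Lemma lmulZ a f g : lmul (a *: f) g = a *: lmul f g.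
Proof. by have := lmulP a f 0 g; rewrite lmul0 !addr0. Qed.
Lemma lmulDl : left_distributive lmul +%R.
Proof. by move=> f f' g; rewrite -[f]scale1r lmulP !scale1r. Qed.

Lemma lmulDr f g h : lmul f (g + h) = lmul f g + lmul f h.
Proof. by rewrite !(lmulC f) lmulDl. Qed.
Lemma lmul0r f : lmul f 0 = 0. Proof. by rewrite lmulC lmul0. Qed.
Lemma lmul_monZ a b k k' :
  lmul (a *: lmon k) (b *: lmon k') = (a * b) *: lmon (k + k').
Proof. by rewrite lmulZ lmulC lmulZ lmul_mon scalerA addrC. Qed.

Lemma lmulA : associative lmul.
Proof.
move=> f g h; elim/lau_ind: f => [|f f' IH IH'|_ a k _ _]; first by rewrite !lmul0.
  by rewrite !lmulDl IH IH'.
elim/lau_ind: g => [|g g' IH IH'|_ b k' _ _].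
- by rewrite lmul0r !lmul0 lmul0r.
- by rewrite !lmulDl !lmulDr !lmulDl IH IH'.
elim/lau_ind: h => [|h h' IH IH'|_ c k'' _ _].
- by rewrite !lmul0r.
- by rewrite !lmulDr IH IH'.
by rewrite !lmul_monZ addrA mulrA.
Qed.

Lemma lmul1 : left_id (lmon 0) lmul.
Proof.
move=> f; elim/lau_ind: f => [|f f' IH IH'|_ a k _ _]; rewrite lmulC ?lmul0 //.
  by rewrite lmulDl -!(lmulC (lmon 0)) IH IH'.
by rewrite lmulZ lmul_mon addr0.
Qed.

Lemma lone_neq0 : lmon 0 != 0.
Proof.
by apply/eqP => /(congr1 (fun f => lc f 0)); rewrite lc_mon eqxx lc0; apply/eqP/oner_neq0.
Qed.

HB.instance Definition _ := GRing.Zmodule_isComNzRing.Build (lau A W)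
  lmulA lmulC lmul1 lmulDl lone_neq0.

Lemma lscaleAl a f g : a *: (f * g) = (a *: f) * g.
Proof. by rewrite -[RHS]/(lmul _ _) lmulZ. Qed.
HB.instance Definition _ :=
  GRing.Lmodule_isLalgebra.Build A (lau A W) lscaleAl.
Lemma lscaleAr a f g : a *: (f * g) = f * (a *: g).
Proof. by rewrite mulrC lscaleAl mulrC. Qed.
HB.instance Definition _ := GRing.Lalgebra_isAlgebra.Build A (lau A W) lscaleAr.

Lemma lmonD k k' : lmon (k + k') = lmon k * lmon k'.
Proof. by rewrite -lmul_mon. Qed.
Lemma lmon0 : lmon 0 = 1. Proof. by []. Qed.

Lemma lmonVl k : lmon (- k) * lmon k = 1.
Proof. by rewrite -lmonD addNr. Qed.
Lemma lmonVr k : lmon k * lmon (- k) = 1.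
Proof. by rewrite -lmonD addrN. Qed.

Lemma lmonX k m : lmon k ^+ m = lmon (k *+ m).
Proof. by elim: m => [|m IH]; rewrite ?mulr0n ?lmon0 // exprS IH mulrS lmonD. Qed.

Lemma lmon_sum I (r : seq I) (P : pred I) (F : I -> W) :
  lmon (\sum_(i <- r | P i) F i) = \prod_(i <- r | P i) lmon (F i).
Proof. exact: (big_morph _ lmonD lmon0). Qed.

Lemma lc1 k : lc 1 k = (k == 0)%:R.
Proof. by rewrite -lmon0 lc_mon eq_sym. Qed.

Lemma lcM f g k : lc (f * g) k = \sum_(k' <- lsupp f) lc f k' * lc g (k - k').
Proof.
rewrite {1}[f]lauE mulr_suml lc_sum; apply: eq_bigr => k' _.
rewrite -scalerAl lcZ; congr (_ * _).
rewrite {1}[g]lauE mulr_sumr lc_sum; under eq_bigr do rewrite -scalerAr lcZ -lmonD lc_mon.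
rewrite (fsum1 (x := k - k')) ?subrKC ?eqxx ?mulr1 // => [/lc_out //|j _ /negPf jk].
by rewrite eq_sym addrC -subr_eq eq_sym jk mulr0.
Qed.

Lemma lc_monM k f k' : lc (lmon k * f) k' = lc f (k' - k).
Proof.
have -> : lc (lmon k * f) k' = \sum_(j <- [fset k]%fset) lc (lmon k) j * lc f (k' - j).
  rewrite lcM; apply: big_fset_incl => [|j _ /lc_out ->]; last by rewrite mul0r.
  by apply/fsubsetP => j; rewrite lsuppP lc_mon inE eq_sym; have [//|_] := eqVneq j k; rewrite mulr0n eqxx.
by rewrite big_seq_fset1 lc_mon eqxx mul1r.
Qed.

Definition suppin (Q : W -> Prop) f := forall k, lc f k != 0 -> Q k.

Section Supp.
Variable Q : W -> Prop.

Lemma suppin0 : suppin Q 0.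
Proof. by move=> k; rewrite lc0 eqxx. Qed.

Lemma suppinD f g : suppin Q f -> suppin Q g -> suppin Q (f + g).
Proof.
move=> Qf Qg k; have [f0|/Qf //] := eqVneq (lc f k) 0.
by rewrite lcD f0 add0r => /Qg.
Qed.

Lemma suppinZ a f : suppin Q f -> suppin Q (a *: f).
Proof.
move=> Qf k; have [f0|/Qf //] := eqVneq (lc f k) 0.
by rewrite lcZ f0 mulr0 eqxx.
Qed.

Lemma suppinN f : suppin Q f -> suppin Q (- f).
Proof. by rewrite -scaleN1r; apply: suppinZ. Qed.

Lemma suppin_sum I (r : seq I) (P : pred I) (F : I -> lau A W) :
  (forall i, P i -> suppin Q (F i)) -> suppin Q (\sum_(i <- r | P i) F i).
Proof.
move=> QF; apply: (big_ind (suppin Q)) => //; [exact: suppin0|exact: suppinD].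
Qed.

Lemma suppin_mon k : Q k -> suppin Q (lmon k).
Proof. by move=> Qk k'; rewrite lc_mon; have [<- //|_] := eqVneq k k'; rewrite mulr0n eqxx. Qed.

Lemma suppin1 : Q 0 -> suppin Q 1.
Proof. by rewrite -lmon0; apply: suppin_mon. Qed.

Lemma suppin_ind (P : lau A W -> Prop) f : suppin Q f ->
    P 0 -> (forall f g, P f -> P g -> P (f + g)) ->
    (forall a k, Q k -> P (a *: lmon k)) -> P f.
Proof. by move=> Qf P0 PD PM; apply: (lau_ind_supp (Q := Q)). Qed.
End Supp.

Lemma suppinS (Q Q' : W -> Prop) f :
  (forall k, Q k -> Q' k) -> suppin Q f -> suppin Q' f.
Proof. by move=> QQ' Qf k /Qf/QQ'. Qed.

Lemma suppinM (Q1 Q2 Q : W -> Prop) f g :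
    (forall k k', Q1 k -> Q2 k' -> Q (k + k')) ->
  suppin Q1 f -> suppin Q2 g -> suppin Q (f * g).
Proof.
move=> Q12 Qf Qg; apply: (suppin_ind (P := fun f => suppin Q (f * g)) Qf).
- by rewrite mul0r; apply: suppin0.
- by move=> f1 f2; rewrite mulrDl; apply: suppinD.
move=> a k Qk; rewrite -scalerAl; apply: suppinZ => k'.
by rewrite lc_monM => /Qg/(Q12 _ _ Qk); rewrite subrKC.
Qed.

End GroupAlgebra.

Section Scaling.
Variables (A : comNzRingType) (W : zmodType).

Lemma scale_algE (a : A) (f : lau A W) : a *: f = a%:A * f.
Proof. by rewrite -scalerAl mul1r. Qed.

Definition lcst (a : A) : lau A W := a%:A.
Lemma lcst_zmod : zmod_morphism lcst.
Proof. by move=> a b; rewrite /lcst scalerBl. Qed.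
Lemma lcst_monoid : monoid_morphism lcst.
Proof. by split=> [|a b]; rewrite /lcst ?scale1r // -scalerAl mul1r scalerA. Qed.
HB.instance Definition _ := GRing.isZmodMorphism.Build A (lau A W) lcst lcst_zmod.
HB.instance Definition _ := GRing.isMonoidMorphism.Build A (lau A W) lcst lcst_monoid.

Lemma scale_lcst (a : A) (f : lau A W) : a *: f = lcst a * f.
Proof. exact: scale_algE. Qed.

End Scaling.

(** * Ring homomorphisms out of a group algebra *)

Record wchar (W : zmodType) (C : comNzRingType) := WChar {
  wch :> W -> C;
  wchD : forall k k', wch (k + k') = wch k * wch k';
  wch0 : wch 0 = 1 }.

HB.lock Definition lev (A C : comNzRingType) (W : zmodType) (rho : {rmorphism A -> C})
    (chi : wchar W C) (f : lau A W) : C :=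
  \sum_(k <- lsupp f) rho (lc f k) * chi k.

Arguments lev {A C W} rho chi f.

Section Evaluation.
Variables (A C : comNzRingType) (W : zmodType) (rho : {rmorphism A -> C}).
Variable chi : wchar W C.
Implicit Types (f g : lau A W).

Local Notation lev := (lev rho chi).

Lemma levw (d : {fset W}) f : (lsupp f `<=` d)%fset ->
  lev f = \sum_(k <- d) rho (lc f k) * chi k.
Proof.
move=> fd; rewrite lev.unlock; apply: big_fset_incl => // k _ /lc_out ->.
by rewrite rmorph0 mul0r.
Qed.

Lemma lev_is_zmod_morphism : zmod_morphism lev.
Proof.
move=> f g; pose d := (lsupp f `|` lsupp g `|` lsupp (f - g)%R)%fset.
rewrite !(@levw d) ?fsubsetUr //; last 2 first.
- by rewrite /d -fsetUA fsetUCA fsubsetUl.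
- by rewrite /d -fsetUA fsubsetUl.
rewrite -sumrB; apply: eq_bigr => k _.
by rewrite lcD lcN rmorphB mulrBl.
Qed.
HB.instance Definition _ :=
  GRing.isZmodMorphism.Build (lau A W) C lev lev_is_zmod_morphism.

Lemma lev_mon k : lev (lmon k) = chi k.
Proof.
rewrite (@levw [fset k]%fset) ?big_seq_fset1 ?lc_mon ?eqxx ?rmorph1 ?mul1r //.
by apply/fsubsetP => k'; rewrite lsuppP lc_mon inE eq_sym; have [//|_] := eqVneq k' k; rewrite mulr0n eqxx.
Qed.

Lemma levZ a f : lev (a *: f) = rho a * lev f.
Proof.
rewrite !(@levw (lsupp f)) ?mulr_sumr //; last first.
  by apply/fsubsetP => k; rewrite !lsuppP lcZ; apply: contraNneq => ->; rewrite mulr0.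
by apply: eq_bigr => k _; rewrite lcZ rmorphM mulrA.
Qed.

Lemma lev_is_monoid_morphism : monoid_morphism lev.
Proof.
split; first by rewrite -lmon0 lev_mon wch0.
move=> f g; elim/lau_ind: f => [|f f' IH IH'|_ a k _ _].
- by rewrite mul0r raddf0 mul0r.
- by rewrite mulrDl !raddfD /= IH IH' mulrDl.
elim/lau_ind: g => [|g g' IH IH'|_ b k' _ _].
- by rewrite mulr0 raddf0 mulr0.
- by rewrite mulrDr !raddfD /= IH IH' mulrDr.
rewrite -scalerAl -scalerAr -lmonD !levZ !lev_mon wchD.
by rewrite mulrACA mulrA.
Qed.
HB.instance Definition _ :=
  GRing.isMonoidMorphism.Build (lau A W) C lev lev_is_monoid_morphism.

End Evaluation.

Lemma eq_add_lauP (A : comNzRingType) (W V : zmodType) (F G : {additive lau A W -> V}) :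
  (forall a k, F (a *: lmon k) = G (a *: lmon k)) -> F =1 G.
Proof.
move=> FG f; elim/lau_ind: f => [|f g|_ a k _ _]; rewrite ?raddf0 ?raddfD //.
by move=> -> ->.
Qed.

Section MonomialMaps.
Variables (A B : comNzRingType) (W W' : zmodType) (rho : {rmorphism A -> B}).
Variable G : {additive W -> W'}.

Lemma lmon_wcharD k k' : lmon (G (k + k')) = lmon (G k) * lmon (G k') :> lau B W'.
Proof. by rewrite raddfD lmonD. Qed.
Lemma lmon_wchar0 : lmon (G 0) = 1 :> lau B W'.
Proof. by rewrite raddf0 lmon0. Qed.
Definition wmon := WChar lmon_wcharD lmon_wchar0.

Definition cstB (a : A) : lau B W' := (rho a)%:A.
Lemma cstB_zmod : zmod_morphism cstB.
Proof. by move=> a b; rewrite /cstB rmorphB scalerBl. Qed.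
Lemma cstB_monoid : monoid_morphism cstB.
Proof.
by split=> [|a b]; rewrite /cstB ?rmorph1 ?scale1r // rmorphM -scalerAl mul1r scalerA.
Qed.
HB.instance Definition _ := GRing.isZmodMorphism.Build A (lau B W') cstB cstB_zmod.
HB.instance Definition _ := GRing.isMonoidMorphism.Build A (lau B W') cstB cstB_monoid.

Definition lmap : lau A W -> lau B W' := lev cstB wmon.
HB.instance Definition _ := GRing.RMorphism.on lmap.

Lemma lmap_mon k : lmap (lmon k) = lmon (G k).
Proof. exact: lev_mon. Qed.
Lemma lmapZ a f : lmap (a *: f) = rho a *: lmap f.
Proof. by rewrite /lmap levZ /cstB -scalerAl mul1r. Qed.
Lemma lmapE f : lmap f = \sum_(k <- lsupp f) rho (lc f k) *: lmon (G k).
Proof. by rewrite /lmap lev.unlock; apply: eq_bigr => k _; rewrite /cstB -scalerAl mul1r. Qed.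

End MonomialMaps.

(** * Divided differences of Laurent polynomials *)

Notation laur A n := (lau A (weight n)).

HB.instance Definition _ n := GRing.Zmodule.on (weight n).

Definition eps n (i : 'I_n) : weight n := [ffun j => (i == j)%:Z].
HB.lock Definition root n (i j : 'I_n) : weight n := eps i - eps j.

Section Weights.
Variable n : nat.
Implicit Types (k : weight n) (i j : 'I_n).

Lemma wact_zmod (w : 'S_n) : zmod_morphism (@wact n w).
Proof. by move=> k k'; rewrite wactD wactN. Qed.
HB.instance Definition _ w :=
  GRing.isZmodMorphism.Build (weight n) (weight n) (@wact n w) (wact_zmod w).

Lemma rootE i j a : root i j a = (i == a)%:Z - (j == a)%:Z.
Proof. by rewrite root.unlock !ffunE. Qed.

Lemma wact_eps w i : wact w (eps i) = eps (w i).
Proof. by apply/ffunP => j; rewrite !ffunE -(inj_eq (@perm_inj _ w)) permKV. Qed.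

Lemma wact_root w i j : wact w (root i j) = root (w i) (w j).
Proof. by rewrite root.unlock raddfB /= !wact_eps. Qed.

Lemma rootN i j : - root i j = root j i.
Proof. by rewrite root.unlock opprB. Qed.

Lemma weightN k a : (- k) a = - k a. Proof. by rewrite ffunE. Qed.
Lemma weightD k k' a : (k + k') a = k a + k' a. Proof. by rewrite ffunE. Qed.
Lemma weight0 a : (0 : weight n) a = 0. Proof. by rewrite ffunE. Qed.
Lemma weightMz k (t : int) a : (k *~ t) a = k a * t.
Proof. by rewrite ffunMzE mulrzz. Qed.

Lemma wact_tpermE i j k : wact (tperm i j) k = k - root i j *~ (k i - k j).
Proof.
apply/ffunP => a; rewrite wact_tperm weightD weightN weightMz rootE.
case: tpermP => [->|->|/eqP + /eqP]; rewrite ?eqxx.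
- by case: (j =P i) => [->|_]; lia.
- by case: (i =P j) => [->|_]; lia.
by rewrite !(eq_sym a) => /negPf -> /negPf ->; lia.
Qed.

Definition n2 k : int := \sum_i k i ^+ 2.

Lemma n2_wact w k : n2 (wact w k) = n2 k.
Proof.
rewrite /n2 [RHS](reindex_inj (@perm_inj _ w^-1)).
by apply: eq_bigr => i _; rewrite ffunE.
Qed.

Lemma n2_ge0 k : 0 <= n2 k.
Proof. by apply: sumr_ge0 => i _; apply: sqr_ge0. Qed.

Lemma n2N k : n2 (- k) = n2 k.
Proof. by apply: eq_bigr => i _; rewrite ffunE sqrrN. Qed.

Definition pair_w k k' : int := \sum_i k i * k' i.

Lemma n2D k k' : n2 (k + k') = n2 k + pair_w k k' *+ 2 + n2 k'.
Proof.
rewrite /n2 /pair_w -sumrMnl -!big_split; apply: eq_bigr => i _.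
by rewrite ffunE sqrrD.
Qed.

Lemma pair_wDr k k1 k2 : pair_w k (k1 + k2) = pair_w k k1 + pair_w k k2.
Proof. by rewrite /pair_w -big_split; apply: eq_bigr => i _; rewrite ffunE mulrDr. Qed.

Lemma pair_wNr k k1 : pair_w k (- k1) = - pair_w k k1.
Proof. by rewrite /pair_w -sumrN; apply: eq_bigr => i _; rewrite ffunE mulrN. Qed.

Lemma pair_w0 k : pair_w k 0 = 0.
Proof. by rewrite /pair_w big1 // => i _; rewrite ffunE mulr0. Qed.

Lemma pair_wZ k k1 (t : int) : pair_w k (k1 *~ t) = pair_w k k1 * t.
Proof.
rewrite /pair_w mulr_suml; apply: eq_bigr => i _.
by rewrite weightMz mulrA.
Qed.

Lemma pair_w_eps k i : pair_w k (eps i) = k i.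
Proof.
rewrite /pair_w (bigD1 i) //= ffunE eqxx mulr1 big1 ?addr0 // => j ji.
by rewrite ffunE eq_sym (negPf ji) mulr0.
Qed.

Lemma pair_w_root k i j : pair_w k (root i j) = k i - k j.
Proof. by rewrite root.unlock pair_wDr pair_wNr !pair_w_eps. Qed.

Lemma n2_string i j k (t : int) : i != j ->
  n2 (k - root i j *~ t) = n2 k - 2 * t * (k i - k j) + 2 * t ^+ 2.
Proof.
move=> ij; rewrite n2D -mulrNz pair_wZ pair_w_root.
suff -> : n2 (root i j *~ - t) = 2 * t ^+ 2 by rewrite -mulr_natl; ring.
rewrite -[LHS]addr0; transitivity (pair_w (root i j *~ - t) (root i j *~ - t)).
  by rewrite addr0; apply: eq_bigr => a _; rewrite expr2.
rewrite pair_wZ pair_w_root !weightMz !rootE !eqxx (negPf ij) eq_sym (negPf ij).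
by rewrite /=; ring.
Qed.

Lemma n2_eq0 k : n2 k = 0 -> k = 0.
Proof.
move=> /eqP; rewrite psumr_eq0 => [/allP k0|i _]; last exact: sqr_ge0.
apply/ffunP => i; have /(_ (mem_index_enum i)) := k0 i.
by rewrite sqrf_eq0 ffunE => /eqP.
Qed.

End Weights.

HB.lock Definition sact (A : comNzRingType) (n : nat) (w : 'S_n) (f : laur A n) : laur A n :=
  lmap idfun (@wact n w) f.

Definition ldiv_mon (A : comNzRingType) (n : nat) (i : 'I_n) (k : weight n) : laur A n :=
  match k i - k (ordS i) with
  | Posz m => - \sum_(t < m) lmon (k - root i (ordS i) *+ t)
  | Negz m => \sum_(t < m.+1) lmon (k + root i (ordS i) *+ t.+1)
  end.

HB.lock Definition ldiv (A : comNzRingType) (n : nat) (i : 'I_n) (f : laur A n) : laur A n :=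
  lext (@ldiv_mon A n i) f.

Section DividedDifference.
Variables (A : comNzRingType) (n : nat).
Notation L := (laur A n).
Implicit Types (f g h : L) (k : weight n) (i j : 'I_n).

Lemma sact_mon w k : sact w (lmon k) = lmon (wact w k) :> L.
Proof. by rewrite sact.unlock; apply: lmap_mon. Qed.
Lemma sactZ w a f : sact w (a *: f) = a *: sact w f.
Proof. by rewrite sact.unlock; apply: lmapZ. Qed.

Lemma sact_zmod w : zmod_morphism (sact w : L -> L).
Proof. by move=> f g; rewrite sact.unlock; apply: rmorphB. Qed.
Lemma sact_monoid w : monoid_morphism (sact w : L -> L).
Proof. by rewrite sact.unlock; split=> [|f g]; [apply: rmorph1|apply: rmorphM]. Qed.
HB.instance Definition _ w := GRing.isZmodMorphism.Build L L (sact w) (sact_zmod w).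
HB.instance Definition _ w := GRing.isMonoidMorphism.Build L L (sact w) (sact_monoid w).

Lemma sact0 w : sact w 0 = 0 :> L. Proof. exact: rmorph0. Qed.
Lemma sactD w f g : sact w (f + g) = sact w f + sact w g. Proof. exact: rmorphD. Qed.
Lemma sactN w f : sact w (- f) = - sact w f. Proof. exact: rmorphN. Qed.
Lemma sactMr w f g : sact w (f * g) = sact w f * sact w g. Proof. exact: rmorphM. Qed.
Lemma sact_one w : sact w 1 = 1 :> L. Proof. exact: rmorph1. Qed.

Lemma sactM w v f : sact (w * v)%g f = sact v (sact w f).
Proof.
elim/lau_ind: f => [|f f' IH IH'|_ a k _ _]; first by rewrite !sact0.
  by rewrite !sactD IH IH'.
by rewrite !sactZ !sact_mon wactM.
Qed.

Lemma sact1 f : sact 1 f = f.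
Proof.
elim/lau_ind: f => [|f f' IH IH'|_ a k _ _]; first by rewrite !sact0.
  by rewrite !sactD IH IH'.
by rewrite !sactZ !sact_mon wact1.
Qed.

Lemma lc_sact w f k : lc (sact w f) k = lc f (wact w^-1 k).
Proof.
elim/lau_ind: f => [|f f' IH IH'|_ a k' _ _]; first by rewrite sact0 !lc0.
  by rewrite sactD !lcD IH IH'.
rewrite sactZ sact_mon !lcZ !lc_mon; congr (_ * _%:R); congr nat_of_bool.
by rewrite -(inj_eq (can_inj (wactK w^-1))) wactK.
Qed.

Variable i : 'I_n.
Notation j := (ordS i).
Notation al := (root i j).
Notation s := (@sact A n (adj i)).

Lemma sactK : involutive s.
Proof. by move=> f; rewrite -sactM tperm2 sact1. Qed.

Local Notation ldiv := (@ldiv A n i).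

Lemma ldiv_lmon k : ldiv (lmon k) = ldiv_mon A i k.
Proof. by rewrite ldiv.unlock; apply: lext_mon. Qed.
Lemma ldivD f g : ldiv (f + g) = ldiv f + ldiv g.
Proof. by rewrite ldiv.unlock; apply: linearD. Qed.
Lemma ldivZ a f : ldiv (a *: f) = a *: ldiv f.
Proof. by rewrite ldiv.unlock; apply: linearZ. Qed.
Lemma ldiv0 : ldiv 0 = 0.
Proof. by rewrite ldiv.unlock; apply: linear0. Qed.

Lemma ldivP f : (1 - lmon (- al)) * ldiv f = s f - f.
Proof.
elim/lau_ind: f => [|f f' IH IH'|_ a k _ _].
- by rewrite ldiv0 mulr0 sact0 subrr.
- by rewrite ldivD mulrDr IH IH' sactD opprD addrACA.
rewrite ldivZ -scalerAr sactZ -scalerBr; congr (_ *: _).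
rewrite ldiv_lmon sact_mon wact_tpermE /ldiv_mon.
case: (k i - k j) => m.
  rewrite mulrN mulr_sumr; apply/eqP; rewrite eqr_oppLR opprB; apply/eqP.
  transitivity (\sum_(0 <= t < m) (lmon (k - al *+ t) - lmon (k - al *+ t.+1) : L)).
    rewrite big_mkord; apply: eq_bigr => t _.
    rewrite mulrBl mul1r -lmonD; congr (_ - lmon _).
    by rewrite mulrS opprD addrCA.
  rewrite (@telescope_sumr_eq L 0 m (fun t => - lmon (k - al *+ t))) //.
    by rewrite mulr0n subr0 opprK addrC.
  by move=> t _; rewrite opprK addrC.
rewrite mulr_sumr.
transitivity (\sum_(0 <= t < m.+1) (lmon (k + al *+ t.+1) - lmon (k + al *+ t) : L)).
  rewrite big_mkord; apply: eq_bigr => t _.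
  rewrite mulrBl mul1r -lmonD addrCA; congr (_ - lmon (_ + _)).
  by rewrite mulrS addKr.
rewrite (@telescope_sumr_eq L 0 m.+1 (fun t => lmon (k + al *+ t))) //.
by rewrite mulr0n addr0 NegzE -mulrNz opprK.
Qed.

Hypothesis si : simple i.

(** Coefficients of f would be constant along lines in the direction of the root, against finiteness
    of the support. This replaces division in the identities for [ldiv], as A need not be a
    domain. *)
Lemma one_sub_root_reg f : (1 - lmon (- al)) * f = 0 -> f = 0.
Proof.
move=> f0; apply: lauP => k; rewrite lc0; apply/eqP; apply: contraT => fk.
have step k' : lc f (k' + al) = lc f k'.
  have := congr1 (fun g => lc g k') f0.
  rewrite mulrBl mul1r lcD lcN lc_monM opprK lc0 => /eqP.
  by rewrite subr_eq0 => /eqP.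
have shift m : lc f (k + al *+ m) != 0.
  by elim: m => [|m IH]; rewrite ?mulr0n ?addr0 // mulrSr addrA step.
pose B : nat := \sum_(k' <- lsupp f) `|k' i|%N.
have bnd m : (`|(k + al *+ m)%R i|%N <= B)%N.
  have kf : k + al *+ m \in lsupp f by rewrite lsuppP.
  by rewrite /B (big_fsetD1 (k + al *+ m)) //= leq_addr.
have := bnd (B + `|k i|).+1%N; rewrite weightD pmulrn weightMz rootE eqxx.
have ij := ordS_neq si; rewrite eq_sym (negPf ij); lia.
Qed.

Lemma one_sub_root_inj : injective ( *%R (1 - lmon (- al)) : L -> L).
Proof.
move=> f g fg; apply/eqP; rewrite -subr_eq0; apply/eqP.
by apply: one_sub_root_reg; rewrite mulrBr fg subrr.
Qed.

Lemma root_inv : wact (adj i) al = - al.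
Proof. by rewrite wact_root tpermL tpermR rootN. Qed.

Lemma ldiv_mul f g : ldiv f * g - f * ldiv g = ldiv (f * s g).
Proof.
apply: one_sub_root_inj; rewrite ldivP mulrBr mulrA ldivP [_ * (f * _)]mulrCA ldivP.
by rewrite sactMr sactK; ring.
Qed.

Lemma sact_ldiv f : s (ldiv f) = lmon (- al) * ldiv f.
Proof.
apply: one_sub_root_inj; rewrite mulrCA ldivP.
have := congr1 s (ldivP f).
rewrite sactMr !sactD !sactN sact_one sact_mon wactN root_inv opprK sactK.
move=> e; have -> : (1 - lmon (- al) : L) = - lmon (- al) * (1 - lmon al).
  by rewrite mulrBr mulr1 mulNr lmonVl opprK addrC.
by rewrite -mulrA e; ring.
Qed.

Lemma ldiv_sact f : ldiv (s f) = - ldiv f.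
Proof. by apply: one_sub_root_inj; rewrite mulrN !ldivP sactK opprB. Qed.

Lemma ldiv_ldiv f : ldiv (ldiv f) = - ldiv f.
Proof.
apply: one_sub_root_inj; rewrite mulrN ldivP sact_ldiv.
by rewrite mulrBl mul1r opprB.
Qed.

End DividedDifference.

(** * Hecke operators without negative powers of q *)

HB.lock Definition opU (A : comNzRingType) (n : nat) (q : A) (i : 'I_n) (f : laur A n) : laur A n :=
  sact (adj i) f + (q - 1) *: ldiv i f.
HB.lock Definition opV (A : comNzRingType) (n : nat) (q : A) (i : 'I_n) (f : laur A n) : laur A n :=
  opU q i f + (q - 1) *: f.

Section HeckeOperators.
Variables (A : comNzRingType) (n : nat) (q : A) (i : 'I_n).
Notation L := (laur A n).
Implicit Types (f g h : L) (k : weight n).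
Notation j := (ordS i).
Notation al := (root i j).
Notation s := (@sact A n (adj i)).
Notation U := (@opU A n q i).
Notation V := (@opV A n q i).

Lemma opUD f g : U (f + g) = U f + U g.
Proof. by rewrite !opU.unlock sactD ldivD scalerDr addrACA. Qed.
Lemma opUZ a f : U (a *: f) = a *: U f.
Proof. by rewrite !opU.unlock sactZ ldivZ scalerDr !scalerA [a * _]mulrC. Qed.
Lemma opU0 : U 0 = 0.
Proof. by rewrite -(scale0r (0 : L)) opUZ !scale0r. Qed.
Lemma opVD f g : V (f + g) = V f + V g.
Proof. by rewrite !opV.unlock opUD scalerDr addrACA. Qed.
Lemma opVZ a f : V (a *: f) = a *: V f.
Proof. by rewrite !opV.unlock opUZ scalerDr !scalerA [a * _]mulrC. Qed.
Lemma opV0 : V 0 = 0.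
Proof. by rewrite -(scale0r (0 : L)) opVZ !scale0r. Qed.

Hypothesis si : simple i.

Lemma opUU f : U (U f) = (1 - q) *: U f + q *: f.
Proof.
have sE : s f = f + (1 - lmon (- al)) * ldiv i f by rewrite ldivP addrC subrK.
rewrite !opU.unlock !sactD !sactZ !ldivD !ldivZ sactK sact_ldiv // ldiv_sact // ldiv_ldiv //.
rewrite sE; move: (ldiv i f) => h.
by rewrite !scale_lcst !rmorphB rmorph1; ring.
Qed.

Lemma opUV f : U (V f) = q *: f.
Proof.
rewrite opV.unlock opUD opUZ opUU addrAC -scalerDl.
by rewrite addrA subrK subrr scale0r add0r.
Qed.

Lemma opVU f : V (U f) = q *: f.
Proof.
rewrite opV.unlock opUU addrAC -scalerDl.
by rewrite addrA subrK subrr scale0r add0r.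
Qed.

(* The operators are self-adjoint up to the image of [U - 1], on which the
   constant term functional below vanishes. *)
Lemma opU_adj f g : U f * g - f * U g = U (f * s g) - f * s g.
Proof.
rewrite !opU.unlock -ldiv_mul // sactMr sactK.
by rewrite !scale_lcst; ring.
Qed.

Lemma opV_adj f g : V f * g - f * V g = U f * g - f * U g.
Proof. by rewrite !opV.unlock !scale_lcst; ring. Qed.

(** The factor q - x_(i + 1) / x_i is a unit times 1 - q x_i / x_(i + 1), one of the denominators in
    the constant term functional. *)
Lemma opU_sub1 h : U h - h = (lcst _ q - lmon (- al)) * ldiv i h.
Proof.
rewrite opU.unlock addrAC -ldivP scale_lcst !rmorphB rmorph1; ring.
Qed.

Lemma ldiv_monM k h : k i - k j = 1 ->
  ldiv i (lmon k * h : L) = lmon (k - al) * ldiv i h - lmon k * h.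
Proof.
move=> k1; apply: (one_sub_root_inj si); rewrite ldivP sactMr sact_mon wact_tpermE k1 mulr1z.
have e : (1 - lmon (- al)) * (lmon (k - al) * ldiv i h) = lmon (k - al) * (s h - h).
  by rewrite mulrCA ldivP.
by rewrite mulrBr e lmonD; ring.
Qed.

(** The correction that [ldiv] picks up from x^k is precisely the difference between V and U.
    Together with [opU_mon] this reconciles the two families in [hf_translate]. *)
Lemma opV_mon k f : k i - k j = 1 -> V (lmon k * f) = lmon (wact (adj i) k) * U f.
Proof.
move=> k1; rewrite opV.unlock opU.unlock ldiv_monM // sactMr sact_mon wact_tpermE k1 mulr1z.
by rewrite !scale_lcst; ring.
Qed.

Lemma opU_mon k f : k i - k j = - 1 -> U (lmon k * f) = lmon (wact (adj i) k) * V f.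
Proof.
move=> k1; have sk : wact (adj i) k = k + al by rewrite wact_tpermE k1 mulrNz opprK mulr1z.
have e : ldiv i (lmon k * f) = lmon (k + al) * (ldiv i f + f).
  apply: (one_sub_root_inj si); rewrite ldivP sactMr sact_mon sk.
  have -> : (1 - lmon (- al)) * (lmon (k + al) * (ldiv i f + f)) =
     lmon (k + al) * ((s f - f) + (1 - lmon (- al)) * f) by rewrite mulrCA mulrDr ldivP.
  have -> : lmon k = lmon (k + al) * lmon (- al) :> L by rewrite -lmonD addrK.
  by ring.
rewrite opV.unlock opU.unlock e sactMr sact_mon sk.
by rewrite !scale_lcst; ring.
Qed.

Lemma opU_mon_inv k f : k i = k j -> U (lmon k * f) = lmon k * U f.
Proof.
move=> kij; have ks : wact (adj i) k = k by rewrite wact_tpermE kij subrr mulr0z subr0.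
rewrite opU.unlock sactMr sact_mon ks.
have -> : ldiv i (lmon k * f) = lmon k * ldiv i f.
  by apply: (one_sub_root_inj si); rewrite mulrCA !ldivP sactMr sact_mon ks mulrBr.
by rewrite mulrDr scalerAr.
Qed.

Lemma opV_mon_inv k f : k i = k j -> V (lmon k * f) = lmon k * V f.
Proof. by move=> kij; rewrite opV.unlock opU_mon_inv // mulrDr scalerAr. Qed.

(** The weights on the segment from k to s_i k. With [strict], the end s_i k is left out when k_i >
    k_(i + 1), where it is the leading exponent to be split off from the remainder. *)
Definition on_string k (strict : bool) (k' : weight n) :=
  exists2 t : int, k' = k - al *~ t &
    (0 <= t /\ t + strict%:Z <= k i - k j) \/ (k i - k j <= t /\ t <= 0).

Lemma suppin_ldiv k : suppin (on_string k true) (ldiv i (lmon k : L)).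
Proof.
rewrite ldiv_lmon /ldiv_mon; case e: (k i - k j) => [m|m].
  apply: suppinN; apply: suppin_sum => t _; apply: suppin_mon.
  by exists t%:Z => //; left; rewrite e; have := ltn_ord t; lia.
apply: suppin_sum => t _; apply: suppin_mon; exists (- t.+1%:Z).
  by rewrite mulrNz opprK.
by right; rewrite e; have := ltn_ord t; lia.
Qed.

Lemma opU_lmon k : exists2 r, U (lmon k) = lmon (wact (adj i) k) + r & suppin (on_string k true) r.
Proof.
exists ((q - 1) *: ldiv i (lmon k)); first by rewrite opU.unlock sact_mon.
by apply: suppinZ; apply: suppin_ldiv.
Qed.

Lemma opV_lmon k : k j < k i ->
  exists2 r, V (lmon k) = lmon (wact (adj i) k) + r & suppin (on_string k true) r.
Proof.
move=> kji; have [r rE rS] := opU_lmon k; exists (r + (q - 1) *: lmon k).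
  by rewrite opV.unlock rE addrA.
apply: suppinD => //; apply: suppinZ; apply: suppin_mon; exists 0; last by left; lia.
by rewrite mulr0z subr0.
Qed.

Lemma suppin_opU_lmon k : suppin (on_string k false) (U (lmon k)).
Proof.
have [r -> rS] := opU_lmon k; apply: suppinD; last first.
  apply: suppinS rS => k' [t -> [h|h]]; exists t; rewrite //; [left|right]; lia.
by apply: suppin_mon; exists (k i - k j); rewrite ?wact_tpermE //; case: (lerP 0 (k i - k j)) => h; [left|right]; lia.
Qed.

Lemma suppin_opV_lmon k : suppin (on_string k false) (V (lmon k)).
Proof.
rewrite opV.unlock; apply: suppinD; first exact: suppin_opU_lmon.
apply: suppinZ; apply: suppin_mon; exists 0; first by rewrite mulr0z subr0.
by case: (lerP 0 (k i - k j)) => h; [left|right]; lia.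
Qed.

Lemma suppin_opU (Q Q' : weight n -> Prop) f :
  (forall k k', Q k -> on_string k false k' -> Q' k') -> suppin Q f -> suppin Q' (U f).
Proof.
move=> QQ' Qf; apply: (suppin_ind (P := fun f => suppin Q' (U f)) Qf).
- by rewrite opU0; apply: suppin0.
- by move=> f1 f2; rewrite opUD; apply: suppinD.
move=> a k Qk; rewrite opUZ; apply: suppinZ.
by apply: (suppinS _ (@suppin_opU_lmon k)) => k'; apply: QQ'.
Qed.

Lemma suppin_opV (Q Q' : weight n -> Prop) f :
  (forall k k', Q k -> on_string k false k' -> Q' k') -> suppin Q f -> suppin Q' (V f).
Proof.
move=> QQ' Qf; apply: (suppin_ind (P := fun f => suppin Q' (V f)) Qf).
- by rewrite opV0; apply: suppin0.
- by move=> f1 f2; rewrite opVD; apply: suppinD.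
move=> a k Qk; rewrite opVZ; apply: suppinZ.
by apply: (suppinS _ (@suppin_opV_lmon k)) => k'; apply: QQ'.
Qed.

End HeckeOperators.

(** * Laurent polynomials as rational functions *)

Lemma dl_rescale (K : fieldType) (x Q a b : K) : x != 0 -> Q != 0 ->
  a + (Q - 1) * b = Q * (Q^-1 * a + (1 - Q^-1) / x * (x * b)).
Proof. by move=> x0 Q0; field; rewrite x0 Q0. Qed.

Section LaurentFractions.
Variables (A : comNzRingType) (F : fieldType) (rho : {rmorphism A -> F}) (n : nat).
Notation K := (ratfun F n).
Notation L := (laur A n).
Implicit Types (f g : L) (k : weight n) (i : 'I_n).

Definition rmon_char : wchar (weight n) K := WChar (@rmonD F n) (rmon0 F n).

Definition ratev : L -> K := lev (@rcst F n \o rho) rmon_char.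
HB.instance Definition _ := GRing.RMorphism.on ratev.

Lemma ratev_mon k : ratev (lmon k) = rmon F k. Proof. exact: lev_mon. Qed.
Lemma ratevZ a f : ratev (a *: f) = rcst n (rho a) * ratev f. Proof. exact: levZ. Qed.
Lemma ratevD f g : ratev (f + g) = ratev f + ratev g. Proof. exact: rmorphD. Qed.
Lemma ratevB f g : ratev (f - g) = ratev f - ratev g. Proof. exact: rmorphB. Qed.
Lemma ratevM f g : ratev (f * g) = ratev f * ratev g. Proof. exact: rmorphM. Qed.
Lemma ratev0 : ratev 0 = 0. Proof. exact: rmorph0. Qed.
Lemma ratev1 : ratev 1 = 1. Proof. exact: rmorph1. Qed.

Lemma ratevE f : ratev f = \sum_(k <- lsupp f) rcst n (rho (lc f k)) * rmon F k.
Proof. by rewrite /ratev lev.unlock. Qed.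

Lemma rmon_clear (N : nat) k : (forall i, 0 <= k i + N%:Z) ->
  rmon F k * rmon F [ffun => N%:Z] =
  FracField.tofrac ('X_[[multinom `|(k i + N%:Z)%R|%N | i < n]] : mpoly.mpoly n F).
Proof.
move=> kN; rewrite -rmonD mpolyXE_id rmorph_prod /=; apply: eq_bigr => i _.
rewrite rmorphXn mnmE weightD [X in _ + X]ffunE /rx.
by case: (k i + N%:Z) (kN i).
Qed.

(** Multiplication by a high power of the product of all variables turns the given Laurent monomials
    into distinct ordinary monomials. *)
Lemma rmon_free (r : seq (weight n)) (c : weight n -> F) : uniq r ->
  \sum_(k <- r) rcst n (c k) * rmon F k = 0 -> forall k, k \in r -> c k = 0.
Proof.
move=> ur r0 k kr; pose N := (\sum_(k' <- r) \sum_i `|k' i|)%N.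
have kN k' i : k' \in r -> 0 <= k' i + N%:Z.
  move=> k'r; have : (`|k' i| <= N)%N; last by lia.
  rewrite /N (big_rem k') //= (bigD1 i) //= -addnA; exact: leq_addr.
pose m k' := [multinom `|(k' i + N%:Z)%R|%N | i < n].
have := congr1 ( *%R^~ (rmon F [ffun => N%:Z])) r0; rewrite mul0r mulr_suml.
rewrite big_seq (eq_bigr (fun k' => FracField.tofrac (c k' *: 'X_[m k'] : mpoly.mpoly n F))); last first.
  move=> k' k'r; rewrite -mulrA rmon_clear => [|i]; last exact: kN.
  by rewrite /rcst -rmorphM /= mul_mpolyC.
rewrite -big_seq -rmorph_sum /= => /eqP; rewrite tofrac_eq0 => /eqP.
move=> /(congr1 (mpoly.mcoeff (m k))); rewrite mpoly.mcoeff0 raddf_sum /=.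
rewrite (big_rem k) //= mpoly.mcoeffZ mcoeffX eqxx mulr1 big_seq big1 ?addr0 //.
move=> k'; rewrite mem_rem_uniq // inE => /andP[k'k k'r].
rewrite mpoly.mcoeffZ mcoeffX; case: eqP => [mm|]; last by rewrite mulr0.
case/eqP: k'k; apply/ffunP => i; have := congr1 (fun x : multinom n => x i) mm.
rewrite !mnmE => /(congr1 Posz); rewrite !gez0_abs ?kN //; exact: addIr.
Qed.

Hypothesis rho_inj : injective rho.

Lemma ratev_inj : injective ratev.
Proof.
suff h f : ratev f = 0 -> f = 0.
  move=> f g fg; apply/eqP; rewrite -subr_eq0; apply/eqP/h.
  by rewrite ratevB fg subrr.
rewrite ratevE => f0; apply: lauP => k; rewrite lc0; apply/eqP; apply: contraT => fk.
have := rmon_free (fset_uniq _) f0; move=> /(_ k); rewrite lsuppP fk => /(_ isT) /eqP.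
by rewrite -(rmorph0 rho) (inj_eq rho_inj) (negPf fk).
Qed.

Lemma ratev_sact w f : ratev (sact w f) = ract w (ratev f).
Proof.
elim/lau_ind: f => [|f g IH IH'|_ a k _ _].
- by rewrite sact0 ratev0 rmorph0.
- by rewrite sactD !ratevD IH IH' rmorphD.
by rewrite sactZ !ratevZ rmorphM /= ract_rcst sact_mon !ratev_mon ract_rmon.
Qed.

Lemma rmon_eps i : rmon F (eps i) = rx F i.
Proof.
rewrite /rmon (bigD1 i) //= ffunE eqxx expr1z big1 ?mulr1 // => j ji.
by rewrite ffunE eq_sym (negPf ji) expr0z.
Qed.

Lemma rmonN k : rmon F (- k) = (rmon F k)^-1.
Proof.
have : rmon F (- k) * rmon F k = 1 by rewrite -rmonD addNr rmon0.
move=> e; have k0 : rmon F k != 0 by apply/eqP => k0; move: e; rewrite k0 mulr0 => /eqP; rewrite eq_sym oner_eq0.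
by rewrite -[RHS]mul1r -e mulfK.
Qed.

Lemma rmon_root i j : rmon F (root i j) = rx F i / rx F j.
Proof. by rewrite root.unlock rmonD rmonN !rmon_eps. Qed.

Lemma ratev_opU (q : A) i f : simple i -> rho q != 0 ->
  ratev (opU q i f) = rcst n (rho q) * T_simple (rho q)^-1 i (ratev f).
Proof.
move=> si q0; have x0 : 1 - rx F (ordS i) / rx F i != 0.
  rewrite -(inj_eq (mulIf (rx_neq0 F i))) mul0r mulrBl mul1r mulfVK ?rx_neq0 //.
  exact: rx_sub_neq0 (ordS_neq si).
have := congr1 ratev (ldivP i f).
rewrite ratevM !ratevB ratev1 ratev_mon rootN rmon_root ratev_sact => e.
have Q0 : rcst n (rho q) != 0 by rewrite fmorph_eq0.
rewrite opU.unlock ratevD ratevZ ratev_sact /T_simple -e fmorphV !rmorphB !rmorph1 fmorphV.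
exact: (dl_rescale _ _ x0 Q0).
Qed.

End LaurentFractions.

(** * Twisted nonsymmetric Hall-Littlewood polynomials *)

Section Rank.
Variables (R : realType) (n : nat).
Implicit Types (c : 'I_n -> R) (i j : 'I_n).

Definition rank_set c i := [set j | c j < c i].

Lemma rank_lt c i : (#|rank_set c i| < n)%N.
Proof.
suff : (#|rank_set c i| < #|'I_n|)%N by rewrite card_ord.
apply: proper_card; apply/properP; split; first exact: subset_predT.
by exists i; rewrite // inE ltxx.
Qed.

Definition rank c i : 'I_n := Ordinal (rank_lt c i).

Lemma rank_ltE c i j : (rank c i < rank c j)%N = (c i < c j).
Proof.
have le a b : c a <= c b -> (rank c a <= rank c b)%N.
  move=> ab; apply: subset_leq_card; apply/fintype.subsetP => k; rewrite !inE => ka.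
  exact: lt_le_trans ka ab.
apply/idP/idP => [ij|ij]; first by rewrite ltNge; apply/negP => /le; rewrite leqNgt ij.
apply: proper_card; apply/properP; split.
  by apply/fintype.subsetP => k; rewrite !inE => /lt_trans; apply.
by exists i; rewrite !inE // ltxx.
Qed.

Lemma rank_inj c : injective c -> injective (rank c).
Proof.
move=> c_inj i j /(congr1 (@nat_of_ord n)) rij; apply: c_inj; apply/eqP.
by rewrite eq_le !leNgt -!rank_ltE rij ltnn.
Qed.

(** The standardization of the word c; words with repeated entries get the identity as a default. *)
Definition std c : 'S_n :=
  match pselect (injective (rank c)) with
  | left rank_inj => perm rank_inj
  | right _ => 1%g
  end.

Lemma stdE c : injective c -> std c =1 rank c.
Proof.
move=> /rank_inj c_inj i; rewrite /std; case: pselect => // r_inj.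
by rewrite permE.
Qed.

Lemma std_lt c i j : injective c -> (std c i < std c j)%N = (c i < c j).
Proof. by move=> ci; rewrite !stdE // rank_ltE. Qed.

Lemma perm_lt_eq (w v : 'S_n) :
  (forall i j, (w i < w j)%N = (v i < v j)%N) -> w = v.
Proof.
move=> wv; suff : (w^-1 * v = 1)%g by move/(congr1 (mulg w)); rewrite mulKVg mulg1.
apply: ninv_eq0_perm => i si; rewrite !permM -wv !permKV val_ordS //.
Qed.

Lemma std_adj c i : injective c -> std (c \o adj i) = (adj i * std c)%g.
Proof.
move=> ci; have ci' : injective (c \o adj i) by apply: inj_comp => //; apply: perm_inj.
by apply: perm_lt_eq => a b; rewrite !permM !std_lt.
Qed.

Lemma std_unique c (w : 'S_n) : injective c ->
  (forall i j, (w i < w j)%N = (c i < c j)) -> std c = w.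
Proof. by move=> ci wc; apply: perm_lt_eq => i j; rewrite std_lt // wc. Qed.

End Rank.

(* [e lam c] plays the role of E^pi_lam(x; q^-1), where pi^-1 has the same
   relative order as the word [c]. *)
Record hecke_family (R : realType) (A : comNzRingType) (n : nat) (q : A)
    (e : weight n -> ('I_n -> R) -> laur A n) : Prop := HeckeFamily {
  hf_dominant : forall lam c, injective c -> dominant lam -> e lam c = lmon lam;
  hf_U : forall (i : 'I_n) (lam : weight n) c, injective c -> simple i ->
    c (ordS i) < c i -> lam (ordS i) <= lam i ->
    e (wact (adj i) lam) (c \o adj i) = opU q i (e lam c);
  hf_V : forall (i : 'I_n) (lam : weight n) c, injective c -> simple i ->
    c i < c (ordS i) -> lam (ordS i) < lam i ->
    e (wact (adj i) lam) (c \o adj i) = opV q i (e lam c)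
}.

Section Existence.
Variables (R : realType) (A : comNzRingType) (F : fieldType) (rho : {rmorphism A -> F}).
Variables (q : A) (n : nat).
Hypotheses (rho_inj : injective rho) (q0 : rho q != 0).
Notation L := (laur A n).
Notation ev := (@ratev A F rho n).
Implicit Types (lam : weight n) (c : 'I_n -> R) (i : 'I_n) (sigma : 'S_n).

(** The number of pairs of positions at which lam strictly increases; it vanishes on dominant
    weights. *)
Definition asc lam := ninv (fun i => - lam i).

Lemma asc_swap lam i : simple i -> lam (ordS i) < lam i ->
  asc (wact (adj i) lam) = (asc lam).+1.
Proof.
move=> si li; rewrite /asc -(@ninv_swap _ int n (fun i => - lam i) i) ?ltrN2 //.
by apply: eq_card => -[a b]; rewrite !inE /= !wact_tperm.
Qed.

Lemma dominant_or_ascent lam :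
  dominant lam \/ exists2 i, simple i & lam i < lam (ordS i).
Proof.
have [[i si li]|no] := pselect (exists2 i, simple i & lam i < lam (ordS i)); [by right; exists i|left].
apply/dominantP => i j ij; rewrite -lerN2.
apply: (@adj_mono _ int n (fun i => - lam i)) => // k sk; rewrite lerN2 leNgt.
by apply/negP => kk; apply: no; exists k.
Qed.

Lemma wact_adjK i lam : wact (adj i) (wact (adj i) lam) = lam.
Proof. by rewrite -wactM tperm2 wact1. Qed.

(** Swapping a strict descent raises [asc] by exactly one, so every weight is reached from a
    dominant one by such swaps. *)
Lemma weight_ind (P : weight n -> Prop) :
    (forall lam, dominant lam -> P lam) ->
    (forall i lam, simple i -> lam (ordS i) < lam i -> P lam -> P (wact (adj i) lam)) ->
  forall lam, P lam.
Proof.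
move=> Pd Ps lam; move: {2}(asc lam) (erefl (asc lam)) => m.
elim/ltn_ind: m lam => m IH lam mE; case: (dominant_or_ascent lam) => [|[i si li]]; first exact: Pd.
rewrite -(wact_adjK i lam); have li' : wact (adj i) lam (ordS i) < wact (adj i) lam i.
  by rewrite !wact_tperm tpermL tpermR.
apply: Ps => //; apply: (IH _ _ _ erefl).
by have := asc_swap si li'; rewrite wact_adjK mE => ->.
Qed.

Lemma T_opV i f : simple i -> T_simple (rho q)^-1 i (ev (opV q i f)) = ev f.
Proof.
move=> si; have Q0 : rcst n (rho q) != 0 by rewrite fmorph_eq0.
by apply: (mulfI Q0); rewrite -ratev_opU // opUV // ratevZ.
Qed.

(** [E_twist_adj], solved for the polynomial of the swapped weight, applies U_i or V_i according to
    the order of the word at i. Neither has a denominator, so all coefficients stay in A. *)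
Lemma E_twist_laurent lam sigma : exists f : L, ev f = E_twist (rho q)^-1 sigma^-1 lam.
Proof.
have Q0 : (rho q)^-1 != 0 by rewrite invr_eq0.
elim/weight_ind: lam sigma => [lam dl sigma|i lam si li IH sigma].
  by exists (lmon lam); rewrite E_twist_dominant // ratev_mon.
have [f fE] := IH (adj i * sigma)%g.
have sE : sigma = (adj i * (adj i * sigma))%g by rewrite mulgA tperm2 mul1g.
case: (perm_ascdesc sigma si) => s_i.
  exists (opU q i f); rewrite ratev_opU // fE.
  have := E_twist_adj Q0 (wact (adj i) lam) si s_i.
  rewrite wact_adjK !wact_tperm tpermL tpermR (ltW li) expr1 => ->.
  by rewrite mulrA -rmorphM mulfV // rmorph1 mul1r.
exists (opV q i f); apply: (can_inj (T_simpleK Q0 si)); rewrite T_opV // fE.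
rewrite [in RHS]sE E_twist_adj // ?permM ?tpermL ?tpermR //.
by rewrite leNgt li expr0 mul1r.
Qed.

Definition hl_laurent lam sigma : L :=
  xget 0 [set f | ev f = E_twist (rho q)^-1 sigma^-1 lam]%classic.

Lemma hl_laurentE lam sigma : ev (hl_laurent lam sigma) = E_twist (rho q)^-1 sigma^-1 lam.
Proof.
rewrite /hl_laurent; case: xgetP => [f -> //|no].
by have [f fE] := E_twist_laurent lam sigma; case: (no f).
Qed.

Lemma hl_family : hecke_family q (fun lam c => hl_laurent lam (@std R n c)).
Proof.
have Q0 : (rho q)^-1 != 0 by rewrite invr_eq0.
have Q1 : rcst n (rho q) != 0 by rewrite fmorph_eq0.
have ei := ratev_inj rho_inj.
split=> [lam c ci dl|i lam c ci si c_i li|i lam c ci si c_i li]; apply: ei.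
- by rewrite hl_laurentE E_twist_dominant // ratev_mon.
- rewrite ratev_opU // !hl_laurentE std_adj //.
  have := @E_twist_adj _ _ _ Q0 (adj i * std c)%g (wact (adj i) lam) i si.
  rewrite wact_adjK mulgA tperm2 mul1g !wact_tperm !permM tpermL tpermR std_lt // => -> //.
  by rewrite li expr1 mulrA -rmorphM mulfV // rmorph1 mul1r.
apply: (can_inj (T_simpleK Q0 si)); rewrite T_opV // !hl_laurentE std_adj //.
by rewrite E_twist_adj ?std_lt // leNgt li expr0 mul1r.
Qed.

End Existence.

(** * Triangularity *)

Section Triangularity.
Variables (R : realType) (A : comNzRingType) (n : nat) (q : A).
Variable e : weight n -> ('I_n -> R) -> laur A n.
Hypothesis he : hecke_family q e.
Implicit Types (lam mu k : weight n) (c : 'I_n -> R) (i : 'I_n).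
Notation L := (laur A n).

Lemma adj_inj c i : injective c -> injective (c \o adj i).
Proof. by move=> ci; apply: inj_comp => //; apply: perm_inj. Qed.

Lemma adj_comp2 c i : (c \o adj i) \o adj i = c.
Proof. by apply/funext => k /=; rewrite tpermK. Qed.

Lemma hf_step c i lam : injective c -> simple i -> lam (ordS i) < lam i ->
  e (wact (adj i) lam) c =
  (if c i < c (ordS i) then @opU A n else @opV A n) q i (e lam (c \o adj i)).
Proof.
move=> ci si li; rewrite -{1}(adj_comp2 c i); have ci' := @adj_inj _ i ci.
case: ltP => cij.
  by rewrite (hf_U he) ?(ltW li) //= tpermL tpermR.
rewrite (hf_V he) //= tpermL tpermR lt_neqAle cij andbT.
by rewrite (inj_eq ci) eq_sym ordS_neq.
Qed.

Lemma hf_supp (Q : weight n -> Prop) lam c : injective c ->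
    (forall i k k', simple i -> Q k -> on_string i k false k' -> Q k') ->
  Q lam -> suppin Q (e lam c).
Proof.
move=> + Qs; elim/weight_ind: lam c => [lam dl c ci Ql|i lam si li IH c ci Ql].
  by rewrite (hf_dominant he) //; apply: suppin_mon.
have Ql' : Q lam.
  apply: (Qs i _ _ si Ql); exists (wact (adj i) lam i - wact (adj i) lam (ordS i)).
    by rewrite -wact_tpermE wact_adjK.
  by right; rewrite !wact_tperm tpermL tpermR; lia.
have Qe := IH _ (@adj_inj c i ci) Ql'; rewrite hf_step //; case: ifP => _.
  by apply: (suppin_opU si _ Qe) => k k'; apply: (Qs i).
by apply: (suppin_opV si _ Qe) => k k'; apply: (Qs i).
Qed.

(** Interior points of the segment from k to s_i k are strictly shorter than its ends. So lengths
    are compared first, and ascents only within one orbit. *)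
Definition low lam k := n2 k < n2 lam \/
  [/\ n2 k = n2 lam, exists w, k = wact w lam & (asc k < asc lam)%N].

Lemma asc_adj_le lam i : simple i -> (asc (wact (adj i) lam) <= (asc lam).+1)%N.
Proof.
move=> si; case: (ltgtP (lam i) (lam (ordS i))) => li; last 1 first.
- suff -> : wact (adj i) lam = lam by [].
  by rewrite wact_tpermE li subrr mulr0z subr0.
- have := @asc_swap n (wact (adj i) lam) i si; rewrite wact_adjK.
  by rewrite !wact_tperm tpermL tpermR => /(_ li) ->; rewrite leqW.
- by rewrite asc_swap.
Qed.

Lemma n2_on_string i k k' : simple i -> on_string i k false k' ->
  [\/ k' = k, k' = wact (adj i) k | n2 k' < n2 k].
Proof.
move=> si [t -> tk]; have ij := ordS_neq si.
have [->|t0] := eqVneq t 0; first by constructor 1; rewrite mulr0z subr0.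
have [->|t1] := eqVneq t (k i - k (ordS i)); first by constructor 2; rewrite -wact_tpermE.
constructor 3; rewrite n2_string //; move: (k i - k (ordS i)) tk t0 t1 => d.
rewrite addr0 => tk t0 t1; rewrite -subr_gt0.
have -> : n2 k - (n2 k - 2 * t * d + 2 * t ^+ 2) = 2 * (t * (d - t)) by ring.
by rewrite mulr_gt0 //; case: tk => -[h1 h2]; [rewrite mulr_gt0|rewrite nmulr_rgt0]; lia.
Qed.

Lemma low_on_string i lam k k' : simple i -> lam (ordS i) < lam i ->
  low lam k -> on_string i k false k' -> low (wact (adj i) lam) k'.
Proof.
move=> si li lk /(n2_on_string si) kk'; rewrite /low n2_wact asc_swap //.
case: lk => [nk|[nk [w kE] ak]].
  by left; case: kk' => [-> //|->|/lt_trans]; [rewrite n2_wact|apply].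
case: kk' => [->|->|]; last by rewrite nk; left.
  right; split; rewrite ?nk ?ltnS ?(ltnW ak) //.
  by exists (adj i * w)%g; rewrite wactM wact_adjK.
right; split; rewrite ?n2_wact ?nk //.
  by exists (adj i * w * adj i)%g; rewrite !wactM wact_adjK -kE.
by apply: leq_ltn_trans (asc_adj_le _ si) _; rewrite ltnS.
Qed.

Lemma hf_triangular lam c : injective c ->
  exists2 r, e lam c = lmon lam + r & suppin (low lam) r.
Proof.
elim/weight_ind: lam c => [lam dl c ci|i lam si li IH c ci].
  by exists 0; rewrite ?addr0 ?(hf_dominant he) //; apply: suppin0.
have [r rE rl] := IH _ (@adj_inj c i ci).
have string_low k : on_string i lam true k -> low (wact (adj i) lam) k.
  move=> ks; have [t kE tk] := ks.
  have : on_string i lam false k by exists t => //; case: tk => h; [left|right]; lia.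
  move=> /(n2_on_string si)[->|kE'|nk]; rewrite /low n2_wact asc_swap //; last by left.
    by right; split=> //; exists (adj i); rewrite wact_adjK.
  move: kE'; rewrite kE wact_tpermE => /(congr1 (fun x : weight n => x i)).
  rewrite !(weightD, weightN, weightMz) rootE eqxx eq_sym (negPf (ordS_neq si)).
  by case: tk => /= -[]; lia.
rewrite hf_step // rE; case: ifP => _.
  have [u uE us] := @opU_lmon A n q i si lam; exists (u + opU q i r).
    by rewrite opUD uE addrA.
  apply: suppinD; first exact: suppinS us.
  by apply: (suppin_opU si _ rl) => k k'; apply: low_on_string.
have [u uE us] := @opV_lmon A n q i si lam li; exists (u + opV q i r).
  by rewrite opVD uE addrA.
apply: suppinD; first exact: suppinS us.
by apply: (suppin_opV si _ rl) => k k'; apply: low_on_string.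
Qed.

(** Lexicographic order on length and ascents coded as one natural number; n * n bounds the number
    of ascents. *)
Definition wdeg lam : nat := (`|n2 lam| * (n * n).+1 + asc lam)%N.

Lemma low_wdeg lam k : low lam k -> (wdeg k < wdeg lam)%N.
Proof.
have asc_le mu : (asc mu <= n * n)%N.
  by apply: leq_trans (max_card _) _; rewrite card_prod !card_ord.
have := n2_ge0 lam; have := n2_ge0 k; have := asc_le k; rewrite /low /wdeg.
case: (n2 lam) (n2 k) => [m|//] [m'|//] ak _ _ [|[]] /=; last by move=> [->] _; rewrite ltn_add2l.
rewrite ltz_nat => mm; apply: leq_trans (leq_addr _ _).
apply: leq_trans (_ : m'.+1 * (n * n).+1 <= _)%N; last by rewrite leq_mul2r mm orbT.
by rewrite mulSn addnC ltn_add2r ltnS.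
Qed.

(** Leading coefficients are 1, so x^k is solved for by induction on [wdeg] over any ring. The
    condition Q confines the expansion, for instance to nonpositive weights in the Cauchy
    identity. *)
Lemma hf_span (Q : weight n -> Prop) c h : injective c ->
    (forall i k k', simple i -> Q k -> on_string i k false k' -> Q k') ->
  suppin Q h -> exists2 g, suppin Q g & lext (e^~ c) g = h.
Proof.
move=> ci Qs Qh.
apply: (suppin_ind (P := fun h => exists2 g, suppin Q g & lext (e^~ c) g = h) Qh).
- by exists 0; [apply: suppin0|apply: linear0].
- move=> _ _ [g1 Q1 <-] [g2 Q2 <-]; exists (g1 + g2); first exact: suppinD.
  exact: linearD.
move=> a k Qk; suff [g Qg gE] : exists2 g, suppin Q g & lext (e^~ c) g = lmon k.
  by exists (a *: g); [apply: suppinZ|rewrite linearZ /= gE].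
move: {2}(wdeg k) (erefl (wdeg k)) => m; elim/ltn_ind: m k Qk => m IH k Qk mE.
have [r rE rl] := hf_triangular k ci.
have Qr : suppin Q r.
  have -> : r = e k c - lmon k by rewrite rE addrC addKr.
  apply: suppinD; first exact: hf_supp.
  by apply: suppinN; apply: suppin_mon.
have Qlr : suppin (fun k' => Q k' /\ low k k') r.
  by move=> k' k'r; split; [apply: Qr|apply: rl].
have [g Qg gE] : exists2 g, suppin Q g & lext (e^~ c) g = r.
  apply: (suppin_ind (P := fun r => exists2 g, suppin Q g & lext (e^~ c) g = r) Qlr).
  - by exists 0; [apply: suppin0|apply: linear0].
  - move=> _ _ [g1 Q1 <-] [g2 Q2 <-]; exists (g1 + g2); first exact: suppinD.
    exact: linearD.
  move=> b k' [Qk' /low_wdeg]; rewrite mE => /IH/(_ k' Qk' erefl)[g Qg gE].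
  by exists (b *: g); [apply: suppinZ|rewrite linearZ /= gE].
exists (lmon k - g); first by apply: suppinD; [apply: suppin_mon|apply: suppinN].
by rewrite linearB /= lext_mon gE rE addrK.
Qed.

Lemma lc_hf lam k c : injective c -> lc (e lam c) k != 0 -> k = lam \/ low lam k.
Proof.
move=> ci; have [r -> rl] := hf_triangular lam ci.
rewrite lcD lc_mon; have [->|lk] := eqVneq lam k; first by left.
by rewrite add0r; right; apply: rl.
Qed.

Lemma low_irr lam : ~ low lam lam.
Proof. by case=> [|[_ _]]; rewrite ?ltxx ?ltnn. Qed.

Lemma lc_hf_diag lam c : injective c -> lc (e lam c) lam = 1.
Proof.
move=> ci; have [r -> rl] := hf_triangular lam ci.
rewrite lcD lc_mon eqxx; have [->|/rl/low_irr //] := eqVneq (lc r lam) 0.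
by rewrite addr0.
Qed.

(** Coefficients vanish by descending induction on [wdeg]: x^k occurs in e_k with coefficient 1 and
    otherwise only in members of larger [wdeg]. The bound B starts the induction outside the support
    of g. *)
Lemma hf_free c g : injective c -> lext (e^~ c) g = 0 -> g = 0.
Proof.
move=> ci g0; pose B := (\sum_(k <- lsupp g) (wdeg k).+1)%N.
have bnd k : k \in lsupp g -> (wdeg k < B)%N.
  by move=> kg; rewrite /B (big_fsetD1 k) //= leq_addr.
apply: lauP => k; rewrite lc0.
move: {2}(B - wdeg k)%N (leqnn (B - wdeg k)) => d; elim: d k => [|d IH] k kd.
  by apply: lc_out; apply/negP => /bnd; lia.
have := congr1 (fun f => lc f k) g0; rewrite lext.unlock lc_sum lc0.
have [kg|/lc_out //] := boolP (k \in lsupp g).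
rewrite (big_fsetD1 k) //= lcZ lc_hf_diag // mulr1 big_seq big1 ?addr0 // => k'.
rewrite in_fsetD1 => /andP[k'k k'g]; rewrite lcZ.
have [->|/(lc_hf ci)[kk|/low_wdeg kk]] := eqVneq (lc (e k' c) k) 0; first by rewrite mulr0.
  by rewrite kk eqxx in k'k.
by rewrite IH ?mul0r //; have := bnd k' k'g; lia.
Qed.

End Triangularity.

(** * Base change *)

Section BaseChange.
Variables (A B : comNzRingType) (rho : {rmorphism A -> B}) (n m : nat).
Variable G : {additive weight n -> weight m}.
Notation h := (lmap rho G).
Implicit Types (f g : laur A n).

Lemma lmap0 : h 0 = 0. Proof. exact: rmorph0. Qed.
Lemma lmap1 : h 1 = 1. Proof. exact: rmorph1. Qed.
Lemma lmapD f g : h (f + g) = h f + h g. Proof. exact: rmorphD. Qed.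
Lemma lmapB f g : h (f - g) = h f - h g. Proof. exact: rmorphB. Qed.
Lemma lmapM f g : h (f * g) = h f * h g. Proof. exact: rmorphM. Qed.

Variables (i : 'I_n) (i' : 'I_m).
Hypotheses (si : simple i) (si' : simple i').
Hypothesis G_adj : forall k, G (wact (adj i) k) = wact (adj i') (G k).
Hypothesis G_root : G (root i (ordS i)) = root i' (ordS i').

Lemma lmap_sact f : h (sact (adj i) f) = sact (adj i') (h f).
Proof.
elim/lau_ind: f => [|f g IH IH'|_ a k _ _].
- by rewrite sact0 lmap0 sact0.
- by rewrite sactD !lmapD sactD IH IH'.
by rewrite sactZ !lmapZ sactZ sact_mon !lmap_mon sact_mon G_adj.
Qed.

Lemma lmap_ldiv f : h (ldiv i f) = ldiv i' (h f).
Proof.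
apply: (one_sub_root_inj si'); rewrite ldivP -lmap_sact -lmapB -ldivP.
by rewrite lmapM lmapB lmap1 lmap_mon raddfN /= G_root.
Qed.

(** Coefficients and exponents change together so that one lemma serves both extension of scalars
    ([G] the identity) and the addition of a variable ([rho] the identity). *)
Lemma lmap_opU q f : h (opU q i f) = opU (rho q) i' (h f).
Proof. by rewrite !opU.unlock lmapD lmapZ lmap_sact lmap_ldiv rmorphB rmorph1. Qed.

Lemma lmap_opV q f : h (opV q i f) = opV (rho q) i' (h f).
Proof. by rewrite !opV.unlock lmapD lmapZ lmap_opU rmorphB rmorph1. Qed.

End BaseChange.

Lemma hf_map (R : realType) (A B : comNzRingType) (rho : {rmorphism A -> B}) n (q : A)
    (e : weight n -> ('I_n -> R) -> laur A n) :
  hecke_family q e -> hecke_family (rho q) (fun lam c => lmap rho idfun (e lam c)).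
Proof.
case=> ed eU eV; split=> [lam c ci dl|i lam c ci si cc ll|i lam c ci si cc ll].
- by rewrite ed // lmap_mon.
- by rewrite eU // (@lmap_opU _ _ _ _ _ _ i i).
- by rewrite eV // (@lmap_opV _ _ _ _ _ _ i i).
Qed.

(** * The constant term functional *)

Definition geo (C : comNzRingType) (M : nat) (y : C) : C := \sum_(m < M.+1) y ^+ m.

Lemma geoP (C : comNzRingType) (M : nat) (y : C) : y ^+ M.+1 = 0 -> (1 - y) * geo M y = 1.
Proof. by move=> y0; rewrite -opprB mulNr -subrX1 y0 sub0r opprK. Qed.

Lemma rmorph_geo (C D : comNzRingType) (h : {rmorphism C -> D}) M y :
  h (geo M y) = geo M (h y).
Proof. by rewrite /geo rmorph_sum; apply: eq_bigr => m _; rewrite rmorphXn. Qed.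

Section ConstantTerm.
Variables (B : comNzRingType) (q : B) (M n : nat).
Hypothesis q_nilp : q ^+ M.+1 = 0.
Notation L := (laur B n).
Implicit Types (f g h : L) (k : weight n) (i j : 'I_n).

Definition zr i j : L := lmon (root i j).

Lemma zr_inv i j : zr i j * zr j i = 1.
Proof. by rewrite /zr -lmonD -rootN addNr lmon0. Qed.

Lemma scale_zr_nilp i j : (q *: zr i j) ^+ M.+1 = 0.
Proof. by rewrite exprZn q_nilp scale0r. Qed.

(** Truncated form of (1 - x_i / x_j) / (1 - q x_i / x_j). *)
Definition kern (p : 'I_n * 'I_n) : L := (1 - zr p.1 p.2) * geo M (q *: zr p.1 p.2).
Definition Delta : L := \prod_(p : 'I_n * 'I_n | (p.1 < p.2)%N) kern p.
Definition ct f : B := lc (f * Delta) 0.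

Lemma ctD f g : ct (f + g) = ct f + ct g.
Proof. by rewrite /ct mulrDl lcD. Qed.
Lemma ctZ a f : ct (a *: f) = a * ct f.
Proof. by rewrite /ct -scalerAl lcZ. Qed.
Lemma ctB f g : ct (f - g) = ct f - ct g.
Proof. by rewrite ctD -scaleN1r ctZ mulN1r. Qed.
Lemma ct0 : ct 0 = 0. Proof. by rewrite /ct mul0r lc0. Qed.

Lemma sact_zr w i j : sact w (zr i j) = zr (w i) (w j).
Proof. by rewrite /zr sact_mon wact_root. Qed.

Lemma sact_kern w p : sact w (kern p) = kern (w p.1, w p.2).
Proof. by rewrite /kern sactMr sactD sactN sact_one rmorph_geo /= sactZ !sact_zr. Qed.

(** By [opU_sub1] the denominator attached to (i, i + 1) cancels, leaving s_i h - h times the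
    product D' over the other pairs. D' is invariant under s_i, and s_i preserves constant terms. *)
Lemma ct_opU_sub1 i h : simple i -> ct (opU q i h - h) = 0.
Proof.
move=> si; pose P (p : 'I_n * 'I_n) := (p.1 < p.2)%N && (p != (i, ordS i)).
pose D' : L := \prod_(p | P p) kern p.
have DE : Delta = kern (i, ordS i) * D'.
  by rewrite /Delta (bigD1 (i, ordS i)) //= modn_small.
have sD' : sact (adj i) D' = D'.
  rewrite /D' rmorph_prod /=; pose t (p : 'I_n * 'I_n) := (adj i p.1, adj i p.2).
  have tK : involutive t by case=> a b; rewrite /t /= !tpermK.
  rewrite [RHS](reindex_inj (inv_inj tK)); apply: eq_big => [[a b]|p _]; last exact: sact_kern.
  rewrite /P /t /=.
  have [/andP[/eqP -> /eqP ->]|ab] := boolP ((a == i) && (b == ordS i)).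
    by rewrite tpermL tpermR eqxx andbF val_ordS // ltnNge leqnSn.
  have [/andP[/eqP -> /eqP ->]|ba] := boolP ((a == ordS i) && (b == i)).
    by rewrite tpermL tpermR eqxx andbF val_ordS // ltnNge leqnSn.
  rewrite adj_lt // xpair_eqE ab; congr (_ && _); apply/esym.
  apply: contraNneq ba => -[/(congr1 (adj i)) + /(congr1 (adj i))].
  by rewrite !tpermK tpermL tpermR => -> ->; rewrite !eqxx.
rewrite /ct opU_sub1 // DE.
have -> : (lcst _ q - lmon (- root i (ordS i))) * ldiv i h * (kern (i, ordS i) * D') =
    (sact (adj i) h - h) * D'.
  rewrite -ldivP /kern /= rootN -/(zr _ _).
  have := geoP (scale_zr_nilp i (ordS i)); have := zr_inv i (ordS i).
  rewrite scale_lcst; move: (zr i _) (zr _ i) (lcst _ q) => z z' Q.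
  move: (geo M (Q * z)) (ldiv i h) => G d zz' g1.
  have -> : (Q - z') = - z' * (1 - Q * z) by rewrite mulrBr mulr1 mulNr mulrCA mulrC [z' * z]mulrC; ring: zz'.
  transitivity (- z' * (1 - z) * d * D' * ((1 - Q * z) * G)); first by ring.
  by rewrite g1; ring: zz'.
rewrite mulrBl lcD lcN -{1}sD' -sactMr lc_sact.
have -> : wact (adj i)^-1 0 = 0 :> weight n by apply: raddf0.
by rewrite subrr.
Qed.

Lemma ct_opU i f g : simple i -> ct (opU q i f * g) = ct (f * opU q i g).
Proof.
by move=> si; apply/eqP; rewrite -subr_eq0 -ctB opU_adj // ct_opU_sub1.
Qed.

Lemma ct_opV i f g : simple i -> ct (opV q i f * g) = ct (f * opV q i g).
Proof.
move=> si; apply/eqP; rewrite -subr_eq0 -ctB opV_adj //.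
by rewrite ctB ct_opU // subrr.
Qed.

Definition rho_w : weight n := [ffun i : 'I_n => - (nat_of_ord i)%:Z].

(** Stands for the cone generated by the positive roots, described by the inequalities that are
    needed: [rho_w] separates its nonzero elements from 0. *)
Definition qplus k := (forall lam, dominant lam -> 0 <= pair_w lam k) /\
  (k != 0 -> 0 < pair_w rho_w k).

Lemma qplus0 : qplus 0.
Proof. by split=> [lam _|]; rewrite ?pair_w0 ?eqxx. Qed.

Lemma rho_w_dominant : dominant rho_w.
Proof. by apply/dominantP => i j ij; rewrite !ffunE; lia. Qed.

Lemma qplusD k k' : qplus k -> qplus k' -> qplus (k + k').
Proof.
move=> [k1 k2] [k1' k2']; split=> [lam dl|kk0]; first by rewrite pair_wDr addr_ge0 ?k1 ?k1'.
rewrite pair_wDr; have [k0|/k2 kp] := eqVneq k 0.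
  by move: kk0; rewrite k0 add0r pair_w0 add0r.
by apply: ltr_wpDr => //; apply: k1'; apply: rho_w_dominant.
Qed.

Lemma qplus_root i j : (i < j)%N -> qplus (root i j).
Proof.
move=> ij; split=> [lam /dominantP dl|_]; rewrite pair_w_root.
  by rewrite subr_ge0; apply/dl/ltnW.
by rewrite [rho_w i]ffunE [rho_w j]ffunE opprK addrC subr_gt0 ltz_nat.
Qed.

Definition qunit f := suppin qplus f /\ lc f 0 = 1.

Lemma qunitM f g : qunit f -> qunit g -> qunit (f * g).
Proof.
move=> [f1 f2] [g1 g2]; split; first by apply: suppinM f1 g1; apply: qplusD.
rewrite lcM (fsum1 (x := 0)) ?f2 ?mul1r ?subr0 // => [/lc_out|k + k0].
  by rewrite f2 => /eqP; rewrite oner_eq0.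
rewrite lsuppP => /f1[_ /(_ k0) kp].
have [->|/g1[/(_ _ rho_w_dominant)]] := eqVneq (lc g (0 - k)) 0; first by rewrite mulr0.
by rewrite sub0r pair_wNr; lia.
Qed.

Lemma qunit1 : qunit 1.
Proof. by split; [apply: suppin1; apply: qplus0|rewrite lc1 eqxx]. Qed.

Lemma qunit_root i j f : (i < j)%N -> suppin qplus f -> qunit (1 + zr i j * f).
Proof.
move=> ij fS; have rS : suppin (fun k => qplus k /\ k != 0) (zr i j * f).
  have zS : suppin (fun k => k = root i j) (zr i j) by apply: suppin_mon.
  apply: suppinM zS fS => _ k -> kS; split; first by apply: qplusD => //; apply: qplus_root.
  have [k1 _] := kS; have [_ r2] := qplus_root ij.
  have r0 : root i j != 0.
    apply/eqP => /(congr1 (fun x : weight n => x i)).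
    by rewrite rootE weight0 eqxx eq_sym ord_eqE (ltn_eqF ij).
  apply/eqP => /(congr1 (pair_w rho_w)); rewrite pair_wDr pair_w0.
  by have := r2 r0; have := k1 _ rho_w_dominant; lia.
split; last first.
  rewrite lcD lc1 eqxx; have [->|/rS[_]] := eqVneq (lc (zr i j * f) 0) 0; last by rewrite eqxx.
  by rewrite addr0.
apply: suppinD; first by apply: suppin1; apply: qplus0.
by apply: suppinS rS => k [].
Qed.

Lemma qunit_kern i j : (i < j)%N -> qunit (kern (i, j)).
Proof.
move=> ij; rewrite /kern /=; apply: qunitM.
  rewrite -mulrN1; apply: qunit_root => //; apply: suppinN.
  by apply: suppin1; apply: qplus0.
rewrite /geo big_ord_recl expr0.
under eq_bigr do rewrite exprS -scalerAl scalerAr.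
rewrite -mulr_sumr; apply: qunit_root => //; apply: suppin_sum => m _; apply: suppinZ.
rewrite exprZn lmonX; apply: suppinZ; apply: suppin_mon.
elim: (nat_of_ord m) => [|m' IH]; rewrite ?mulr0n ?mulrS; first exact: qplus0.
by apply: qplusD => //; apply: qplus_root.
Qed.

Lemma qunit_Delta : qunit Delta.
Proof.
rewrite /Delta; apply: (big_ind qunit); [exact: qunit1|exact: qunitM|].
by move=> [i j]; apply: qunit_kern.
Qed.

Lemma ct_mon k : ct (lmon k) = lc Delta (- k).
Proof. by rewrite /ct lc_monM sub0r. Qed.

(* If [lam] is dominant then x^lam * x^k has nonzero image only if -k lies
   above [lam] in dominance order, and then -k is at least as long as [lam]. *)
Lemma ct_dominant lam k : dominant lam -> ct (lmon (lam + k)) != 0 ->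
  k = - lam \/ n2 lam < n2 k.
Proof.
move=> dl; rewrite ct_mon => /qunit_Delta.1[/(_ _ dl)]; set g := - (lam + k).
have -> : n2 k = n2 (lam + g) by rewrite /g opprD addNKr n2N.
move=> lg _; rewrite n2D; have := n2_ge0 g; rewrite le_eqVlt => /orP[/eqP/esym/n2_eq0 g0|gp].
  by left; move: g0; rewrite /g => /eqP; rewrite oppr_eq0 addrC addr_eq0 => /eqP.
by right; lia.
Qed.

Lemma ct1 : ct 1 = 1.
Proof. by rewrite -lmon0 ct_mon oppr0 qunit_Delta.2. Qed.

End ConstantTerm.

(** * Duality *)

Section Duality.
Variables (R : realType) (B : comNzRingType) (q : B) (M n : nat).
Hypothesis q_nilp : q ^+ M.+1 = 0.
Variable e : weight n -> ('I_n -> R) -> laur B n.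
Hypothesis he : hecke_family q e.
Implicit Types (lam mu k : weight n) (c : 'I_n -> R) (i : 'I_n).
Notation ct := (@ct B q M n).

Definition oppw c : 'I_n -> R := fun i => - c i.

Lemma oppw_inj c : injective c -> injective (oppw c).
Proof. by move=> ci a b /oppr_inj/ci. Qed.

Definition dpair lam mu c := ct (e lam c * e (- mu) (oppw c)).

(** The operator producing e of s_i lam is moved to the other factor. There it either performs a
    swap of - mu as well, or undoes one, in which case U V = q leaves a factor q. The latter
    requires lam and mu to be ordered differently at i, hence to be distinct. *)
Lemma dpair_swap i lam mu c : injective c -> simple i -> lam (ordS i) < lam i ->
  exists2 d : nat, dpair (wact (adj i) lam) (wact (adj i) mu) c =
    q ^+ d * dpair lam mu (c \o adj i) & (lam = mu -> d = 0%N).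
Proof.
move=> ci si li; set c' := c \o adj i.
have ci' : injective c' by apply: adj_inj.
have ni := oppw_inj ci; have ni' := oppw_inj ci'.
have cc' : oppw c \o adj i = oppw c' by [].
have c'c : oppw c' \o adj i = oppw c by apply/funext => k; rewrite /oppw /c' /= tpermK.
have c'i : c' i = c (ordS i) by rewrite /c' /= tpermL.
have c'j : c' (ordS i) = c i by rewrite /c' /= tpermR.
rewrite /dpair (hf_step he) // -/c'; case: ltP => cij.
  case: (lerP (mu (ordS i)) (mu i)) => mui.
    exists 0%N; rewrite // expr0 mul1r ct_opU //; congr (ct (_ * _)).
    rewrite -[in RHS](wact_adjK i mu) -(wactN (adj i) (wact _ mu)) -cc'.
    by rewrite (hf_U he) // /oppw ?ltrN2 // !weightN !wact_tperm tpermL tpermR lerN2.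
  exists 1%N; last by move=> lm; move: li; rewrite lm => /lt_trans/(_ mui); rewrite ltxx.
  rewrite ct_opU // -wactN -c'c (hf_V he) ?opUV // -?scalerAr ?ctZ //.
    by rewrite /oppw ltrN2 c'i c'j.
  by rewrite !weightN ltrN2.
have {}cij : c (ordS i) < c i by rewrite lt_neqAle cij andbT (inj_eq ci) eq_sym ordS_neq.
case: (lerP (mu i) (mu (ordS i))) => mui.
  exists 1%N; last by move=> lm; move: li; rewrite lm ltNge mui.
  rewrite ct_opV // -wactN -c'c (hf_U he) ?opVU // -?scalerAr ?ctZ //.
    by rewrite /oppw ltrN2 c'i c'j.
  by rewrite !weightN lerN2.
exists 0%N; rewrite // expr0 mul1r ct_opV //; congr (ct (_ * _)).
rewrite -[in RHS](wact_adjK i mu) -(wactN (adj i) (wact _ mu)) -cc'.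
by rewrite (hf_V he) // /oppw ?ltrN2 // !weightN !wact_tperm tpermL tpermR ltrN2.
Qed.

(** The entries of - lam are weakly increasing, so every pair of unequal entries is already an
    ascent there. *)
Lemma asc_dominant lam w : dominant lam -> (asc (- wact w lam) <= asc (- lam))%N.
Proof.
move=> /dominantP dl; rewrite /asc /ninv.
have wi : injective (fun p : 'I_n * 'I_n => ((w^-1)%g p.1, (w^-1)%g p.2)).
  by case=> [a b] [a' b'] /= [/perm_inj -> /perm_inj ->].
rewrite -(card_imset _ wi); apply: subset_leq_card; apply/fintype.subsetP => p.
case/imsetP => -[a b]; rewrite !inE /= => /andP[_]; rewrite !weightN !ltrN2 !ffunE.
move=> ab ->; rewrite /= ab andbT ltnNge; apply/negP => /dl.
by rewrite leNgt ab.
Qed.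

Lemma dpair_le lam mu c : injective c -> n2 mu <= n2 lam ->
  dpair lam mu c = (lam == mu)%:R.
Proof.
elim/weight_ind: lam mu c => [lam dl mu c ci ml|i lam si li IH mu c ci].
  have ni := oppw_inj ci; rewrite /dpair (hf_dominant he) //; set f := e _ _.
  have fS k : lc f k != 0 -> k = - mu \/ low (- mu) k by apply: (lc_hf he ni).
  (* No exponent of f is longer than mu, hence none is longer than lam, and [ct_dominant] leaves the
     single exponent - lam. *)
  have -> : ct (lmon lam * f) = lc f (- lam).
    have ctS : ct (lmon lam * f) = \sum_(k <- lsupp f) lc f k * ct (lmon (lam + k)).
      rewrite {1}[f]lauE mulr_sumr (big_morph _ (@ctD B q M n) (ct0 _ _ _)).
      by apply: eq_bigr => k _; rewrite -scalerAr ctZ -lmonD.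
    have term k : k \in lsupp f -> k != - lam -> lc f k * ct (lmon (lam + k)) = 0.
      rewrite lsuppP => /fS fk kl; have n2k : n2 k <= n2 mu.
        by case: fk => [->|[/ltW|[-> _ _]]]; rewrite n2N.
      have [->|/(ct_dominant dl)[kE|]] := eqVneq (ct (lmon (lam + k))) 0.
      - by rewrite mulr0.
      - by rewrite kE eqxx in kl.
      - by move=> /(le_lt_trans ml); rewrite ltNge n2k.
    rewrite ctS (fsum1 (x := - lam) _ term) ?subrr ?lmon0 ?ct1 ?mulr1 // => /lc_out //.
  have [->|lm] := eqVneq lam mu; first by rewrite (lc_hf_diag he).
  apply/eqP; apply: contraT => /fS[/oppr_inj/eqP|]; first by rewrite (negPf lm).
  (* At equal lengths, - mu would lie in the orbit of - lam and have more ascents, against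
     [asc_dominant]. *)
  case=> [|[_ [w wE]]]; first by rewrite !n2N ltNge ml.
  have -> : - mu = - wact w^-1 lam by rewrite -wactN wE wactK.
  by rewrite ltnNge asc_dominant.
rewrite n2_wact => ml; have [d dE d0] := dpair_swap (wact (adj i) mu) ci si li.
rewrite wact_adjK in dE d0; rewrite dE IH ?n2_wact //; last exact: adj_inj.
rewrite -(inj_eq (can_inj (wactK (adj i)))) wact_adjK.
have [lm|_] := eqVneq; last by rewrite mulr0.
by rewrite d0 ?mul1r // -lm wact_adjK.
Qed.

(* Moving adjacent swaps from one factor to the other reduces to dominant [lam],
   where [ct_dominant] applies if [mu] is not longer than [lam]; otherwise
   exchange the roles of [lam] and [- mu]. *)
Theorem hf_dual lam mu c : injective c -> dpair lam mu c = (lam == mu)%:R.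
Proof.
move=> ci; have [|/ltW ml] := lerP (n2 mu) (n2 lam); first exact: dpair_le.
have -> : dpair lam mu c = dpair (- mu) (- lam) (oppw c).
  rewrite /dpair mulrC opprK; congr (ct (_ * e _ _)).
  by apply/funext => k; rewrite /oppw opprK.
by rewrite dpair_le ?n2N // ?eqr_opp 1?eq_sym //; apply: oppw_inj.
Qed.

End Duality.

(** * The Cauchy identity *)

Section Cauchy.
Variables (B : comNzRingType) (q : B) (M N n : nat) (X : 'I_n -> B).
Hypothesis q_nilp : q ^+ M.+1 = 0.
Hypothesis X_nilp : forall i, X i ^+ N.+1 = 0.
Notation L := (laur B n).
Implicit Types (f g h : L) (k : weight n) (i j m : 'I_n).
Notation ctq := (@ct B q M n).

Definition ymon i : L := lmon (eps i).
Definition ymonV i : L := lmon (- eps i).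
Definition xyinv i j : L := X i *: ymonV j.

Lemma ymonK i : ymon i * ymonV i = 1. Proof. exact: lmonVr. Qed.

Lemma xyinv_nilp i j : xyinv i j ^+ N.+1 = 0.
Proof. by rewrite exprZn X_nilp scale0r. Qed.

Definition cauchy_kernel : L :=
  (\prod_(p : 'I_n * 'I_n | (p.1 < p.2)%N) (1 - q *: xyinv p.1 p.2)) *
  \prod_(p : 'I_n * 'I_n | (p.1 <= p.2)%N) geo N (xyinv p.1 p.2).

(** Kernel and weight function are regrouped into rows: row i contains no y_m with m < i, so the
    variables can be eliminated one after the other. *)
Definition cauchy_factor i j : L := kern q M (i, j) * (1 - q *: xyinv i j) * geo N (xyinv i j).
Definition cauchy_row i : L := geo N (xyinv i i) * \prod_(j < n | (i < j)%N) cauchy_factor i j.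

Lemma cauchy_kernel_Delta :
  cauchy_kernel * Delta q M n = \prod_(i < n) cauchy_row i.
Proof.
rewrite /cauchy_kernel /Delta.
have E (F : 'I_n * 'I_n -> L) :
    \prod_(p : 'I_n * 'I_n | (p.1 < p.2)%N) F p =
    \prod_(i < n) \prod_(j < n | (i < j)%N) F (i, j).
  by rewrite pair_big_dep; apply: eq_big => [[]|[]].
have E' (F : 'I_n * 'I_n -> L) :
    \prod_(p : 'I_n * 'I_n | (p.1 <= p.2)%N) F p =
    \prod_(i < n) (F (i, i) * \prod_(j < n | (i < j)%N) F (i, j)).
  transitivity (\prod_(i < n) \prod_(j < n | (i <= j)%N) F (i, j)).
    by rewrite pair_big_dep; apply: eq_big => [[]|[]].
  apply: eq_bigr => i _; rewrite (bigD1 i) //=; congr (_ * _).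
  by apply: eq_bigl => j; rewrite ltn_neqAle andbC eq_sym.
rewrite !E E' -!big_split; apply: eq_bigr => i _ /=.
rewrite /cauchy_row /cauchy_factor !big_split /=; ring.
Qed.

(* On Laurent polynomials without negative powers of y_m, multiplying by
   1 / (1 - X_m / y_m) and taking the coefficient of y_m^0 substitutes X_m for
   y_m; [cgr m] is the congruence modulo y_m - X_m. *)
Definition nneg m f := suppin (fun k => 0 <= k m) f.
Definition cgr m f g := [/\ nneg m f, nneg m g &
  exists2 h, nneg m h & f - g = (ymon m - lcst _ (X m)) * h].

Lemma nnegM m f g : nneg m f -> nneg m g -> nneg m (f * g).
Proof. by apply: suppinM => k k' k0 k'0; rewrite weightD addr_ge0. Qed.

Lemma nneg_cst m a : nneg m (lcst _ a).
Proof. by apply: suppinZ; apply: suppin1; rewrite weight0. Qed.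

Lemma cgr_refl m f : nneg m f -> cgr m f f.
Proof.
by move=> nf; split=> //; exists 0; [exact: suppin0|rewrite subrr mulr0].
Qed.

Lemma cgrD m f f' g g' : cgr m f f' -> cgr m g g' -> cgr m (f + g) (f' + g').
Proof.
move=> [n1 n2 [h nh e]] [n1' n2' [h' nh' e']]; split; try exact: suppinD.
by exists (h + h'); [exact: suppinD|rewrite opprD addrACA e e' mulrDr].
Qed.

Lemma cgrM m f f' g g' : cgr m f f' -> cgr m g g' -> cgr m (f * g) (f' * g').
Proof.
move=> [n1 n2 [h nh e]] [n1' n2' [h' nh' e']]; split; try exact: nnegM.
exists (h * g + f' * h'); first by apply: suppinD; apply: nnegM.
have -> : f * g - f' * g' = (f - f') * g + f' * (g - g') by ring.
by rewrite e e'; ring.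
Qed.

Lemma cgrX m f f' a : cgr m f f' -> cgr m (f ^+ a) (f' ^+ a).
Proof.
move=> ff'; elim: a => [|a IH]; last by rewrite !exprS; apply: cgrM.
by apply: cgr_refl; apply: suppin1; rewrite weight0.
Qed.

Lemma cgrZ m a f f' : cgr m f f' -> cgr m (a *: f) (a *: f').
Proof.
by move=> ff'; rewrite !scale_lcst; apply: cgrM => //; apply/cgr_refl/nneg_cst.
Qed.

Lemma cgr_geo m f f' a : cgr m f f' -> cgr m (geo a f) (geo a f').
Proof.
move=> ff'; rewrite /geo; apply: (big_ind2 (cgr m)) => [|g g' h h'|b _].
- by apply: cgr_refl; apply: suppin0.
- exact: cgrD.
- exact: cgrX.
Qed.

Lemma nneg1 m : nneg m 1.
Proof. by apply: suppin1; rewrite weight0. Qed.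

Lemma cgr_ymon m : cgr m (ymon m) (lcst _ (X m)).
Proof.
split; [by apply: suppin_mon; rewrite ffunE eqxx|exact: nneg_cst|].
by exists 1; [exact: nneg1|rewrite mulr1].
Qed.

Lemma nneg_ymonV m j : (m < j)%N -> nneg m (ymonV j).
Proof.
move=> mj; apply: suppin_mon; rewrite weightN ffunE ord_eqE eq_sym.
by rewrite (ltn_eqF mj).
Qed.

(** At y_m = X_m the factor (1 - y_m / y_j) / (1 - q y_m / y_j) of the weight is inverse to the
    factor (1 - q X_m / y_j) / (1 - X_m / y_j) of the kernel. *)
Lemma cgr_cauchy_factor m j : (m < j)%N -> cgr m (cauchy_factor m j) 1.
Proof.
move=> mj; have nj := nneg_ymonV mj.
have zc : cgr m (zr B m j) (xyinv m j).
  have -> : zr B m j = ymon m * ymonV j by rewrite /zr root.unlock lmonD.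
  by rewrite /xyinv scale_lcst; apply: cgrM; [exact: cgr_ymon|exact: cgr_refl].
have nx : nneg m (xyinv m j) by apply: suppinZ.
have nqx : nneg m (1 - q *: xyinv m j).
  by apply: suppinD; [exact: nneg1|apply: suppinN; apply: suppinZ].
(* 1 is written as the value of the factor at y_m = X_m, to be compared term by term. *)
have -> : 1 = ((1 - xyinv m j) * geo M (q *: xyinv m j)) * (1 - q *: xyinv m j) * geo N (xyinv m j) :> L.
  have g1 := geoP (xyinv_nilp m j).
  have g2 : (1 - q *: xyinv m j) * geo M (q *: xyinv m j) = 1.
    by apply: geoP; rewrite exprZn q_nilp scale0r.
  transitivity (((1 - xyinv m j) * geo N (xyinv m j)) * ((1 - q *: xyinv m j) * geo M (q *: xyinv m j))).
    by rewrite g1 g2 mulr1.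
  by ring.
apply: cgrM; last by apply/cgr_geo/cgr_refl.
apply: cgrM; last exact: cgr_refl.
rewrite /kern /=; apply: cgrM; last by apply/cgr_geo/cgrZ.
apply: cgrD; first exact/cgr_refl/nneg1.
by rewrite -!scaleN1r; apply: cgrZ.
Qed.

Definition cauchy_rows (a : nat) : L := \prod_(i < n | (a <= i)%N) cauchy_row i.

Lemma supp0_cauchy_row m i : (m < i)%N -> suppin (fun k => k m = 0) (cauchy_row i).
Proof.
move=> mi; have M0 (f g : L) : suppin (fun k => k m = 0) f -> suppin (fun k => k m = 0) g ->
    suppin (fun k => k m = 0) (f * g).
  by apply: suppinM => k k' k0 k'0; rewrite weightD k0 k'0.
have one0 : suppin (fun k => k m = 0) (1 : L) by apply: suppin1; rewrite weight0.
have X0 f a : suppin (fun k => k m = 0) f -> suppin (fun k => k m = 0) (f ^+ a).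
  by move=> f0; elim: a => [|a IH] //; rewrite exprS; apply: M0.
have g0 f a : suppin (fun k => k m = 0) f -> suppin (fun k => k m = 0) (geo a f).
  by move=> f0; apply: suppin_sum => b _; apply: X0.
have ne j : (m < j)%N -> eps j m = 0 by move=> mj; rewrite ffunE ord_eqE eq_sym (ltn_eqF mj).
have xy0 j : (m < j)%N -> suppin (fun k => k m = 0) (xyinv i j).
  by move=> mj; apply: suppinZ; apply: suppin_mon; rewrite weightN ne // oppr0.
rewrite /cauchy_row; apply: (M0); first by apply/g0/xy0.
apply: (big_ind (suppin (fun k => k m = 0))) => [|f g|j ij]; [exact: one0|exact: (M0)|].
have mj : (m < j)%N by apply: ltn_trans ij.
have z0 : suppin (fun k => k m = 0) (zr B i j).
  by apply: suppin_mon; rewrite root.unlock weightD weightN !ne // subr0.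
rewrite /cauchy_factor /kern; apply: (M0); last by apply/g0/xy0.
apply: (M0); last by apply: suppinD => //; apply: suppinN; apply: suppinZ; apply: xy0.
apply: (M0); first by apply: suppinD => //; apply: suppinN.
by apply: g0; apply: suppinZ.
Qed.

Lemma supp0_cauchy_rows m a : (m < a)%N -> suppin (fun k => k m = 0) (cauchy_rows a).
Proof.
move=> ma; rewrite /cauchy_rows; apply: (big_ind (suppin (fun k => k m = 0))) => [|f g|i ai].
- by apply: suppin1; rewrite weight0.
- by apply: suppinM => k k' k0 k'0; rewrite weightD k0 k'0.
- by apply: supp0_cauchy_row; apply: leq_trans ai.
Qed.

Lemma lc0_supp (Q : weight n -> Prop) f : suppin Q f -> ~ Q 0 -> lc f 0 = 0.
Proof. by move=> Qf Q0; apply/eqP; apply: contraT => /Qf. Qed.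

(** The monomial x^k at X, meant for nonnegative exponents; the X_i are nilpotent and have no
    inverses. *)
Definition monX k : B := \prod_i X i ^+ `|k i|%N.

(** Among the rows from a on, y_a occurs only in row a, and its coefficient of degree 0 is extracted
    by substituting X_a. By [cgr_cauchy_factor] the remaining factors of that row then disappear. *)
Lemma residues a k : (a <= n)%N -> (forall i, 0 <= k i) ->
  (forall i, (i < a)%N -> k i = 0) -> lc (lmon k * cauchy_rows a) 0 = monX k.
Proof.
move: {2}(n - a)%N (erefl (n - a)%N) => d; elim: d a k => [|d IH] a k dE an k0 ka.
  have aE : a = n by lia.
  have -> : k = 0 by apply/ffunP => i; rewrite weight0 ka // aE.
  rewrite lmon0 mul1r /cauchy_rows big_pred0 => [|i]; last by rewrite aE leqNgt ltn_ord.
  by rewrite lc1 eqxx /monX big1 // => i _; rewrite weight0 expr0.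
have an' : (a < n)%N by lia.
pose m := Ordinal an'; pose k' := k - eps m *~ k m.
have k'i i : k' i = if i == m then 0 else k i.
  rewrite /k' weightD weightN weightMz ffunE eq_sym.
  by case: eqP => [->|_]; rewrite ?mul1r ?subrr // mul0r subr0.
have OE : cauchy_rows a = cauchy_row m * cauchy_rows a.+1.
  rewrite /cauchy_rows (bigD1 m) //=; congr (_ * _); apply: eq_bigl => i.
  by rewrite ltn_neqAle eq_sym andbC.
have kE : lmon k = ymon m ^+ `|k m|%N * lmon k' :> L.
  rewrite /ymon lmonX -lmonD; congr lmon.
  by rewrite /k' pmulrn gez0_abs // subrKC.
have cW : cgr m (\prod_(j < n | (m < j)%N) cauchy_factor m j) 1.
  apply: (big_ind (cgr m ^~ 1)) => [|f g f1 g1|j]; last exact: cgr_cauchy_factor.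
    by apply/cgr_refl/nneg1.
  by rewrite -[X in cgr m _ X]mulr1; apply: cgrM.
have [_ _ [h hn hE]] := cgrM (cgrX `|k m|%N (cgr_ymon m)) cW.
pose O' := lmon k' * cauchy_rows a.+1.
have O0 : suppin (fun k => k m = 0) O'.
  apply: suppinM (supp0_cauchy_rows (ltnSn m)) => [k1 k2 k1m k2m|]; last first.
    by apply: (suppin_mon (Q := fun k => k m = 0)); rewrite k'i eqxx.
  by rewrite weightD k1m k2m.
have yX : (ymon m - lcst _ (X m)) * geo N (xyinv m m) = ymon m.
  have -> : ymon m - lcst _ (X m) = ymon m * (1 - xyinv m m).
    by rewrite mulrBr mulr1 /xyinv scale_lcst mulrCA ymonK mulr1.
  by rewrite -mulrA geoP ?mulr1 // xyinv_nilp.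
have [r rE rS] : exists2 r, geo N (xyinv m m) = 1 + r & suppin (fun k => k m <= -1) r.
  exists (\sum_(b < N) xyinv m m ^+ b.+1); first by rewrite /geo big_ord_recl.
  apply: suppin_sum => b _; rewrite exprZn lmonX; apply: suppinZ; apply: suppin_mon.
  by rewrite mulNrn weightN pmulrn weightMz ffunE eqxx mul1r; lia.
(* The first summand is free of y_m; the second has only negative powers of y_m and the third only
   positive ones, so neither has a constant term. *)
have -> : lmon k * cauchy_rows a = lcst _ (X m) ^+ `|k m|%N * O' +
    (lcst _ (X m) ^+ `|k m|%N * (r * O') + ymon m * h * O').
  have -> : lmon k * cauchy_rows a = geo N (xyinv m m) *
     (ymon m ^+ `|k m|%N * \prod_(j < n | (m < j)%N) cauchy_factor m j) * O'.
    by rewrite OE kE /cauchy_row /O'; ring.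
  have -> : ymon m ^+ `|k m|%N * \prod_(j < n | (m < j)%N) cauchy_factor m j =
     lcst _ (X m) ^+ `|k m|%N + (ymon m - lcst _ (X m)) * h.
    by rewrite -hE mulr1 addrC subrK.
  transitivity (geo N (xyinv m m) * lcst _ (X m) ^+ `|k m|%N * O' +
     ((ymon m - lcst _ (X m)) * geo N (xyinv m m)) * h * O'); first by ring.
  by rewrite yX rE; ring.
rewrite !lcD [X in _ + (_ + X)](@lc0_supp (fun k => 1 <= k m)) ?addr0; first last.
- by rewrite weight0.
- have yh : suppin (fun k => 1 <= k m) (ymon m * h).
    apply: suppinM hn => [k1 k2 k1m k2m|]; last first.
      by apply: (suppin_mon (Q := fun k => k m = 1)); rewrite ffunE eqxx.
    by rewrite weightD k1m; lia.
  by apply: suppinM yh O0 => k1 k2 k1m k2m; rewrite weightD k2m addr0.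
have lcX f : lc (lcst _ (X m) ^+ `|k m|%N * f) 0 = X m ^+ `|k m|%N * lc f 0.
  by rewrite -rmorphXn -scale_lcst lcZ.
rewrite !lcX [X in _ + _ * X](@lc0_supp (fun k => k m <= -1)) ?mulr0 ?addr0; first last.
- by rewrite weight0.
- by apply: suppinM rS O0 => k1 k2 k1m k2m; rewrite weightD k2m addr0.
rewrite /O' IH //; last first.
- move=> i; rewrite k'i ltnS leq_eqVlt ord_eqE => /orP[->//|ia].
  by rewrite ka // if_same.
- by move=> i; rewrite k'i; case: ifP.
- by lia.
rewrite /monX [RHS](bigD1 m) //= (bigD1 m) //= k'i eqxx expr0 mul1r.
by congr (_ * _); apply: eq_bigr => i /negPf im; rewrite k'i im.
Qed.

Lemma ct_cauchy_mon k : (forall i, 0 <= k i) -> ctq (lmon k * cauchy_kernel) = monX k.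
Proof.
move=> k0; rewrite /ct -mulrA cauchy_kernel_Delta -(@residues 0) //.
Qed.

Definition evX (h : L) : B := lext (V := B^o) monX h.

(** The kernel is reproducing: pairing a polynomial with it evaluates the polynomial at X. *)
Lemma ct_cauchy h : suppin (fun k => forall i, 0 <= k i) h -> ctq (h * cauchy_kernel) = evX h.
Proof.
move=> h0; apply: (suppin_ind (P := fun h => ctq (h * cauchy_kernel) = evX h) h0).
- by rewrite mul0r ct0 /evX linear0.
- by move=> f g fE gE; rewrite mulrDl ctD fE gE /evX linearD.
move=> a k k0; rewrite -scalerAl ctZ ct_cauchy_mon // /evX linearZ /= lext_mon.
by [].
Qed.

Variables (R : realType) (e : weight n -> ('I_n -> R) -> L).
Hypothesis he : hecke_family q e.

Lemma npos_string i k k' : simple i -> (forall j, k j <= 0) -> on_string i k false k' ->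
  forall j, k' j <= 0.
Proof.
move=> si k0 [t -> tk] a; rewrite weightD weightN weightMz rootE.
have := k0 i; have := k0 (ordS i); have := k0 a; have ij := ordS_neq si.
case: (i =P a) => [<-|_]; first by rewrite eq_sym (negPf ij); lia.
by case: (ordS i =P a) => [<-|_]; lia.
Qed.

Lemma nneg_string i k k' : simple i -> (forall j, 0 <= k j) -> on_string i k false k' ->
  forall j, 0 <= k' j.
Proof.
move=> si k0 [t -> tk] a; rewrite weightD weightN weightMz rootE.
have := k0 i; have := k0 (ordS i); have := k0 a; have ij := ordS_neq si.
case: (i =P a) => [<-|_]; first by rewrite eq_sym (negPf ij); lia.
by case: (ordS i =P a) => [<-|_]; lia.
Qed.

Lemma hf_nneg k c : injective c -> (forall i, 0 <= k i) ->
  suppin (fun k => forall i, 0 <= k i) (e k c).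
Proof. by move=> ci k0; apply: (hf_supp he) => // i k1 k2; apply: nneg_string. Qed.

Lemma xyinv_supp i j : suppin (fun k => forall i, k i <= 0) (xyinv i j).
Proof. by apply: suppinZ; apply: suppin_mon => a; rewrite weightN ffunE; case: eqP. Qed.

Lemma cauchy_kernel_npos : suppin (fun k => forall i, k i <= 0) cauchy_kernel.
Proof.
have M0 (f g : L) : suppin (fun k => forall i, k i <= 0) f ->
    suppin (fun k => forall i, k i <= 0) g -> suppin (fun k => forall i, k i <= 0) (f * g).
  by apply: suppinM => k k' k0 k'0 i; rewrite weightD; have := k0 i; have := k'0 i; lia.
have one0 : suppin (fun k => forall i, k i <= 0) (1 : L).
  by apply: suppin1 => i; rewrite weight0.
apply: (M0); (apply: (big_ind (suppin (fun k => forall i, k i <= 0))) => [|f g|p _];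
  [exact: one0|exact: (M0)|]).
  by apply: suppinD => //; apply: suppinN; apply: suppinZ; apply: xyinv_supp.
apply: suppin_sum => b _; elim: (nat_of_ord b) => [|b' IH] //.
by rewrite exprS; apply: M0 => //; apply: xyinv_supp.
Qed.

(** The kernel has nonpositive exponents, so it expands in the e_(- b, - c) with b nonnegative. By
    duality the coefficient is the pairing with e_(b, c), which is its value at X by [ct_cauchy].
    The finite type T enumerates the weights for which this value can be nonzero. *)
Theorem cauchy_identity (T : finType) (wa : T -> weight n) c : injective c -> injective wa ->
    (forall a i, 0 <= wa a i) ->
    (forall k, (forall i, 0 <= k i) -> evX (e k c) != 0 -> exists a, k = wa a) ->
  cauchy_kernel = \sum_a evX (e (wa a) c) *: e (- wa a) (oppw c).
Proof.
move=> ci wi wa0 was; have ni := oppw_inj ci.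
have [g gS gE] := hf_span he ni (Q := fun k => forall i, k i <= 0)
  (fun i k k' si => @npos_string i k k' si) cauchy_kernel_npos.
have dual (b : weight n) : (forall i, 0 <= b i) -> evX (e b c) = lc g (- b).
  move=> b0; rewrite -ct_cauchy; last exact: hf_nneg.
  rewrite -gE lext.unlock mulr_sumr (big_morph _ (@ctD B q M n) (ct0 _ _ _)).
  have term k : ctq (e b c * (lc g k *: e k (oppw c))) = lc g k * (b == - k)%:R.
    rewrite -scalerAr ctZ -(hf_dual q_nilp he b (- k) ci) /dpair opprK.
    by [].
  under eq_bigr do rewrite term.
  by under eq_bigr do rewrite -eqr_oppLR eq_sym; rewrite fsum_delta // => /lc_out.
have {}gE' : g = \sum_a evX (e (wa a) c) *: lmon (- wa a).
  apply: lauP => k; rewrite lc_sum.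
  under eq_bigr do rewrite lcZ lc_mon.
  have [[a kE]|no] := pselect (exists a, k = - wa a).
    rewrite (bigD1 a) //= dual // -kE eqxx mulr1 big1 ?addr0 // => a' a'a.
    by rewrite kE (inj_eq oppr_inj) (inj_eq wi) (negPf a'a) mulr0.
  rewrite big1 => [|a _]; last first.
    by case: eqP => [ka|_]; rewrite ?mulr0 //; case: no; exists a.
  apply/eqP; apply: contraT => gk; have k0 := gS k gk.
  have nk0 i : 0 <= (- k) i by rewrite weightN oppr_ge0.
  have [|a kE] := was (- k) nk0; first by rewrite dual // opprK.
  by case: no; exists a; rewrite -kE opprK.
rewrite -gE gE' linear_sum; apply: eq_bigr => a _.
by rewrite linearZ /= lext_mon.
Qed.

End Cauchy.

(** * Translation and restriction of Hall-Littlewood families *)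

Section Translation.
Variables (R : realType) (A : comNzRingType) (n : nat) (q : A).
Variable e : weight n -> ('I_n -> R) -> laur A n.
Hypothesis he : hecke_family q e.
Implicit Types (lam mu : weight n) (c : 'I_n -> R) (i k : 'I_n).

Definition narrow c := forall i j, c i - c j < 1.

Lemma intr_ltB1 (x y : int) : (y%:~R - 1 < x%:~R :> R) -> y <= x.
Proof. by rewrite ltrBlDr -[1]/(1%:~R) -intrD ltr_int ltzD1. Qed.

(** Sorts the numbers lam_k + c_k by adjacent swaps, by induction on the number of their strictly
    increasing pairs. Once they are sorted, narrowness of c forces the integer weight lam to be
    dominant. *)
Lemma line_ind (P : weight n -> ('I_n -> R) -> Prop) :
    (forall lam c, injective c -> narrow c -> dominant lam ->
      (forall i, simple i -> (lam (ordS i))%:~R + c (ordS i) <= (lam i)%:~R + c i) -> P lam c) ->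
    (forall lam c i, injective c -> narrow c -> simple i ->
      (lam (ordS i))%:~R + c (ordS i) < (lam i)%:~R + c i -> P lam c ->
      P (wact (adj i) lam) (c \o adj i)) ->
  forall lam c, injective c -> narrow c -> P lam c.
Proof.
move=> Pd Ps lam c; pose r lam c i : R := - ((lam i)%:~R + c i : R).
move: {2}(ninv (r lam c)) (erefl (ninv (r lam c))) => m.
elim/ltn_ind: m lam c => m IH lam c mE ci cn.
have [[i si ri]|no] := pselect (exists2 i, simple i & (lam i)%:~R + c i < (lam (ordS i))%:~R + c (ordS i)).
  rewrite -(wact_adjK i lam) -(adj_comp2 c i); apply: Ps => //; first exact: adj_inj.
  - by move=> a b; apply: cn.
  - by rewrite !wact_tperm /= tpermL tpermR.
  apply: (IH _ _ _ _ erefl); [|exact: adj_inj|by move=> a b; apply: cn].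
  rewrite -mE -[X in (_ < X)%N]/(ninv (r lam c)).
  have -> : r lam c = r (wact (adj i) lam) (c \o adj i) \o adj i.
    by apply/funext => k; rewrite /r /= wact_tperm tpermK.
  by rewrite (@ninv_swap _ R n) //= /r ltrN2 !wact_tperm /= tpermL tpermR.
have rd i : simple i -> (lam (ordS i))%:~R + c (ordS i) <= (lam i)%:~R + c i.
  by move=> si; rewrite leNgt; apply/negP => ri; apply: no; exists i.
apply: Pd => //; apply/dominantP => i j ij; apply: intr_ltB1.
have W (k : 'I_n) : simple k -> (r lam c k <= r lam c (ordS k))%O by move=> sk; rewrite /r lerN2 rd.
by have := adj_mono W ij; rewrite /r lerN2; have := cn i j; lra.
Qed.

(* Both sides are built by the same swaps.  Where one uses U and the other V, the
   two entries of [lam' - lam] involved differ by 1, and moving x^(lam' - lam)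
   past the operator exchanges U and V. *)
Theorem hf_translate lam lam' c c' (a : R) : injective c -> injective c' -> narrow c -> narrow c' ->
  (forall i, (lam' i)%:~R + c' i = (lam i)%:~R + c i + a) ->
  e lam' c' = lmon (lam' - lam) * e lam c.
Proof.
move=> ci + cn; move: lam c ci cn lam' c'.
apply: line_ind => [lam c ci cn dl rd|lam c i ci cn si ri IH] lam' c' ci' cn' rr.
  rewrite !(hf_dominant he) // -?lmonD ?subrK //.
  apply/dominantP => i j ij; apply: intr_ltB1.
  have W (k : 'I_n) : simple k -> (- ((lam k)%:~R + c k) <= - ((lam (ordS k))%:~R + c (ordS k) : R))%O.
    by move=> sk; rewrite lerN2 rd.
  have := adj_mono (g := fun k : 'I_n => - ((lam k)%:~R + c k : R)) W ij; rewrite lerN2.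
  by have := cn' i j; have := rr i; have := rr j; lra.
pose l0 := wact (adj i) lam'; pose c0 := c' \o adj i.
have ci0 : injective c0 by apply: adj_inj.
have cn0 : narrow c0 by move=> x y; apply: cn'.
have rr0 k : (l0 k)%:~R + c0 k = (lam k)%:~R + c k + a.
  by rewrite /l0 wact_tperm /c0 /= rr wact_tperm /= tpermK.
have ri0 : (l0 (ordS i))%:~R + c0 (ordS i) < (l0 i)%:~R + c0 i by rewrite !rr0 ltrD2r.
rewrite -(wact_adjK i lam') -(adj_comp2 c' i) -/l0 -/c0.
rewrite -raddfB /=.
have {}IH := IH l0 c0 ci0 cn0 rr0; set eta := l0 - lam in IH *.
have etaE k : (eta k)%:~R = c k - c0 k + a.
  by rewrite /eta weightD weightN intrD intrN; have := rr0 k; lra.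
have step (l1 : weight n) c1 : injective c1 -> narrow c1 ->
    (l1 (ordS i))%:~R + c1 (ordS i) < (l1 i)%:~R + c1 i ->
    (c1 (ordS i) < c1 i /\ e (wact (adj i) l1) (c1 \o adj i) = opU q i (e l1 c1)) \/
    (c1 i < c1 (ordS i) /\ e (wact (adj i) l1) (c1 \o adj i) = opV q i (e l1 c1)).
  move=> i1 n1 r1; have [cc|cc] := ltP (c1 (ordS i)) (c1 i); [left|right].
    by split=> //; rewrite (hf_U he) //; apply: intr_ltB1; have := n1 i (ordS i); lra.
  have {}cc : c1 i < c1 (ordS i) by rewrite lt_neqAle cc andbT (inj_eq i1) ordS_neq.
  by split=> //; rewrite (hf_V he) // -(ltr_int R); lra.
(* The difference of two entries of eta is an integer, and narrowness confines it to an open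
   interval of length 2 around z. Here z is 0 if both sides use the same operator, and 1 or -1
   otherwise. *)
have diff (z : int) : (z - 1)%:~R < (eta i - eta (ordS i))%:~R :> R ->
    (eta i - eta (ordS i))%:~R < (z + 1)%:~R :> R -> eta i - eta (ordS i) = z.
  by rewrite !ltr_int; lia.
have eB : (eta i - eta (ordS i))%:~R = (c i - c (ordS i)) - (c0 i - c0 (ordS i)).
  by rewrite intrB !etaE; lra.
have := cn i (ordS i); have := cn (ordS i) i.
have := cn0 i (ordS i); have := cn0 (ordS i) i.
have inv0 : eta i - eta (ordS i) = 0 -> eta i = eta (ordS i) /\ wact (adj i) eta = eta.
  by move=> e0; rewrite wact_tpermE e0 mulr0z subr0; split=> //; apply/eqP; rewrite -subr_eq0 e0.
case: (step _ _ ci cn ri) => -[cc ->]; case: (step _ _ ci0 cn0 ri0) => -[cc0 ->]; rewrite IH => b1 b2 b3 b4.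
- have [|ee ->] := inv0; last by rewrite opU_mon_inv.
  by apply: diff; rewrite eB ?sub0r ?add0r ?rmorphN; lra.
- by rewrite opV_mon //; apply: diff; rewrite eB ?rmorphB ?rmorphD; lra.
- by rewrite opU_mon //; apply: diff; rewrite eB ?rmorphB ?rmorphD ?rmorphN; lra.
- have [|ee ->] := inv0; last by rewrite opV_mon_inv.
  by apply: diff; rewrite eB ?sub0r ?add0r ?rmorphN; lra.
Qed.

End Translation.

(** * Adjoining an extremal entry to a weight *)

Section Restriction.
Variables (R : realType) (A : comNzRingType) (n : nat) (q : A).
Variables (e : weight n -> ('I_n -> R) -> laur A n).
Variables (e' : weight n.+1 -> ('I_n.+1 -> R) -> laur A n.+1).
Hypotheses (he : hecke_family q e) (he' : hecke_family q e').
Variables (io : 'I_n -> 'I_n.+1) (z : 'I_n.+1).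
Hypothesis io_inj : injective io.
Hypothesis io_neq : forall i, io i != z.
Hypothesis io_simple : forall i, simple i -> simple (io i).
Hypothesis io_ordS : forall i, simple i -> ordS (io i) = io (ordS i).
Variable P : weight n.+1 -> Prop.

(** Inserts 0 at the position missed by [io]; the sum over fibres makes additivity immediate for any
    embedding. *)
Definition push (k : weight n) : weight n.+1 := [ffun a => \sum_(i | io i == a) k i].

Lemma push_io k i : push k (io i) = k i.
Proof. by rewrite ffunE (big_pred1 i) // => j; rewrite (inj_eq io_inj). Qed.

Lemma push_z k : push k z = 0.
Proof. by rewrite ffunE big_pred0 // => j; apply/negbTE. Qed.

Lemma push_zmod : zmod_morphism push.
Proof.
by move=> k k'; apply/ffunP => a; rewrite !ffunE -sumrN -big_split; apply: eq_bigr => i _; rewrite !ffunE.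
Qed.
HB.instance Definition _ := GRing.isZmodMorphism.Build (weight n) (weight n.+1) push push_zmod.

Hypothesis io_cover : forall a, a != z -> exists i, a = io i.

Lemma push_eps i : push (eps i) = eps (io i).
Proof.
apply/ffunP => a; have [->|/io_cover[j ->]] := eqVneq a z.
  by rewrite push_z ffunE (negPf (io_neq i)).
by rewrite push_io !ffunE (inj_eq io_inj).
Qed.

Lemma push_root i j : push (root i j) = root (io i) (io j).
Proof. by rewrite root.unlock raddfB /= !push_eps. Qed.

Lemma push_adj i k : simple i -> push (wact (adj i) k) = wact (adj (io i)) (push k).
Proof.
move=> si; rewrite !wact_tpermE raddfB raddfMz /= push_root io_ordS //.
by rewrite !push_io.
Qed.

Hypothesis P_adj : forall lam i, simple i -> P (wact (adj (io i)) lam) -> P lam.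
Hypothesis P_dominant : forall lam, P lam ->
  (forall i, simple i -> lam (io (ordS i)) <= lam (io i)) -> dominant lam.

(** The swaps constructing e_mu never touch position z, so the same operators build both sides,
    starting from a monomial. The condition P, extremality of the entry at z, keeps the enlarged
    weight dominant at the start. *)
Lemma hf_restrict mu t c : injective c -> P (push mu + eps z *~ t) ->
  e' (push mu + eps z *~ t) c = lmon (eps z *~ t) * lmap idfun push (e mu (c \o io)).
Proof.
have ez i : (eps z *~ t) (io i) = 0 by rewrite weightMz ffunE eq_sym (negPf (io_neq i)) mul0r.
elim/weight_ind: mu c => [mu dmu|i mu si mi IH] c ci PH.
  rewrite (hf_dominant he) //; last by apply: inj_comp.
  rewrite lmap_mon (hf_dominant he') //; first by rewrite -lmonD addrC.
  apply: P_dominant => // i si; rewrite !weightD !ez !push_io !addr0.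
  by move/dominantP: dmu; apply; rewrite val_ordS.
have si' := io_simple si; have zi : wact (adj (io i)) (eps z *~ t) = eps z *~ t.
  by rewrite wact_tpermE io_ordS // !ez subrr mulr0z subr0.
rewrite push_adj // -zi -wactD in PH *; have PH' := P_adj si PH.
rewrite (hf_step he') // ?(hf_step he) //; last first.
- by rewrite io_ordS // !weightD !ez !push_io !addr0.
- exact: inj_comp.
have ci' : injective (c \o adj (io i)) by apply: adj_inj.
have cc : (c \o adj (io i)) \o io = (c \o io) \o adj i.
  apply/funext => k /=; congr c; rewrite io_ordS //.
  case: (tpermP i (ordS i) k) => [->|->|/eqP k1 /eqP k2]; rewrite ?tpermL ?tpermR //.
  by rewrite tpermD // (inj_eq io_inj) eq_sym.
rewrite IH // cc /= io_ordS //.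
have GA k : push (wact (adj i) k) = wact (adj (io i)) (push k) by apply: push_adj.
have GR : push (root i (ordS i)) = root (io i) (ordS (io i)) by rewrite push_root io_ordS.
have ez' : (eps z *~ t) (io i) = (eps z *~ t) (ordS (io i)) by rewrite io_ordS // !ez.
case: ifP => _.
  by rewrite opU_mon_inv // (lmap_opU idfun si' GA GR) -io_ordS // zi.
by rewrite opV_mon_inv // (lmap_opV idfun si' GA GR) -io_ordS // zi.
Qed.

End Restriction.

Section HeadTail.
Variables (R : realType) (A : comNzRingType) (n : nat) (q : A).
Variables (e : weight n -> ('I_n -> R) -> laur A n).
Variables (e' : weight n.+1 -> ('I_n.+1 -> R) -> laur A n.+1).
Hypotheses (he : hecke_family q e) (he' : hecke_family q e').

Definition hd_ord (i : 'I_n) : 'I_n.+1 := widen_ord (leqnSn n) i.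
Definition tl_ord (i : 'I_n) : 'I_n.+1 := lift ord0 i.

Lemma hf_head (mu : weight n) (t : int) (c : 'I_n.+1 -> R) : injective c -> (forall i, t <= mu i) ->
  e' (push hd_ord mu + eps ord_max *~ t) c =
  lmon (eps ord_max *~ t) * lmap idfun (push hd_ord) (e mu (c \o hd_ord)).
Proof.
have hi : injective hd_ord by move=> i j /(congr1 val) /= ij; apply: val_inj.
have hz i : hd_ord i != ord_max by rewrite ord_eqE /= ltn_eqF.
have hs i : simple i -> simple (hd_ord i) by rewrite /simple /=; apply: ltnW.
have hS i : simple i -> ordS (hd_ord i) = hd_ord (ordS i).
  by move=> si; apply: ord_inj; rewrite val_ordS ?hs //= !modn_small // ltnW.
have hc a : a != ord_max -> exists i, a = hd_ord i.
  rewrite ord_eqE /= => an; have an' : (a < n)%N by have := ltn_ord a; lia.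
  by exists (Ordinal an'); apply: ord_inj.
move=> ci tm; apply: (hf_restrict he he' hi hz hs hS hc (P := fun lam => forall a, lam ord_max <= lam a)) => //.
- move=> lam i si Pl a; have := Pl (adj (hd_ord i) a); rewrite !wact_tperm tpermK.
  by rewrite tpermD // hS.
- move=> lam Pl ld; apply/dominantP => i j ij; rewrite -lerN2.
  apply: (@adj_mono _ int n.+1 (fun i => - lam i)) => // k sk; rewrite lerN2.
  have [->|/hc[i' iE]] := eqVneq (ordS k) ord_max; first exact: Pl.
  have kn : k != ord_max by move: sk; rewrite /simple ord_eqE /=; lia.
  have [k' kE] := hc _ kn; have sk' : simple k'.
    move: (congr1 (@nat_of_ord _) iE); rewrite val_ordS // kE /= => e1.
    by rewrite /simple e1 ltn_ord.
  by rewrite kE hS // ld.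
- move=> a; rewrite !weightD !weightMz !ffunE eqxx mul1r.
  have [->|/hc[i ->]] := eqVneq a ord_max; first by rewrite ?eqxx mul1r.
  rewrite mul0r addr0 [X in X + _]big_pred0 ?add0r.
    by rewrite (big_pred1 i) // => k; rewrite (inj_eq hi).
  by move=> k; apply/negbTE.
Qed.

Lemma hf_tail (mu : weight n) (t : int) (c : 'I_n.+1 -> R) : injective c -> (forall i, mu i <= t) ->
  e' (push tl_ord mu + eps ord0 *~ t) c =
  lmon (eps ord0 *~ t) * lmap idfun (push tl_ord) (e mu (c \o tl_ord)).
Proof.
have hi : injective tl_ord by apply: lift_inj.
have hz i : tl_ord i != ord0 by rewrite eq_sym neq_lift.
have hs i : simple i -> simple (tl_ord i) by rewrite /simple /= /bump /=; lia.
have hS i : simple i -> ordS (tl_ord i) = tl_ord (ordS i).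
  move=> si; apply: ord_inj; rewrite val_ordS ?hs //=.
  by rewrite modn_small.
have hc a : a != ord0 -> exists i, a = tl_ord i.
  by rewrite eq_sym => /unlift_some[i -> _]; exists i.
move=> ci tm; apply: (hf_restrict he he' hi hz hs hS hc (P := fun lam => forall a, lam a <= lam ord0)) => //.
- move=> lam i si Pl a; have := Pl (adj (tl_ord i) a); rewrite !wact_tperm tpermK.
  by rewrite tpermD // hS.
- move=> lam Pl ld; apply/dominantP => i j ij; rewrite -lerN2.
  apply: (@adj_mono _ int n.+1 (fun i => - lam i)) => // k sk; rewrite lerN2.
  have [->|/hc[k' kE]] := eqVneq k ord0; first exact: Pl.
  have sk' : simple k' by move: sk; rewrite kE /simple /= /bump /=; lia.
  by rewrite kE hS // ld.
- move=> a; rewrite !weightD !weightMz !ffunE eqxx mul1r.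
  rewrite [X in _ <= X + _]big_pred0 ?add0r; last by move=> k; apply/negbTE.
  have [->|/hc[i ->]] := eqVneq a ord0.
    by rewrite mul1r big_pred0 ?add0r // => k; apply/negbTE.
  rewrite mul0r addr0.
  by rewrite (big_pred1 i) // => k; rewrite (inj_eq hi).
Qed.

End HeadTail.

(** * The generating function of products of dual families *)

Section Star.
Variables (R : realType) (A : comNzRingType) (q t : A) (M N n : nat).
Hypotheses (q_nilp : q ^+ M.+1 = 0) (t_nilp : t ^+ N.+1 = 0).
Variables (e : weight n -> ('I_n -> R) -> laur A n).
Variables (e' : weight n.+1 -> ('I_n.+1 -> R) -> laur A n.+1).
Hypotheses (he : hecke_family q e) (he' : hecke_family q e').
Notation hd_ord := (@hd_ord n).
Notation tl_ord := (@tl_ord n).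
Notation B := (laur A n.+1).
Notation cst := (@lcst A (weight n.+1)).
Implicit Types (k : weight n) (i j : 'I_n).

Definition hdX i : B := t *: lmon (eps (hd_ord i)).

Lemma hdX_nilp i : hdX i ^+ N.+1 = 0.
Proof. by rewrite exprZn t_nilp scale0r. Qed.

Lemma hdM_nilp : cst q ^+ M.+1 = 0.
Proof. by rewrite -rmorphXn q_nilp rmorph0. Qed.

Definition sumw m (k : weight m) : int := pair_w [ffun=> 1] k.

Lemma sumwE m (k : weight m) : sumw k = \sum_i k i.
Proof. by apply: eq_bigr => i _; rewrite ffunE mul1r. Qed.

Lemma push_sum (io : 'I_n -> 'I_n.+1) k : injective io -> push io k = \sum_i eps (io i) *~ k i.
Proof.
move=> io_inj; apply/ffunP => a; rewrite ffunE sum_ffunE big_mkcond; apply: eq_bigr => i _.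
by rewrite weightMz ffunE; case: eqP => _; rewrite ?mul1r ?mul0r.
Qed.

Lemma monX_hd k : (forall i, 0 <= k i) ->
  monX hdX k = t ^+ `|sumw k|%N *: lmon (push hd_ord k).
Proof.
move=> k0; have hi : injective hd_ord by move=> i j /(congr1 (@nat_of_ord _)) /= ij; apply: val_inj.
have -> : `|sumw k|%N = (\sum_i `|k i|)%N.
  apply/eqP; rewrite -eqz_nat gez0_abs; last by rewrite sumwE sumr_ge0.
  by rewrite sumwE -natz natr_sum; apply/eqP; apply: eq_bigr => i _; rewrite natz gez0_abs.
rewrite /monX push_sum // lmon_sum expr_sum -scaler_prod; apply: eq_bigr => i _.
by rewrite exprZn lmonX pmulrn gez0_abs.
Qed.

Definition nnegsum (s : int) k := (forall i, 0 <= k i) /\ sumw k = s.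

Lemma hf_nnegsum k c : injective c -> (forall i, 0 <= k i) ->
  suppin (nnegsum (sumw k)) (e k c).
Proof.
move=> ci k0; apply: (hf_supp he) => // i k1 k2 si [k10 k1s] k12.
split; first exact: nneg_string k10 k12.
case: k12 => t' -> _; rewrite -k1s /sumw pair_wDr pair_wNr pair_wZ pair_w_root.
by rewrite !ffunE subrr mul0r subr0.
Qed.

(** Homogeneity of f lets t come out as a single power. *)
Lemma evX_hd s f : suppin (nnegsum s) f ->
  evX hdX (lmap cst idfun f) = t ^+ `|s|%N *: lmap idfun (push hd_ord) f.
Proof.
move=> fs; apply: (suppin_ind (P := fun f =>
  evX hdX (lmap cst idfun f) = t ^+ `|s|%N *: lmap idfun (push hd_ord) f) fs).
- by rewrite !lmap0 /evX linear0 scaler0.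
- by move=> g g' gE g'E; rewrite !lmapD /evX linearD scalerDr -gE -g'E.
move=> a k [k0 ks]; rewrite !lmapZ !lmap_mon /evX linearZ /= lext_mon monX_hd // ks.
by rewrite -[_ *: _]/(_ * _) -scale_lcst !scalerA mulrC.
Qed.

(** The two alphabets live in different layers: X_i = t x_i among the coefficients, y_j as outer
    variables. This map sends y_j to x_(j + 1) and brings them together. *)
Definition ev_tl : laur B n -> B := lev idfun (wmon A (push tl_ord)).
HB.instance Definition _ := GRing.RMorphism.on ev_tl.

Lemma ev_tlZ a f : ev_tl (a *: f) = a * ev_tl f.
Proof. exact: levZ. Qed.

Lemma ev_tl_lmap f : ev_tl (lmap cst idfun f) = lmap idfun (push tl_ord) f.
Proof.
apply: (eq_add_lauP (F := ev_tl \o lmap cst idfun) (G := lmap idfun (push tl_ord))) => a k.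
by rewrite /= !lmapZ !lmap_mon ev_tlZ /ev_tl lev_mon /= scale_lcst.
Qed.

(** The Cauchy kernel at X_i = t x_i and y_j = x_(j + 1). The shift by one turns i < j in its
    numerator into a gap of at least two, and i <= j in its denominator into i < j. *)
Definition star_kernel : B :=
  (\prod_(p : 'I_n.+1 * 'I_n.+1 | (p.1.+1 < p.2)%N) (1 - (q * t) *: zr A p.1 p.2)) *
  \prod_(p : 'I_n.+1 * 'I_n.+1 | (p.1 < p.2)%N) geo N (t *: zr A p.1 p.2).

(** In a pair a < b, a is not the last position and b is not the first, so the pair comes from (a, b
    - 1) alone. *)
Lemma hd_tl_reindex (P : nat -> nat -> bool) (F : 'I_n.+1 -> 'I_n.+1 -> B) :
    (forall a b, P a b -> (a < b)%N) ->
  \prod_(p : 'I_n.+1 * 'I_n.+1 | P p.1 p.2) F p.1 p.2 =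
  \prod_(p : 'I_n * 'I_n | P p.1 p.2.+1) F (hd_ord p.1) (tl_ord p.2).
Proof.
move=> PS; pose h (p : 'I_n * 'I_n) := (hd_ord p.1, tl_ord p.2).
pose g (p : 'I_n.+1 * 'I_n.+1) : option ('I_n * 'I_n) :=
  if insub (nat_of_ord p.1) is Some i then
    if insub (nat_of_ord p.2).-1 is Some j then Some (i, j) else None
  else None.
rewrite (reindex_omap h g) /= => [|[a b] /= /PS ab]; last first.
  have an : (a < n)%N by have := ltn_ord b; lia.
  have bn : (b.-1 < n)%N by have := ltn_ord b; lia.
  rewrite /g /= insubT insubT /=; congr Some; congr pair; apply: ord_inj => //=.
  by rewrite /bump /=; lia.
apply: eq_bigl => -[i j] /=; rewrite /bump leq0n add1n.
by rewrite /g /= /bump ?leq0n ?add1n /= !valK eqxx andbT.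
Qed.

Lemma ev_tl_kernel : ev_tl (cauchy_kernel (cst q) N hdX) = star_kernel.
Proof.
have xyE i j : ev_tl (xyinv hdX i j) = t *: zr A (hd_ord i) (tl_ord j).
  rewrite /xyinv /ymonV ev_tlZ /ev_tl lev_mon /= raddfN /= /hdX -scalerAl -lmonD.
  congr (_ *: lmon _); rewrite root.unlock; congr (_ - _).
  apply: (push_eps (z := ord0)); [exact: lift_inj|by move=> k; rewrite eq_sym neq_lift|].
  by move=> a; rewrite eq_sym => /unlift_some[k -> _]; exists k.
rewrite /cauchy_kernel /star_kernel rmorphM !rmorph_prod /=; congr (_ * _).
  rewrite (@hd_tl_reindex (fun a b => (a.+1 < b)%N)
    (fun a b => 1 - (q * t) *: zr A a b)) => [|a b]; last exact: ltnW.
  apply: eq_bigr => p _.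
  transitivity (ev_tl 1 - ev_tl (cst q *: xyinv hdX p.1 p.2)); first exact: rmorphB.
  by rewrite ev_tlZ xyE -scale_lcst scalerA; congr (_ - _); apply: rmorph1.
rewrite (@hd_tl_reindex (fun a b => (a < b)%N) (fun a b => geo N (t *: zr A a b))) //.
by apply: eq_bigr => p _; rewrite -xyE; apply: (rmorph_geo ev_tl).
Qed.

(** Entries up to N suffice: a nonnegative weight outside this range has sum above N and is killed
    by t^(N + 1) = 0. *)
Definition revwt (a : n.-tuple 'I_N.+1) : weight n :=
  wt n (rev [seq (nat_of_ord x)%:Z | x <- a]).

Lemma revwtE a i : revwt a i = (tnth a (rev_ord i))%:Z.
Proof.
rewrite ffunE nth_rev ?size_map ?size_tuple // (nth_map ord0) ?size_tuple; last first.
  by case: i => i /= ii; lia.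
by rewrite (tnth_nth ord0).
Qed.

Lemma revwt_inj : injective revwt.
Proof.
move=> a a' aa; apply: eq_from_tnth => i; apply: ord_inj.
have := congr1 (fun k : weight n => k (rev_ord i)) aa; rewrite !revwtE rev_ordK.
by case.
Qed.

Lemma sumw_revwt a : sumw (revwt a) = (\sum_(x <- a) x)%N.
Proof.
rewrite sumwE big_tuple (reindex_inj rev_ord_inj) -natz natr_sum.
by apply: eq_bigr => i _; rewrite revwtE rev_ordK natz.
Qed.

Lemma revwt_ge0 a i : 0 <= revwt a i. Proof. by rewrite revwtE. Qed.

Lemma sumw_large k : (forall i, 0 <= k i) -> (forall a, k <> revwt a) -> (N < `|sumw k|)%N.
Proof.
move=> k0 ka; rewrite ltnNge; apply/negP => kN.
have kiN i : (`|k i| < N.+1)%N.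
  rewrite ltnS; apply: leq_trans kN; rewrite -lez_nat gez0_abs // gez0_abs.
    by rewrite sumwE (bigD1 i) //= lerDl sumr_ge0.
  by rewrite sumwE sumr_ge0.
case: (ka [tuple Ordinal (kiN (rev_ord i)) | i < n]); apply/ffunP => i.
by rewrite revwtE tnth_mktuple /= rev_ordK gez0_abs.
Qed.

Lemma restricted_cauchy c : injective c ->
  star_kernel = \sum_(a : n.-tuple 'I_N.+1) t ^+ (\sum_(x <- a) x)%N *:
    (lmap idfun (push hd_ord) (e (revwt a) c) * lmap idfun (push tl_ord) (e (- revwt a) (oppw c))).
Proof.
move=> ci; have heB := hf_map cst he.
have evE k : (forall i, 0 <= k i) ->
    evX hdX (lmap cst idfun (e k c)) = t ^+ `|sumw k|%N *: lmap idfun (push hd_ord) (e k c).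
  by move=> k0; apply: evX_hd; apply: hf_nnegsum.
rewrite -ev_tl_kernel (cauchy_identity hdM_nilp hdX_nilp heB ci revwt_inj revwt_ge0).
  rewrite rmorph_sum; apply: eq_bigr => a _; rewrite [LHS]ev_tlZ ev_tl_lmap.
  by rewrite evE ?scalerAl ?sumw_revwt //; apply: revwt_ge0.
(* Terms outside the finite index set vanish because t^(N + 1) = 0. *)
move=> k k0; rewrite evE // => kne; apply: contrapT => no.
have kN : (N < `|sumw k|)%N by apply: sumw_large => // a ka; apply: no; exists a.
by move: kne; rewrite -(subnK kN) exprD t_nilp mulr0 scale0r eqxx.
Qed.

(** The words c and c' restrict to opposite words in n variables, so the two factors of each summand
    come from dual families up to monomials. The product of these monomials does not depend on a,
    and the sum becomes the restricted Cauchy sum. *)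
Theorem star_identity (u v : nat) (Bw : weight n.+1) (c c' : 'I_n.+1 -> R) (p : R) :
    injective c -> injective c' -> narrow c -> narrow c' ->
    (forall i, c' (tl_ord i) = - c (hd_ord i)) ->
    (forall k : 'I_n.+1, (Bw k)%:~R + c k + c' k = p) ->
  \sum_(a : n.-tuple 'I_N.+1) t ^+ (\sum_(x <- a) x)%N *:
    (e' (push hd_ord (revwt a) - eps ord_max *~ u) c *
     e' (- (Bw + (push tl_ord (revwt a) - eps ord0 *~ v))) (oppw c)) =
  lmon (eps ord0 *~ v - eps ord_max *~ u - Bw) * star_kernel.
Proof.
move=> ci ci' cn cn' ct cB; have chi : injective (c \o hd_ord).
  by move=> i j /ci /(congr1 (@nat_of_ord _)) /= ij; apply: val_inj.
rewrite (restricted_cauchy chi) mulr_sumr; apply: eq_bigr => a _.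
rewrite -scalerAr; congr (_ *: _); rewrite -mulNrz.
have -> : - eps ord_max *~ u = eps ord_max *~ - u%:Z :> weight n.+1 by rewrite mulrNz mulNrz.
rewrite (hf_head he he') // => [|i]; last first.
  by apply: le_trans (revwt_ge0 _ _); rewrite oppr_le0.
have pN : push tl_ord (- revwt a) = - push tl_ord (revwt a) by rewrite raddfN.
(* By [cB] the sums of entries of - beta and - c differ from those of (v, - a) and c' by the
   constant p. The first entry v is then maximal, as the others are at most 0, and [hf_tail]
   applies. *)
rewrite (hf_translate he' (lam := push tl_ord (- revwt a) + eps ord0 *~ v) (c := c') (a := - p)) //; first last.
- move=> i; rewrite pN !(weightD, weightN) /oppw.
  by have := cB i; rewrite !(intrD, intrN); lra.
- by move=> i j; have := cn j i; rewrite /oppw; lra.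
- exact: oppw_inj.
rewrite (hf_tail he he') // => [|i]; last first.
  by rewrite weightN; apply: le_trans (_ : 0 <= _); rewrite ?oppr_le0 ?revwt_ge0.
have -> : c' \o tl_ord = oppw (c \o hd_ord) by apply/funext => i; rewrite /= ct.
have -> : - (Bw + (push tl_ord (revwt a) - eps ord0 *~ v)) -
    (push tl_ord (- revwt a) + eps ord0 *~ v) = - Bw.
  by rewrite pN; apply/ffunP => i; rewrite !(weightD, weightN); ring.
by rewrite !lmonD mulrNz; ring.
Qed.

End Star.

(** * Alternants and Laurent polynomial characters *)

Section Alternants.
Variables (A : comNzRingType) (n : nat).
Notation L := (laur A n).
Implicit Types (f g h : L) (k lam : weight n) (w : 'S_n) (i j : 'I_n).

Definition delta_w : weight n := [ffun i => (rev_ord i)%:Z].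

Definition altop f : L := \sum_(w : 'S_n) (-1) ^+ w * sact w f.
Definition alt k : L := altop (lmon k).

Definition antisym f := forall w, sact w f = (-1) ^+ w * f.

Lemma sact_sign w (b : bool) : sact w ((-1) ^+ b) = (-1) ^+ b :> L.
Proof. by rewrite rmorphXn rmorphN rmorph1. Qed.

Lemma antisym_altop f : antisym (altop f).
Proof.
move=> v; rewrite /altop rmorph_sum mulr_sumr /= [RHS](reindex_inj (mulIg v)).
apply: eq_bigr => w _; rewrite sactMr sact_sign -sactM mulrA odd_permM signr_addb.
by congr (_ * _); rewrite mulrC -mulrA -expr2 sqrr_sign mulr1.
Qed.

Lemma lc_sign (b : bool) f k : lc ((-1) ^+ b * f) k = (-1) ^+ b * lc f k.
Proof. by case: b; rewrite ?expr0 ?mul1r // expr1 !mulN1r lcN. Qed.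

Lemma lc_altop f k : lc (altop f) k = \sum_(w : 'S_n) (-1) ^+ w * lc f (wact w k).
Proof.
rewrite /altop lc_sum (reindex_inj invg_inj) /=; apply: eq_bigr => w _.
by rewrite lc_sign lc_sact odd_permV invgK.
Qed.

Lemma antisym_lc f w k : antisym f -> lc f (wact w k) = (-1) ^+ w * lc f k.
Proof.
move=> fa; have := congr1 (fun f => lc f k) (fa w^-1%g).
by rewrite lc_sact invgK lc_sign odd_permV.
Qed.

Definition strict k := forall i j, (i < j)%N -> k j < k i.

Lemma strict_dominant k : strict k -> dominant k.
Proof.
move=> sk; apply/dominantP => i j; rewrite leq_eqVlt => /orP[/eqP/ord_inj -> //|/sk/ltW //].
Qed.

Lemma strict_stab k w : strict k -> dominant (wact w k) -> w = 1%g.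
Proof.
move=> sk /dominantP dk; rewrite -[w]invgK; apply/eqP; rewrite eq_invg1; apply/eqP.
apply: ninv_eq0_perm => i si; have := dk i (ordS i).
rewrite val_ordS // leqnSn !ffunE => /(_ isT) kk.
rewrite ltnNge leq_eqVlt; apply/negP => /orP[/eqP/ord_inj/perm_inj/eqP|/sk].
  by rewrite eq_sym (negPf (ordS_neq si)).
by rewrite ltNge kk.
Qed.

Lemma delta_ordS i : simple i -> delta_w i = delta_w (ordS i) + 1.
Proof. by move=> si; rewrite !ffunE /= modn_small //; move: si; rewrite /simple; lia. Qed.

Lemma strict_delta k : strict k <-> dominant (k - delta_w).
Proof.
split=> [sk|/dominantP dk i j ij].
  apply/dominantP => i j; rewrite -lerN2.
  apply: (@adj_mono _ int n (fun i => - (k - delta_w) i)) => {i j} // i si.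
  have := sk i (ordS i); rewrite val_ordS // ltnSn => /(_ isT).
  by rewrite lerN2 !weightD !weightN (delta_ordS si); lia.
have := dk i j (ltnW ij); rewrite !weightD !weightN !ffunE /=.
by move: (ltn_ord j); lia.
Qed.

End Alternants.

Section AntisymmetricCoefficients.
Variables (n : nat).
Notation L := (laur rat n).
Implicit Types (f g h : L) (k lam : weight n) (w : 'S_n) (i j : 'I_n).

(** Antisymmetry determines the coefficients on an orbit from its dominant member. If that member
    has two equal entries, its coefficient is its own negative and vanishes in the rationals. *)
Lemma antisym_eq0 f : antisym f -> (forall k, strict k -> lc f k = 0) -> f = 0.
Proof.
move=> fa fs; apply: lauP => k; rewrite lc0; have [w <-] := wplusP k.
rewrite antisym_lc //; set d := wplus k.
suff -> : lc f d = 0 by rewrite mulr0.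
have dd : dominant d by apply: wplus_dominant.
have [sd|nsd] := pselect (strict d); first exact: fs.
have [[i si di]|no] := pselect (exists2 i, simple i & d i = d (ordS i)).
  have := @antisym_lc _ _ f (adj i) d fa; rewrite wact_tpermE di subrr mulr0z subr0.
  by rewrite odd_tperm (ordS_neq si) expr1 mulN1r; lra.
case: nsd; apply/strict_delta/dominantP => i j; rewrite -lerN2.
apply: (@adj_mono _ int n (fun i => - (d - delta_w n) i)) => {i j} // i si.
have : d (ordS i) <= d i by move/dominantP: (dd); apply; rewrite val_ordS.
case: ltgtP => // [dlt|deq] _; last by case: no; exists i.
by rewrite lerN2 !weightD !weightN (delta_ordS si); lia.
Qed.

Lemma lc_alt k k' : strict k -> strict k' -> lc (alt rat k) k' = (k == k')%:R.
Proof.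
move=> sk sk'; rewrite lc_altop (bigD1 1%g) //= wact1 lc_mon odd_perm1 mul1r.
rewrite big1 ?addr0 // => w w1; rewrite lc_mon; case: eqP => [kE|_]; last by rewrite mulr0.
case/eqP: w1; apply: (strict_stab sk'); rewrite -kE; exact: strict_dominant.
Qed.

End AntisymmetricCoefficients.

Section Characters.
Variables (A : comNzRingType) (F : fieldType) (rho : {rmorphism A -> F}) (n : nat).
Notation ev := (@ratev A F rho n).
Implicit Types (k lam : weight n) (w : 'S_n) (i j : 'I_n).

Lemma ratev_sign (b : bool) f : ev ((-1) ^+ b * f) = (-1) ^+ b * ev f.
Proof. by rewrite ratevM rmorphXn rmorphN rmorph1. Qed.

Lemma ratev_alt lam : ev (alt A (lam + delta_w n)) = alternant F lam.
Proof.
rewrite /alternant /determinant /alt /altop rmorph_sum (reindex_inj invg_inj) /=.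
apply: eq_bigr => w _; rewrite odd_permV ratev_sign sact_mon ratev_mon; congr (_ * _).
by apply: eq_bigr => i _; rewrite !ffunE !mxE invgK.
Qed.

Definition weyl_den : laur A n :=
  \prod_(p : 'I_n * 'I_n | (p.1 < p.2)%N) (1 - lmon (root p.2 p.1)).

(** Vandermonde's determinant with rows and columns both reversed, whose signs cancel. The monomial
    x^delta supplies one factor x_i for each pair i < j. *)
Lemma alternant0 : alternant F 0 = rmon F (delta_w n) * ev weyl_den.
Proof.
rewrite /alternant; set m := (X in \det X).
have -> : \det m = \det (Vandermonde n (\row_j rx F (rev_ord j))).
  pose r := perm (@rev_ord_inj n).
  have -> : Vandermonde n (\row_j rx F (rev_ord j)) = (col_perm r (row_perm r m))^T.
    by apply/matrixP => a b; rewrite !mxE !permE ffunE add0r rev_ordK.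
  rewrite det_tr col_permE row_permE !det_mulmx !det_perm odd_permV.
  by rewrite mulrAC -signr_addb addbb mul1r.
rewrite det_Vandermonde pair_big_dep /= /weyl_den rmorph_prod.
have -> : rmon F (delta_w n) = \prod_(p : 'I_n * 'I_n | (p.1 < p.2)%N) rx F p.1.
  rewrite -(pair_big_dep xpredT (fun i j : 'I_n => (i < j)%N) (fun i _ => rx F i)) /=.
  apply: eq_bigr => i _; rewrite prodr_const ffunE -exprnP; congr (_ ^+ _).
  have e1 : #|[pred j : 'I_n | (j < i.+1)%N]| = i.+1.
    by rewrite -sum1_card -(big_ord_widen n (fun _ => 1%N)) // sum1_card card_ord.
  have := cardC [pred j : 'I_n | (j < i.+1)%N]; rewrite e1 card_ord => e2.
  transitivity #|[predC [pred j : 'I_n | (j < i.+1)%N]]|; first by rewrite -[RHS](addKn i.+1) e2.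
  by apply: eq_card => j; rewrite !inE -leqNgt.
rewrite -big_split /=; pose h (p : 'I_n * 'I_n) := (rev_ord p.2, rev_ord p.1).
have hK : involutive h by case=> a b; rewrite /h /= !rev_ordK.
rewrite (reindex_inj (inv_inj hK)); apply: eq_big => [[a b] /=|[a b] _].
  by move: (ltn_ord a) (ltn_ord b); lia.
rewrite /= !mxE !rev_ordK ratevB ratev1 ratev_mon rmon_root mulrBr mulr1.
by rewrite mulrCA mulfV ?mulr1 ?rx_neq0.
Qed.

End Characters.

Section LaurentCharacters.
Variable n : nat.
Notation L := (laur rat n).
Notation ev := (@ratev rat rat idfun n).
Implicit Types (f g h : L) (k lam : weight n) (w : 'S_n) (a b c d : 'I_n).

Lemma idfun_inj : injective (idfun : rat -> rat). Proof. by []. Qed.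

Lemma laur_domain f g : f * g = 0 -> f = 0 \/ g = 0.
Proof.
move=> fg; have /eqP : ev f * ev g = 0 by rewrite -ratevM fg ratev0.
have e0 h : ev h == 0 -> h = 0 by move/eqP => h0; apply: (ratev_inj idfun_inj); rewrite h0 ratev0.
by rewrite mulf_eq0 => /orP[/e0|/e0]; [left|right].
Qed.

Lemma laur_mulfI f : f <> 0 -> injective ( *%R f).
Proof.
move=> f0 g h fgh; apply/eqP; rewrite -subr_eq0; apply/eqP.
by have [] := @laur_domain f (g - h); rewrite // mulrBr fgh subrr.
Qed.

(* The exponent of the image of x^k under x_b |-> x_a. *)
Definition collapse a b k : weight n := k + root a b *~ k b.

Lemma collapse_zmod a b : zmod_morphism (collapse a b).
Proof.
move=> k k'; rewrite /collapse weightD weightN mulrzBr opprD addrACA.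
by congr (_ + _).
Qed.
HB.instance Definition _ a b :=
  GRing.isZmodMorphism.Build (weight n) (weight n) (collapse a b) (collapse_zmod a b).

Definition specialize a b : L -> L := lmap idfun (collapse a b).
HB.instance Definition _ a b := GRing.RMorphism.on (specialize a b).

(** On a monomial the difference is a multiple of 1 - y^m with y = x_b / x_a. *)
Lemma specialize_divides a b f : exists h, f - specialize a b f = (1 - lmon (root b a)) * h.
Proof.
elim/lau_ind: f => [|f g [h hE] [h' h'E]|_ x k _ _].
- by exists 0; rewrite /specialize lmap0 subrr mulr0.
- exists (h + h'); rewrite mulrDr -hE -h'E /specialize lmapD; ring.
suff [h hE] : exists h, lmon k - lmon (collapse a b k) = (1 - lmon (root b a)) * h :> L.
  by exists (x *: h); rewrite /specialize lmapZ lmap_mon -scalerAr -hE scalerBr.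
have geom (y : L) m : exists h, 1 - y ^+ m = (1 - y) * h.
  by exists (\sum_(i < m) y ^+ i); rewrite -opprB subrX1 -mulNr opprB.
set y : L := lmon (root b a); have yV : lmon (root a b) * y = 1 by rewrite /y -rootN lmonVl.
rewrite /collapse lmonD; case e: (k b) => [m|m].
  have [h hE] := geom y m; exists (- (lmon k * lmon (root a b) ^+ m * h)).
  rewrite mulrN mulrCA -hE -pmulrn -lmonX.
  have yVm : lmon (root a b) ^+ m * y ^+ m = 1 by rewrite -exprMn yV expr1n.
  by rewrite mulrBr mulr1 -mulrA yVm; ring.
have [h hE] := geom y m.+1; exists (lmon k * h).
by rewrite mulrCA -hE /y lmonX mulrBr mulr1 NegzE mulrNz -mulNrz rootN -pmulrn.
Qed.

(** Exchanging x_a and x_b does not affect the specialization but changes the sign of f. *)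
Lemma specialize_antisym a b f : a != b -> antisym f -> specialize a b f = 0.
Proof.
move=> ab fa; have e : specialize a b (sact (tperm a b) f) = specialize a b f.
  apply: (eq_add_lauP (F := specialize a b \o sact (tperm a b)) (G := specialize a b)) => x k.
  rewrite /= sactZ sact_mon /specialize !lmapZ !lmap_mon; congr (_ *: lmon _).
  rewrite /= /collapse wact_tpermE.
  have -> : (k - root a b *~ (k a - k b)) b = k a.
    by rewrite weightD weightN weightMz rootE eqxx (negPf ab); lia.
  by rewrite -addrA mulrzBr opprB subrK.
have : specialize a b f *+ 2 = 0.
  rewrite mulr2n -{1}e fa odd_tperm ab expr1 mulN1r /specialize.
  by rewrite (raddfN (lmap _ _)) addNr.
move=> f2; apply: lauP => k; rewrite lc0; apply/eqP.
have /eqP := congr1 (fun f => lc f k) f2; rewrite /= mulr2n lcD lc0 -mulr2n.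
by rewrite mulrn_eq0.
Qed.

Lemma root_neq0 a b : a != b -> root a b != 0.
Proof.
move=> ab; apply/eqP => /(congr1 (fun k : weight n => k a)).
by rewrite rootE eqxx eq_sym (negPf ab) weight0.
Qed.

Lemma one_sub_lmon_neq0 k : k != 0 -> 1 - lmon k <> 0 :> L.
Proof.
move=> k0 /(congr1 (fun f => lc f 0)); rewrite lcD lcN lc1 lc_mon eqxx (negPf k0) subr0 lc0.
by move/eqP; rewrite oner_eq0.
Qed.

(** The factors are split off one at a time. Setting x_b = x_a kills f but none of the factors for
    other pairs, and the ring is a domain, so it kills the remaining cofactor, which is then
    divisible by 1 - x_b / x_a. *)
Lemma antisym_divides (s : seq ('I_n * 'I_n)) f : uniq s -> all (fun p : 'I_n * 'I_n => (p.1 < p.2)%N) s ->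
  antisym f -> exists g, f = \prod_(p <- s) (1 - lmon (root p.2 p.1)) * g.
Proof.
move=> + + fa; elim: s => [_ _|[a b] s IH /= /andP[abs us] /andP[ab sa]].
  by exists f; rewrite big_nil mul1r.
have [g gE] := IH us sa; have nab : a != b by rewrite ord_eqE ltn_eqF.
have := specialize_antisym nab fa; rewrite gE /specialize lmapM.
case/laur_domain => [/eqP|g0]; last first.
  have [h] := specialize_divides a b g; rewrite /specialize g0 subr0 => ->.
  by exists h; rewrite big_cons mulrA [X in X * _]mulrC.
rewrite rmorph_prod /= => /eqP p0; exfalso.
have {p0} : exists2 p, p \in s & lmap idfun (collapse a b) (1 - lmon (root p.2 p.1)) = 0 :> L.
  elim: (s) p0 => [|p s' IH']; first by rewrite big_nil => /eqP; rewrite oner_eq0.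
  rewrite big_cons => /laur_domain[p0|/IH'[p' ps p0]]; first by exists p; rewrite ?mem_head.
  by exists p'; rewrite // inE ps orbT.
case=> -[d c] ds /=; rewrite lmapB lmap1 lmap_mon /=; apply: one_sub_lmon_neq0.
have /= dc := allP sa _ ds.
have : (d, c) != (a, b) by apply: contraNneq abs => <-.
rewrite xpair_eqE negb_and => dcab; rewrite /collapse rootE.
have [cb|cb] := eqVneq c b; have [db|db] := eqVneq d b.
- by move: dc; rewrite cb db ltnn.
- have {dcab} da : d != a by move: dcab; rewrite cb eqxx orbF.
  rewrite cb subr0 mulr1z; have -> : root b d + root a b = root a d.
    by rewrite !root.unlock addrC addrA subrK.
  by rewrite root_neq0 // eq_sym.
- rewrite db sub0r mulrNz mulr1z; have -> : root c b - root a b = root c a.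
    by rewrite !root.unlock opprB addrA subrK.
  by apply: root_neq0; rewrite ord_eqE gtn_eqF // (ltn_trans ab) // -db.
- by rewrite subrr mulr0z addr0 root_neq0 // ord_eqE gtn_eqF.
Qed.

Lemma alt_delta : alt rat (delta_w n) = lmon (delta_w n) * weyl_den rat n.
Proof.
apply: (ratev_inj idfun_inj); rewrite -[X in alt _ X]add0r ratev_alt (alternant0 idfun).
by rewrite ratevM ratev_mon.
Qed.

Lemma alt_delta_neq0 : alt rat (delta_w n) <> 0.
Proof.
have sd : strict (delta_w n) by apply/strict_delta; rewrite subrr; apply/dominantP => i j; rewrite !weight0.
move/(congr1 (fun f => lc f (delta_w n))); rewrite lc_alt // eqxx lc0.
by move/eqP; rewrite oner_eq0.
Qed.

(** Weyl's quotient of alternants as a Laurent polynomial, so that it can be carried to other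
    coefficient rings; [lchiP] shows that the default 0 is not taken. *)
Definition lchi lam : L := xget 0 [set g | alt rat (lam + delta_w n) = alt rat (delta_w n) * g]%classic.

Lemma lchiP lam : alt rat (lam + delta_w n) = alt rat (delta_w n) * lchi lam.
Proof.
rewrite /lchi; case: xgetP => [//|no].
have [|||g gE] := @antisym_divides (filter (fun p : 'I_n * 'I_n => (p.1 < p.2)%N) (enum {: 'I_n * 'I_n})) (alt rat (lam + delta_w n)).
- by rewrite filter_uniq ?enum_uniq.
- by apply/allP => p; rewrite mem_filter => /andP[].
- exact: antisym_altop.
case: (no (lmon (- delta_w n) * g)); rewrite /= gE alt_delta big_filter big_enum_cond.
by rewrite mulrACA lmonVr mul1r.
Qed.

Lemma lchi_sym w lam : sact w (lchi lam) = lchi lam.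
Proof.
apply: (laur_mulfI alt_delta_neq0); rewrite -lchiP.
have := congr1 (sact w) (lchiP lam); rewrite sactMr !antisym_altop => e.
by case: (odd_perm w) e; rewrite ?expr0 ?expr1 ?mul1r ?mulN1r ?mulNr // => /oppr_inj.
Qed.

End LaurentCharacters.

(** * Irreducible coefficients of Weyl symmetrizations *)

Section WeylSymmetrization.
Variable n : nat.
Notation L := (laur rat n).
Notation ev := (@ratev rat rat idfun n).
Notation delta := (delta_w n).
Implicit Types (f g h G : L) (k : weight n) (w : 'S_n) (lam : domweight n).

Lemma ev_alt_delta : ev (alt rat delta) = alternant rat 0.
Proof. by rewrite -[X in alt _ X]add0r ratev_alt. Qed.

Lemma alternant0_neq0 : alternant rat 0 != 0 :> ratfun rat n.
Proof.
rewrite -ev_alt_delta; apply/eqP => e; apply: (@alt_delta_neq0 n).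
by apply: (ratev_inj (@idfun_inj)); rewrite e ratev0.
Qed.

Lemma chiE lam : chi rat lam = ev (lchi (val lam)).
Proof.
rewrite /chi -(ratev_alt idfun) lchiP ratevM ev_alt_delta.
by rewrite mulrAC mulfV ?mul1r ?alternant0_neq0.
Qed.

(** The Weyl denominator is x^(- delta) times an antisymmetric element, so clearing it turns the
    symmetrization into an antisymmetrization. *)
Lemma weyl_symE G : weyl_sym (ev G) * alternant rat 0 = ev (altop (G * lmon delta)).
Proof.
have e0 := alternant0_neq0; rewrite /weyl_sym; rewrite -ev_alt_delta in e0 *.
have -> : ev G / \prod_(p : 'I_n * 'I_n | (p.1 < p.2)%N) (1 - rx rat p.2 / rx rat p.1) =
    ev (G * lmon delta) / ev (alt rat delta).
  have wE : \prod_(p : 'I_n * 'I_n | (p.1 < p.2)%N) (1 - rx rat p.2 / rx rat p.1) = ev (weyl_den rat n).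
    rewrite rmorph_prod; apply: eq_bigr => p _.
    by rewrite /= ratevB ratev1 ratev_mon rmon_root.
  have d0 : ev (lmon delta) != 0.
    by apply: contraNneq e0 => d0; rewrite alt_delta ratevM d0 mul0r.
  by rewrite wE alt_delta !ratevM invfM mulrA mulfK.
rewrite mulr_suml [X in _ = ev X]/altop [RHS]rmorph_sum; apply: eq_bigr => w _ /=.
rewrite rmorphM fmorphV /= -!ratev_sact antisym_altop ratev_sign.
rewrite ratev_sign; case: (odd_perm w); rewrite ?expr0 ?expr1 ?mul1r ?mulN1r.
  by rewrite invrN mulrN mulNr divfK.
by rewrite divfK.
Qed.

Definition shift_support (H : L) : {fset domweight n} :=
  [fset lam in pmap (fun k => insub (k - delta)) (lsupp H)]%fset.

Lemma antisym_expand H : antisym H ->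
  H = \sum_(lam <- shift_support H) lc H (val lam + delta) *: alt rat (val lam + delta).
Proof.
move=> Ha; apply/eqP; rewrite -subr_eq0; apply/eqP/antisym_eq0.
  move=> w; rewrite raddfB /= Ha mulrBr; congr (_ - _).
  rewrite raddf_sum mulr_sumr; apply: eq_bigr => lam _ /=.
  by rewrite sactZ antisym_altop scalerAr.
move=> k sk; have dk : dominant (k - delta) by apply/strict_delta.
pose lam : domweight n := Sub (k - delta) dk.
have kE : k = val lam + delta by rewrite /= subrK.
have sl (mu : domweight n) : strict (val mu + delta).
  by apply/strict_delta; rewrite addrK; apply: valP.
rewrite lcD lcN lc_sum; apply/eqP; rewrite subr_eq0; apply/eqP.
have term mu : lc (alt rat (val mu + delta)) k = (mu == lam)%:R.
  by rewrite (lc_alt (sl _) sk) [in LHS]kE (inj_eq (addIr _)) val_eqE.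
under eq_bigr do rewrite lcZ term.
rewrite fsum_delta -?kE // => lS; apply: lc_out; apply: contra lS => kH; rewrite !inE /= mem_pmap; apply/mapP.
by exists k => //; rewrite insubT.
Qed.

(** After multiplication by the alternant of 0, characters become the alternants of lam + delta.
    Each of these has a single strictly decreasing exponent, which isolates its coefficient. *)
Lemma coef_in_chi G lam :
  coef_in (@rcst rat n) (@chi rat n) (weyl_sym (ev G)) lam = lc (altop (G * lmon delta)) (val lam + delta).
Proof.
have sl (mu : domweight n) : strict (val mu + delta).
  by apply/strict_delta; rewrite addrK; apply: valP.
have chiM (mu : domweight n) : chi rat mu * alternant rat 0 = ev (alt rat (val mu + delta)).
  by rewrite chiE -ev_alt_delta -ratevM mulrC -lchiP.
set H := altop (G * lmon delta).
have combo (r : seq (domweight n)) (c : domweight n -> rat) :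
    weyl_sym (ev G) = \sum_(mu <- r) rcst n (c mu) * chi rat mu <->
    H = \sum_(mu <- r) c mu *: alt rat (val mu + delta).
  have e0 := alternant0_neq0; split=> [e|e].
    apply: (ratev_inj (@idfun_inj)); rewrite -weyl_symE e mulr_suml rmorph_sum /=.
    by apply: eq_bigr => mu _; rewrite ratevZ /= -mulrA chiM.
  apply: (mulIf e0); rewrite weyl_symE -/H e rmorph_sum mulr_suml /=.
  by apply: eq_bigr => mu _; rewrite ratevZ /= -mulrA chiM.
rewrite /coef_in; case: xgetP => [c _ /= /combo cE|no].
  have term mu : lc (alt rat (val mu + delta)) (val lam + delta) = (mu == lam)%:R.
    by rewrite (lc_alt (sl _) (sl _)) (inj_eq (addIr _)) val_eqE.
  rewrite cE lc_sum; under eq_bigr do rewrite lcZ term.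
  by rewrite fsum_delta // => /fsfun_dflt.
(* An expansion exists, so the default in [coef_in] is excluded. *)
pose c : {fsfun domweight n -> rat with 0} :=
  [fsfun mu in shift_support H => lc H (val mu + delta)].
case: (no c); apply/combo; rewrite [LHS]antisym_expand; last exact: antisym_altop.
have sub : (finsupp c `<=` shift_support H)%fset.
  by apply/fsubsetP => mu; rewrite mem_finsupp fsfunE; case: ifP; rewrite ?eqxx.
rewrite [RHS](big_fset_incl _ sub) /=; last first.
  by move=> mu _; rewrite mem_finsupp negbK => /eqP ->; rewrite scale0r.
by rewrite big_seq [RHS]big_seq; apply: eq_bigr => mu muS; rewrite fsfunE muS.
Qed.

End WeylSymmetrization.

(** * Inversion combined with reversal of the variables *)

Section Flip.
Variables (A : comNzRingType) (n : nat).
Notation L := (laur A n).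
Notation delta := (delta_w n).
Implicit Types (f g h : L) (k : weight n) (w : 'S_n) (i j : 'I_n).

(* The exponent of the image of x^k under x_i |-> 1 / x_(n - 1 - i). *)
Definition flip k : weight n := [ffun i => - k (rev_ord i)].
Lemma flip_zmod : zmod_morphism flip.
Proof. by move=> k k'; apply/ffunP => i; rewrite !ffunE opprD. Qed.
HB.instance Definition _ := GRing.isZmodMorphism.Build (weight n) (weight n) flip flip_zmod.

Lemma flipK : involutive flip.
Proof. by move=> k; apply/ffunP => i; rewrite !ffunE rev_ordK opprK. Qed.

Lemma flip_root i j : flip (root i j) = root (rev_ord j) (rev_ord i).
Proof.
apply/ffunP => a; rewrite ffunE !rootE opprB.
have e x : (x == rev_ord a) = (rev_ord x == a) by rewrite -(inj_eq rev_ord_inj) rev_ordK.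
by rewrite !e.
Qed.

Definition lflip : L -> L := lmap idfun flip.
HB.instance Definition _ := GRing.RMorphism.on lflip.
Lemma lflip_mon k : lflip (lmon k) = lmon (flip k). Proof. exact: lmap_mon. Qed.
Lemma lflipZ a f : lflip (a *: f) = a *: lflip f. Proof. exact: lmapZ. Qed.
Lemma lflipM f g : lflip (f * g) = lflip f * lflip g. Proof. exact: rmorphM. Qed.

Lemma lc_lflip f : lc (lflip f) 0 = lc f 0.
Proof.
elim/lau_ind: f => [|f g IH IH'|_ a k _ _]; first by rewrite /lflip lmap0.
  by rewrite /lflip lmapD !lcD IH IH'.
rewrite lflipZ lflip_mon !lcZ !lc_mon -(inj_eq (inv_inj flipK) _ 0).
by rewrite raddf0 flipK.
Qed.

Lemma prod_pairs_flip (F : 'I_n -> 'I_n -> L) :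
  \prod_(p : 'I_n * 'I_n | (p.1 < p.2)%N) F (rev_ord p.2) (rev_ord p.1) =
  \prod_(p : 'I_n * 'I_n | (p.1 < p.2)%N) F p.1 p.2.
Proof.
pose h (p : 'I_n * 'I_n) := (rev_ord p.2, rev_ord p.1).
have hK : involutive h by case=> a b; rewrite /h /= !rev_ordK.
rewrite [RHS](reindex_inj (inv_inj hK)); apply: eq_bigl => -[a b] /=.
by move: (ltn_ord a) (ltn_ord b); lia.
Qed.

Lemma lc_altop_pairing f k :
  lc (altop f) k = lc (f * lmap idfun (@GRing.opp (weight n)) (alt A k)) 0.
Proof.
rewrite lc_altop /alt /altop rmorph_sum mulr_sumr lc_sum; apply: eq_bigr => w _ /=.
rewrite rmorphM rmorphXn /= (rmorphN (lmap _ _)) rmorph1 sact_mon lmap_mon /=.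
by rewrite mulrCA lc_sign [f * _]mulrC lc_monM opprK add0r.
Qed.

End Flip.

(** Extracting a coefficient of an antisymmetrization is pairing with an alternant at inverted
    variables, which factors as Weyl denominator times character. [lflip] undoes the inversion and,
    unlike inversion alone, preserves products over i < j. *)
Lemma coef_in_chi_ct (n : nat) (G : laur rat n) (lam : domweight n) :
  coef_in (@rcst rat n) (@chi rat n) (weyl_sym (ratev idfun G)) lam =
  lc (lflip G * (\prod_(p : 'I_n * 'I_n | (p.1 < p.2)%N) (1 - zr rat p.1 p.2)) *
      lchi (val lam)) 0.
Proof.
rewrite coef_in_chi lc_altop_pairing lchiP alt_delta -lc_lflip.
have -> : forall f : laur rat n, lflip (G * lmon (delta_w n) * lmap idfun -%R (lmon (delta_w n) * weyl_den rat n * f)) =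
   lflip G * lflip (lmap idfun -%R (weyl_den rat n)) * lflip (lmap idfun -%R f).
  move=> f; rewrite !lmapM lmap_mon /= !lflipM.
  have : lflip (lmon (delta_w n)) * lflip (lmon (- delta_w n)) = 1 :> laur rat n.
    by rewrite -lflipM lmonVr /lflip lmap1.
  set a := lflip _; set b := lflip _ => ab; transitivity (a * b * (lflip G * lflip (lmap idfun -%R (weyl_den rat n)) * lflip (lmap idfun -%R f))); first by ring.
  by rewrite ab mul1r.
congr (lc (_ * _ * _) 0).
  rewrite -(prod_pairs_flip (fun i j => 1 - zr rat i j)) /weyl_den rmorph_prod /=.
  rewrite /lflip rmorph_prod; apply: eq_bigr => p _ /=.
  by rewrite !(lmapB, lmap1, lmap_mon) /= rootN flip_root.
(* Inversion followed by [lflip] reverses the variables, and the character is symmetric. *)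
rewrite -[RHS](lchi_sym (perm (@rev_ord_inj n))).
elim/lau_ind: (lchi (val lam)) => [|f g IH IH'|_ a k _ _].
- by rewrite /lflip !lmap0 sact0.
- by rewrite /lflip !lmapD sactD -IH -IH'.
rewrite /lflip !lmapZ !lmap_mon sactZ sact_mon; congr (_ *: lmon _).
apply/ffunP => i; rewrite !ffunE opprK; congr (k _).
by apply: (@perm_inj _ (perm (@rev_ord_inj n))); rewrite permKV permE rev_ordK.
Qed.

(** * Truncated power series in q and t *)

(* Q[q, t] / (q^(M + 1), t^(N + 1)), where q is the image of 'X under [tr_rho];
   [tr_cf a i j] is the coefficient of q^i t^j. *)
Record truncation (M N : nat) := Truncation {
  tr_ring : comNzRingType;
  tr_rho : {rmorphism {poly rat} -> tr_ring};
  tr_t : tr_ring;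
  tr_cf : tr_ring -> nat -> nat -> rat;
  tr_q_nilp : tr_rho 'X ^+ M.+1 = 0;
  tr_t_nilp : tr_t ^+ N.+1 = 0;
  tr_cfD : forall a b i j, tr_cf (a + b) i j = tr_cf a i j + tr_cf b i j;
  tr_cfM : forall a b i j, (i <= M)%N -> (j <= N)%N -> tr_cf (a * b) i j =
    \sum_(i' < i.+1) \sum_(j' < j.+1) tr_cf a i' j' * tr_cf b (i - i')%N (j - j')%N;
  tr_cf_mon : forall d P i j, (i <= M)%N -> (j <= N)%N ->
    tr_cf (tr_t ^+ d * tr_rho P) i j = (j == d)%:R * P`_i
}.

Section Truncation.
Variables (A : comNzRingType) (M : nat).
Local Notation T := {poly %/ ('X^(M.+1) : {poly A})}.

Lemma coef_in_trunc (p : {poly A}) i : (i <= M)%N ->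
  (in_qpoly 'X^(M.+1) p : {poly A})`_i = p`_i.
Proof.
by move=> iM; rewrite /= mk_monic_Xn /= -Pdiv.RingMonic.take_poly_rmodp coef_take_poly ltnS iM.
Qed.

Lemma coef_truncM (a b : T) i : (i <= M)%N ->
  ((a * b : T) : {poly A})`_i = \sum_(i' < i.+1) (a : {poly A})`_i' * (b : {poly A})`_(i - i').
Proof.
by move=> iM; rewrite -[a * b]/(in_qpoly 'X^(M.+1) ((a : {poly A}) * b)) coef_in_trunc // coefM.
Qed.

Lemma in_trunc_eq0 : in_qpoly 'X^(M.+1) 'X^(M.+1) = 0 :> T.
Proof. by apply: val_inj; rewrite /= mk_monic_Xn /= Pdiv.RingMonic.rmodpp ?monicXn. Qed.

Lemma trunc_nilp : (in_qpoly 'X^(M.+1) 'X : T) ^+ M.+1 = 0.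
Proof. by rewrite -(rmorphXn (in_qpoly 'X^(M.+1))); apply: in_trunc_eq0. Qed.

End Truncation.

Section TwoVariables.
Variables M N : nat.
Let Aq := {poly %/ ('X^(M.+1) : {poly rat})}.
Let At := {poly %/ ('X^(N.+1) : {poly Aq})}.

Definition qt_rho : {poly rat} -> At := in_qpoly 'X^(N.+1) \o polyC \o in_qpoly 'X^(M.+1).
HB.instance Definition _ := GRing.RMorphism.on qt_rho.

Definition qt_cf (a : At) (i j : nat) : rat := (((a : {poly Aq})`_j : Aq) : {poly rat})`_i.

Lemma qt_truncation : truncation M N.
Proof.
apply: (@Truncation _ _ At qt_rho (in_qpoly 'X^(N.+1) 'X) qt_cf).
- rewrite -rmorphXn; transitivity (in_qpoly 'X^(N.+1) (in_qpoly 'X^(M.+1) 'X^(M.+1))%:P : At) => //.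
  by rewrite in_trunc_eq0 polyC0; apply: rmorph0.
- exact: trunc_nilp.
- by move=> a b i j; rewrite /qt_cf !coefD.
- move=> a b i j iM jN; rewrite /qt_cf coef_truncM // raddf_sum coef_sum exchange_big.
  by apply: eq_bigr => j' _; rewrite coef_truncM.
- move=> d P i j iM jN; rewrite /qt_rho /= -rmorphXn -rmorphM /qt_cf coef_in_trunc //.
  rewrite mulrC coefCM coefXn; case: eqP => _; rewrite ?mulr1 ?mul1r ?mulr0 ?mul0r ?coef0 //.
  by rewrite coef_in_trunc.
Qed.

End TwoVariables.

(** * Extraction of the coefficient of q^i t^j *)

Section Components.
Variables (M N : nat) (Tr : truncation M N) (n : nat).
Notation A := (tr_ring Tr).
Notation rho := (@tr_rho M N Tr).
Notation q := (rho 'X).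
Notation t := (tr_t Tr).
Notation cf := (@tr_cf M N Tr).
Notation L := (laur A n).
Notation K := (ratfun rat n).
Notation ev := (@ratev rat rat idfun n).
Implicit Types (F G : L) (g : laur rat n) (k : weight n) (a b : 'I_n).

Definition tr_cst (c : rat) : A := rho c%:P.
Lemma tr_cst_zmod : zmod_morphism tr_cst.
Proof. by move=> x y; rewrite /tr_cst polyCB rmorphB. Qed.
Lemma tr_cst_monoid : monoid_morphism tr_cst.
Proof. by split=> [|x y]; rewrite /tr_cst ?polyCM ?rmorphM ?rmorph1. Qed.
HB.instance Definition _ := GRing.isZmodMorphism.Build rat A tr_cst tr_cst_zmod.
HB.instance Definition _ := GRing.isMonoidMorphism.Build rat A tr_cst tr_cst_monoid.

Lemma cf0 i j : cf 0 i j = 0.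
Proof. by apply: (@addrI _ (cf 0 i j)); rewrite -tr_cfD !addr0. Qed.

Lemma cf_sum I (r : seq I) (P : pred I) (f : I -> A) i j :
  cf (\sum_(x <- r | P x) f x) i j = \sum_(x <- r | P x) cf (f x) i j.
Proof. by apply: (big_morph (fun x => cf x i j)) => [x y|]; rewrite ?tr_cfD ?cf0. Qed.

Lemma cf_cst x c i j : (i <= M)%N -> (j <= N)%N -> cf (x * tr_cst c) i j = cf x i j * c.
Proof.
move=> iM jN; rewrite tr_cfM // !big_ord_recr /= !subnn.
have cE i' j' : (i' <= M)%N -> (j' <= N)%N -> cf (tr_cst c) i' j' = (j' == 0)%:R * c%:P`_i'.
  by move=> i'M j'N; rewrite -[tr_cst c]mul1r -(expr0 t) tr_cf_mon.
rewrite [X in _ + (X + _)]big1 => [|j' _]; last first.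
  rewrite cE //; last by rewrite (leq_trans (leq_subr _ _)).
  by rewrite subn_eq0 leqNgt ltn_ord mul0r mulr0.
rewrite big1 ?add0r => [|i' _]; last first.
  apply: big1 => j' _; rewrite cE ?(leq_trans (leq_subr _ _)) //.
  have -> : c%:P`_(i - i') = 0 by rewrite coefC subn_eq0 leqNgt ltn_ord.
  by rewrite !mulr0.
by rewrite cE // mul1r coefC.
Qed.

Definition component (i j : nat) F : laur rat n := \sum_(k <- lsupp F) cf (lc F k) i j *: lmon k.

Lemma lc_component i j F k : lc (component i j F) k = cf (lc F k) i j.
Proof.
rewrite lc_sum; under eq_bigr do rewrite lcZ lc_mon.
by rewrite fsum_delta // => /lc_out ->; rewrite cf0.
Qed.

Lemma componentD i j F G : component i j (F + G) = component i j F + component i j G.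
Proof. by apply: lauP => k; rewrite lcD !lc_component lcD tr_cfD. Qed.

Lemma component_sum I (r : seq I) (P : pred I) (f : I -> L) i j :
  component i j (\sum_(x <- r | P x) f x) = \sum_(x <- r | P x) component i j (f x).
Proof.
apply: (big_morph (component i j)) => [x y|]; first exact: componentD.
by apply: lauP => k; rewrite lc_component !lc0 cf0.
Qed.

Lemma component_mon i j d P k : (i <= M)%N -> (j <= N)%N ->
  component i j ((t ^+ d * rho P) *: lmon k) = ((j == d)%:R * P`_i) *: lmon k.
Proof.
move=> iM jN; apply: lauP => k'; rewrite lc_component !lcZ !lc_mon.
by case: eqP => _; rewrite ?mulr1 ?mulr0 ?cf0 // tr_cf_mon.
Qed.

Lemma componentM i j F G : (i <= M)%N -> (j <= N)%N -> component i j (F * G) =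
  \sum_(i' < i.+1) \sum_(j' < j.+1) component i' j' F * component (i - i') (j - j') G.
Proof.
move=> iM jN; apply: lauP => k; rewrite lc_component lcM cf_sum.
under eq_bigr do rewrite tr_cfM //.
rewrite exchange_big lc_sum; apply: eq_bigr => i' _.
rewrite exchange_big lc_sum; apply: eq_bigr => j' _.
rewrite [in RHS]/component mulr_suml lc_sum; apply: eq_bigr => k' _.
by rewrite -scalerAl lcZ lc_monM lc_component.
Qed.

Lemma lc_lmap_id g k : lc (lmap tr_cst idfun g) k = tr_cst (lc g k).
Proof.
elim/lau_ind: g => [|g g' IH IH'|_ c k' _ _].
- by rewrite lmap0 !lc0 rmorph0.
- by rewrite lmapD !lcD IH IH' rmorphD.
- by rewrite lmapZ lmap_mon !lcZ !lc_mon rmorphM rmorph_nat.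
Qed.

Lemma component_cst i j F g : (i <= M)%N -> (j <= N)%N ->
  component i j (F * lmap tr_cst idfun g) = component i j F * g.
Proof.
move=> iM jN; apply: lauP => k; rewrite lc_component lcM cf_sum.
rewrite [in RHS]/component mulr_suml lc_sum; apply: eq_bigr => k' _.
by rewrite lc_lmap_id cf_cst // -scalerAl lcZ lc_monM.
Qed.

Lemma component_lflip i j F : component i j (lflip F) = lflip (component i j F).
Proof.
have lc_flip (B : comNzRingType) (f : laur B n) k : lc (lflip f) k = lc f (flip k).
  elim/lau_ind: f => [|f f' IH IH'|_ c k' _ _]; rewrite /lflip ?lmap0 ?lmapD ?lc0 //.
    by rewrite !lcD -IH -IH'.
  by rewrite lmapZ lmap_mon !lcZ !lc_mon -(inj_eq (inv_inj (@flipK n))) flipK.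
by apply: lauP => k; rewrite !(lc_component, lc_flip).
Qed.

Definition represents (f : fps K) F :=
  forall i j, (i <= M)%N -> (j <= N)%N -> f i j = ev (component i j F).

Lemma represents_mul (f g : fps K) F G : represents f F -> represents g G ->
  represents (fps_mul f g) (F * G).
Proof.
move=> fF gG i j iM jN; rewrite componentM // rmorph_sum; apply: eq_bigr => i' _.
rewrite rmorph_sum; apply: eq_bigr => j' _ /=.
rewrite ratevM fF ?gG ?(leq_trans (leq_subr _ _)) //.
  by apply: leq_trans iM; rewrite -ltnS.
by apply: leq_trans jN; rewrite -ltnS.
Qed.

Lemma component_lmon i j k : (i <= M)%N -> (j <= N)%N ->
  component i j (lmon k) = ((j == 0) && (i == 0))%:R *: lmon k.
Proof.
move=> iM jN; have := component_mon 0 1 k iM jN.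
by rewrite expr0 rmorph1 mul1r scale1r coef1 -natrM mulnb.
Qed.

Lemma represents_mon k : represents (fps_const (rmon rat k)) (lmon k).
Proof.
move=> i j iM jN; rewrite component_lmon // ratevZ ratev_mon /fps_const andbC.
by case: ifP => _; rewrite /= ?rmorph0 ?rmorph1 ?mul0r ?mul1r.
Qed.

Variables a b : 'I_n.
Notation y := (rx rat a / rx rat b).
Notation z := (zr A a b).

Lemma rx_ratio m : y ^+ m = ev (lmon (root a b *+ m)).
Proof. by rewrite -lmonX rmorphXn /= ratev_mon rmon_root. Qed.

Lemma represents_one_sub : represents (one_sub_qt y) (1 - (q * t) *: z).
Proof.
move=> i j iM jN; have -> : 1 - (q * t) *: z = lmon 0 + (t ^+ 1 * rho (- 'X)) *: lmon (root a b).
  by rewrite lmon0 expr1 rmorphN mulrN scaleNr mulrC.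
rewrite componentD component_lmon // component_mon // ratevD !ratevZ !ratev_mon rmon0 rmon_root.
rewrite coefN coefX /one_sub_qt mulr1; case: i j {iM jN} => [|[|i]] [|[|j]] /=;
  by rewrite ?(mul0r, mul1r, mulr0, mulrN, oppr0, rmorphN, rmorph0, rmorph1, mulN1r, addr0, add0r).
Qed.

(** Common to the three geometric series: the m-th term carries t^(d m) q^(e m). *)
Lemma represents_geom (f : fps K) (s : nat) (d e : nat -> nat) :
    (forall i j, (i <= M)%N -> (j <= N)%N ->
      f i j = \sum_(m < s) ((j == d m) && (i == e m))%:R * y ^+ m) ->
  represents f (\sum_(m < s) (t ^+ d m * q ^+ e m) *: z ^+ m).
Proof.
move=> fE i j iM jN; rewrite fE // component_sum rmorph_sum; apply: eq_bigr => m _ /=.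
rewrite -rmorphXn /zr lmonX component_mon // ratevZ rx_ratio coefXn -natrM mulnb.
by rewrite /= rmorph_nat.
Qed.

Lemma represents_geom_q : represents (geom_q y) (geo M (q *: z)).
Proof.
have -> : geo M (q *: z) = \sum_(m < M.+1) (t ^+ 0 * q ^+ m) *: z ^+ m.
  by apply: eq_bigr => m _; rewrite exprZn expr0 mul1r.
apply: (@represents_geom _ _ (fun=> 0%N) id) => i j iM jN; rewrite /geom_q; case: eqP => _ /=; last first.
  by rewrite big1 // => m _; rewrite mul0r.
have iM' : (i < M.+1)%N by [].
rewrite (bigD1 (Ordinal iM')) //= eqxx mul1r big1 ?addr0 // => m mi.
by case: eqP => [im|_]; rewrite ?mul0r //; case/eqP: mi; apply: ord_inj.
Qed.

Lemma represents_geom_t : represents (geom_t y) (geo N (t *: z)).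
Proof.
have -> : geo N (t *: z) = \sum_(m < N.+1) (t ^+ m * q ^+ 0) *: z ^+ m.
  by apply: eq_bigr => m _; rewrite exprZn expr0 mulr1.
apply: (@represents_geom _ _ id (fun=> 0%N)) => i j iM jN; rewrite /geom_t; case: eqP => _ /=; last first.
  by rewrite big1 // => m _; rewrite andbF mul0r.
have jN' : (j < N.+1)%N by [].
rewrite (bigD1 (Ordinal jN')) //= eqxx mul1r big1 ?addr0 // => m mj.
by case: eqP => [jm|_]; rewrite ?mul0r //; case/eqP: mj; apply: ord_inj.
Qed.

Lemma represents_geom_qt : represents (geom_qt y) (geo M ((q * t) *: z)).
Proof.
have -> : geo M ((q * t) *: z) = \sum_(m < M.+1) (t ^+ m * q ^+ m) *: z ^+ m.
  by apply: eq_bigr => m _; rewrite exprZn exprMn mulrC.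
apply: (@represents_geom _ _ id id) => i j iM jN; rewrite /geom_qt.
have iM' : (i < M.+1)%N by [].
rewrite (bigD1 (Ordinal iM')) //= eqxx andbT eq_sym big1 ?addr0 => [|m mi].
  by case: eqP => _; rewrite ?mul1r ?mul0r.
by case: (i =P m) => [im|_]; rewrite ?andbF ?mul0r //; case/eqP: mi; apply: ord_inj.
Qed.

End Components.

(** * Coefficients of the Catalanimals *)

Section PairProducts.
Variables (A : comNzRingType) (n : nat).
Notation L := (laur A n).
Implicit Types (F : 'I_n -> 'I_n -> L) (P : nat -> nat -> bool).

Lemma lflip_pairs P F : (forall a b : 'I_n, P (rev_ord b) (rev_ord a) = P a b) ->
    (forall a b : 'I_n, lflip (F a b) = F (rev_ord b) (rev_ord a)) ->
  lflip (\prod_(p : 'I_n * 'I_n | P p.1 p.2) F p.1 p.2) = \prod_(p : 'I_n * 'I_n | P p.1 p.2) F p.1 p.2.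
Proof.
move=> PS FS; rewrite rmorph_prod /=.
pose h (p : 'I_n * 'I_n) := (rev_ord p.2, rev_ord p.1).
have hK : involutive h by case=> a b; rewrite /h /= !rev_ordK.
rewrite [RHS](reindex_inj (inv_inj hK)); apply: eq_big => [[a b]|[a b] _] /=; last by rewrite FS.
by rewrite PS.
Qed.

Lemma prod_simple F : \prod_(i < n | simple i) F i (ordS i) =
  \prod_(p : 'I_n * 'I_n | p.1.+1 == p.2 :> nat) F p.1 p.2.
Proof.
rewrite -(pair_big_dep xpredT (fun a b : 'I_n => a.+1 == b :> nat) F) /=.
rewrite big_mkcond; apply: eq_bigr => a _; case: ifP => sa.
  rewrite (big_pred1 (ordS a)) // => b; rewrite /= eq_sym -[in LHS](val_ordS sa).
  exact: val_eqE.
rewrite big_pred0 // => b; apply/negP => /eqP ab; move: sa.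
by rewrite /simple ab ltn_ord.
Qed.

End PairProducts.

Section CatalanimalCoefficients.
Variables (M N : nat) (Tr : truncation M N) (n : nat).
Notation A := (tr_ring Tr).
Notation q := (@tr_rho M N Tr 'X).
Notation t := (tr_t Tr).
Notation cf := (@tr_cf M N Tr).
Notation pi := (@tr_cst M N Tr).
Notation L := (laur A n.+1).
Notation ev := (@ratev rat rat idfun n.+1).

Lemma qt_nilp : (q * t) ^+ M.+1 = 0.
Proof. by rewrite exprMn tr_q_nilp mul0r. Qed.

(* The factors 1 - q t x_i / x_(i + 1) of the numerator have been cancelled. *)
Definition H_laur (b : weight n.+1) : L :=
  lmon b * (star_kernel q t N n * \prod_(p : 'I_n.+1 * 'I_n.+1 | (p.1 < p.2)%N) geo M (q *: zr A p.1 p.2)).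

Lemma H_laurE b : H_laur b =
  (lmon b * \prod_(i < n.+1 | simple i) geo M ((q * t) *: zr A i (ordS i))) *
  \prod_(p : 'I_n.+1 * 'I_n.+1 | (p.1 < p.2)%N)
     ((1 - (q * t) *: zr A p.1 p.2) * (geo M (q *: zr A p.1 p.2) * geo N (t *: zr A p.1 p.2))).
Proof.
rewrite /H_laur /star_kernel (prod_simple (fun a b => geo M ((q * t) *: zr A a b))).
rewrite !big_split /=.
have -> : \prod_(p : 'I_n.+1 * 'I_n.+1 | (p.1 < p.2)%N) (1 - (q * t) *: zr A p.1 p.2) =
    (\prod_(p : 'I_n.+1 * 'I_n.+1 | p.1.+1 == p.2 :> nat) (1 - (q * t) *: zr A p.1 p.2)) *
    \prod_(p : 'I_n.+1 * 'I_n.+1 | (p.1.+1 < p.2)%N) (1 - (q * t) *: zr A p.1 p.2).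
  rewrite (bigID (fun p : 'I_n.+1 * 'I_n.+1 => p.1.+1 == p.2 :> nat)) /=.
  by congr (_ * _); apply: eq_bigl => p; lia.
have c1 : \prod_(p : 'I_n.+1 * 'I_n.+1 | p.1.+1 == p.2 :> nat) geo M ((q * t) *: zr A p.1 p.2) *
    \prod_(p : 'I_n.+1 * 'I_n.+1 | p.1.+1 == p.2 :> nat) (1 - (q * t) *: zr A p.1 p.2) = 1.
  rewrite -big_split big1 // => p _ /=; rewrite mulrC; apply: geoP.
  by rewrite exprZn qt_nilp scale0r.
set X1 := \prod_(p | _) geo _ _ in c1 *; set X2 := \prod_(p | _) _ in c1 *.
set Y1 := \prod_(p | _) _; set Y2 := \prod_(p | _) _; set Y3 := \prod_(p | _) _.
transitivity ((X1 * X2) * (lmon b * (Y1 * Y2 * Y3))); last by ring.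
by rewrite c1 mul1r.
Qed.

Lemma represents_big (I : finType) (P : pred I) (f : I -> fps (ratfun rat n.+1)) (F : I -> L) :
  (forall i, P i -> represents (f i) (F i)) ->
  represents (\big[@fps_mul _/fps_const 1]_(i | P i) f i) (\prod_(i | P i) F i).
Proof.
move=> fF; apply: (big_ind2 (@represents _ _ _ _)) => //.
  by rewrite -(rmon0 rat n.+1) -lmon0; apply: represents_mon.
by move=> ????; apply: represents_mul.
Qed.

Lemma H_ser_coef b i j : (i <= M)%N -> (j <= N)%N ->
  H_ser b i j = weyl_sym (ev (component i j (H_laur b))).
Proof.
move=> iM jN; rewrite /H_ser /H_op; congr weyl_sym.
rewrite -[LHS]/((fps_mul _ _) i j) H_laurE.
suff R : represents (fps_mul (fps_mul (fps_const (rmon rat b))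
          (\big[@fps_mul _ / fps_const 1]_(i < n.+1 | simple i)
             geom_qt (rx rat i / rx rat (ordS i))))
       (\big[@fps_mul _ / fps_const 1]_(ij : 'I_n.+1 * 'I_n.+1 | (ij.1 < ij.2)%N)
          let y := rx rat ij.1 / rx rat ij.2 in
          fps_mul (one_sub_qt y) (fps_mul (geom_q y) (geom_t y))))
     (H_laur b) by rewrite -H_laurE; apply: R.
rewrite H_laurE; apply: represents_mul; first apply: represents_mul.
- exact: represents_mon.
- by apply: represents_big => a _; apply: represents_geom_qt.
apply: represents_big => p _; apply: represents_mul; first exact: represents_one_sub.
by apply: represents_mul; [apply: represents_geom_q|apply: represents_geom_t].
Qed.

Lemma lflip_H_laur b : lflip (H_laur b) = H_laur (flip b).
Proof.
rewrite /H_laur !lflipM lflip_mon; congr (_ * _).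
have zS x (a c : 'I_n.+1) : lflip (x *: zr A a c) = x *: zr A (rev_ord c) (rev_ord a).
  by rewrite lflipZ /zr lflip_mon flip_root.
have gS m x (a c : 'I_n.+1) : lflip (geo m (x *: zr A a c)) = geo m (x *: zr A (rev_ord c) (rev_ord a)).
  by rewrite -zS; apply: (rmorph_geo (@lflip A n.+1)).
have lS (a c : 'I_n.+1) : (rev_ord c < rev_ord a)%N = (a < c)%N.
  by rewrite /=; move: (ltn_ord a) (ltn_ord c); lia.
have lS' (a c : 'I_n.+1) : ((rev_ord c).+1 < rev_ord a)%N = (a.+1 < c)%N.
  by rewrite /=; move: (ltn_ord a) (ltn_ord c); lia.
rewrite /star_kernel; congr (_ * _ * _).
- apply: (@lflip_pairs _ _ (fun a c => (a.+1 < c)%N) (fun a c => 1 - (q * t) *: zr A a c)) => // a c.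
  by rewrite /lflip lmapB lmap1 -[lmap _ _ _]/(lflip _) zS.
- exact: (@lflip_pairs _ _ (fun a c => (a < c)%N) (fun a c => geo N (t *: zr A a c))).
- exact: (@lflip_pairs _ _ (fun a c => (a < c)%N) (fun a c => geo M (q *: zr A a c))).
Qed.

(** The factors 1 - x_i / x_j from the Weyl denominator join the 1 / (1 - q x_i / x_j) of the
    Catalanimal to form [Delta], so the coefficient becomes a value of the constant term
    functional. *)
Theorem H_ser_chi (b : weight n.+1) (lam : domweight n.+1) i j : (i <= M)%N -> (j <= N)%N ->
  coef_in (@rcst rat n.+1) (@chi rat n.+1) (H_ser b i j) lam =
  cf (ct q M (lmon (flip b) * star_kernel q t N n * lmap pi idfun (lchi (val lam)))) i j.
Proof.
move=> iM jN; rewrite H_ser_coef // coef_in_chi_ct -component_lflip lflip_H_laur.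
rewrite -mulrA -component_cst // lc_component; congr (cf (lc _ _) _ _).
rewrite /H_laur /Delta lmapM big_split /=; set w := lmap _ _ (\prod_(_ | _) _).
have -> : w = \prod_(p : 'I_n.+1 * 'I_n.+1 | (p.1 < p.2)%N) (1 - zr A p.1 p.2).
  by rewrite /w rmorph_prod; apply: eq_bigr => p _ /=; rewrite lmapB lmap1 lmap_mon.
by ring.
Qed.

End CatalanimalCoefficients.

(** * LLT coefficients *)

Section LaurentBaseChange.
Variables (A B : comNzRingType) (rho : {rmorphism A -> B}) (n : nat).

Lemma lmap_sact_id w (f : laur A n) : lmap rho idfun (sact w f) = sact w (lmap rho idfun f).
Proof.
elim/lau_ind: f => [|f g IH IH'|_ a k _ _]; first by rewrite sact0 !lmap0 sact0.
  by rewrite sactD !lmapD sactD IH IH'.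
by rewrite sactZ sact_mon !lmapZ !lmap_mon sactZ sact_mon.
Qed.

Lemma lmap_alt k : lmap rho idfun (alt A k) = alt B k :> laur B n.
Proof.
rewrite /alt /altop rmorph_sum; apply: eq_bigr => w _ /=.
by rewrite lmapM lmap_sact_id lmap_mon rmorphXn rmorphN rmorph1.
Qed.

End LaurentBaseChange.

Lemma ratev_lmap (A : comNzRingType) (F : fieldType) (rho : {rmorphism A -> F}) n (f : laur A n) :
  ratev idfun (lmap rho idfun f) = ratev rho f.
Proof.
elim/lau_ind: f => [|f g IH IH'|_ a k _ _]; first by rewrite lmap0 !ratev0.
  by rewrite lmapD !ratevD IH IH'.
by rewrite lmapZ lmap_mon !ratevZ !ratev_mon.
Qed.

Section LLTCoefficients.
Variables (R : realType) (F : fieldType) (rho : {rmorphism {poly rat} -> F}) (n : nat).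
Hypothesis rho_inj : injective rho.
Variable c : 'I_n -> R.
Hypothesis ci : injective c.
Notation L := (laur {poly rat} n).
Notation ev := (@ratev {poly rat} F rho n).

Definition hl (lam : weight n) (c : 'I_n -> R) : L := hl_laurent rho 'X lam (std c).

Lemma rho_X_neq0 : rho 'X != 0.
Proof. by rewrite -(rmorph0 rho) (inj_eq rho_inj) polyX_eq0. Qed.

Lemma hl_hecke_family : hecke_family 'X hl.
Proof. exact: hl_family rho_inj rho_X_neq0. Qed.

Definition poly_chi (lam : weight n) : L := lmap polyC idfun (lchi lam).

Lemma alternant0_neq0_gen : alternant F 0 != 0 :> ratfun F n.
Proof.
rewrite (alternant0 rho) mulf_neq0 //.
  by apply/prodf_neq0 => i _; rewrite expfz_neq0 ?rx_neq0.
rewrite rmorph_prod; apply/prodf_neq0 => p lp.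
rewrite /= ratevB ratev1 ratev_mon rmon_root.
have x0 := rx_neq0 F p.1; rewrite -(divff x0) -mulrBl mulf_neq0 ?invr_eq0 //.
by rewrite rx_sub_neq0 // ord_eqE ltn_eqF.
Qed.

Lemma ev_poly_chi (lam : domweight n) : ev (poly_chi (val lam)) = chi F lam.
Proof.
have e0 := alternant0_neq0_gen; apply: (mulIf e0); rewrite /chi divfK //.
rewrite -!(ratev_alt rho) add0r mulrC -ratevM.
by rewrite -(lmap_alt polyC) -lmapM -lchiP lmap_alt.
Qed.

(** An expansion over Q[q] maps to one over the field. There the family is free, so any expansion
    chosen by [coef_in] has the same coefficients. *)
Lemma LLT_coef (beta alpha : weight n) (lam : domweight n) (g : L) :
  lext (hl^~ c) g = poly_chi (val lam) * hl alpha c ->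
  LLT (rho 'X) (std c) beta alpha lam = rho (lc g beta).
Proof.
move=> gE; have hlE (k : weight n) : ev (hl k c) = E_twist (rho 'X)^-1 (std c)^-1 k.
  exact: hl_laurentE rho_X_neq0 _ _.
have hF := hf_map rho hl_hecke_family.
have fE : chi F lam * E_twist (rho 'X)^-1 (std c)^-1 alpha =
    \sum_(k <- lsupp g) rcst n (rho (lc g k)) * E_twist (rho 'X)^-1 (std c)^-1 k.
  rewrite -ev_poly_chi -hlE -ratevM -gE lext.unlock rmorph_sum; apply: eq_bigr => k _ /=.
  by rewrite ratevZ hlE.
rewrite /LLT /coef_in; case: xgetP => [d _ /= dE|no].
  pose G : laur F n := \sum_(k <- finsupp d) d k *: lmon k.
  have lcG k : lc G k = d k.
    rewrite lc_sum; under eq_bigr do rewrite lcZ lc_mon.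
    by rewrite fsum_delta // => /fsfun_dflt.
  suff /(congr1 (fun f => lc f beta)) : G - lmap rho idfun g = 0.
    rewrite lcD lcN lc0 lcG => /eqP; rewrite subr_eq0 => /eqP ->.
    rewrite lmapE lc_sum; under eq_bigr do rewrite lcZ lc_mon.
    by rewrite fsum_delta // => /lc_out ->; rewrite rmorph0.
  apply: (hf_free hF ci); rewrite linearB /= /G linear_sum /=.
  have idF_inj : injective (idfun : F -> F) by [].
  apply: (ratev_inj idF_inj); rewrite ratev0 ratevB rmorph_sum /=.
  apply/eqP; rewrite subr_eq0; apply/eqP.
  transitivity (\sum_(k <- finsupp d) rcst n (d k) * E_twist (rho 'X)^-1 (std c)^-1 k).
    apply: eq_bigr => k _; rewrite linearZ /= lext_mon ratevZ ratev_lmap /=.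
    by rewrite -hlE.
  rewrite -dE fE lmapE linear_sum rmorph_sum; apply: eq_bigr => k _ /=.
  by rewrite linearZ /= lext_mon ratevZ ratev_lmap /= -hlE.
pose d : {fsfun weight n -> F with 0} := [fsfun k in lsupp g => rho (lc g k)].
case: (no d); rewrite /= fE; have sub : (finsupp d `<=` lsupp g)%fset.
  by apply/fsubsetP => k; rewrite mem_finsupp fsfunE; case: ifP; rewrite ?eqxx.
rewrite [RHS](big_fset_incl _ sub) /=; last first.
  by move=> k _; rewrite mem_finsupp negbK => /eqP ->; rewrite rmorph0 mul0r.
by rewrite big_seq [RHS]big_seq; apply: eq_bigr => k kg; rewrite fsfunE kg.
Qed.

End LLTCoefficients.

(** * Comparison of the coefficients of q^m t^N *)

Section Assembly.
Variables (R : realType) (F : fieldType) (rho : {rmorphism {poly rat} -> F}) (n : nat).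
Hypothesis rho_inj : injective rho.
Variables (c c' : 'I_n.+1 -> R) (Bw : weight n.+1) (p : R).
Hypotheses (ci : injective c) (ci' : injective c') (cn : narrow c) (cn' : narrow c').
Hypothesis c_shift : forall i : 'I_n, c' (tl_ord i) = - c (hd_ord i).
Hypothesis c_slope : forall k, (Bw k)%:~R + c k + c' k = p.
Variables (u v : nat) (lam : domweight n.+1) (N : nat).

Definition alpha_w (a : n.-tuple 'I_N.+1) : weight n.+1 := push (@hd_ord n) (revwt a) - eps ord_max *~ u.
Definition beta_w (a : n.-tuple 'I_N.+1) : weight n.+1 := Bw + (push (@tl_ord n) (revwt a) - eps ord0 *~ v).
(** The exponent left over in [star_identity], turned back by [flip] into (b_1 + u, b_2, ..., b_l -
    v). *)
Definition b_w : weight n.+1 := flip (eps ord0 *~ v - eps ord_max *~ u - Bw).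

(** P a is the LLT coefficient as a polynomial in q, found by expanding over Q[q]; one choice of P
    serves all m. *)
Theorem H_ser_LLT : exists P : n.-tuple 'I_N.+1 -> {poly rat},
  (forall a, LLT (rho 'X) (std c) (beta_w a) (alpha_w a) lam = rho (P a)) /\
  forall m, coef_in (@rcst rat n.+1) (@chi rat n.+1) (H_ser b_w m N) lam =
    (\sum_(a : n.-tuple 'I_N.+1 | (\sum_(x <- a) x)%N == N) P a)`_m.
Proof.
have hE := hl_hecke_family R n.+1 rho_inj; have hE' := hl_hecke_family R n rho_inj.
have gP (a : n.-tuple 'I_N.+1) : exists g : laur {poly rat} n.+1,
    lext (hl rho (n := n.+1) ^~ c) g = poly_chi (val lam) * hl rho (alpha_w a) c.
  have [||g _ gE] := hf_span hE ci (Q := fun=> True) (h := poly_chi (val lam) * hl rho (alpha_w a) c).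
  - by [].
  - by [].
  - by exists g.
have [g gE] := choice gP; exists (fun a => lc (g a) (beta_w a)); split=> [a|m].
  exact: LLT_coef (gE a).
(* Only the coefficient of q^m t^N is in question, so q^(m + 1) and t^(N + 1) may be set to zero. *)
have [Tr] := inhabits (qt_truncation m N).
have hT := hf_map (@tr_rho m N Tr) hE; have hT' := hf_map (@tr_rho m N Tr) hE'.
have qN := tr_q_nilp Tr.
rewrite (H_ser_chi Tr) // /b_w flipK -(star_identity qN (tr_t_nilp Tr) hT' hT u v ci ci' cn cn' c_shift c_slope).
rewrite mulr_suml (big_morph _ (@ctD _ _ _ _) (ct0 _ _ _)) cf_sum coef_sum [RHS]big_mkcond.
apply: eq_bigr => a _; rewrite -scalerAl ctZ.
(* Expanding chi_lam e_alpha in the family and pairing with the dual element of index beta extracts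
   the coefficient at beta. *)
have -> : ct (tr_rho Tr 'X) m (lmap (tr_rho Tr) idfun (hl rho (alpha_w a) c) *
     lmap (tr_rho Tr) idfun (hl rho (- beta_w a) (oppw c)) *
     lmap (@tr_cst m N Tr) idfun (lchi (val lam))) = tr_rho Tr (lc (g a) (beta_w a)).
  have -> : lmap (@tr_cst m N Tr) idfun (lchi (val lam)) = lmap (tr_rho Tr) idfun (poly_chi (val lam)).
    rewrite /poly_chi; elim/lau_ind: (lchi (val lam)) => [|f f' IH IH'|_ x k _ _].
    - by rewrite !lmap0.
    - by rewrite !lmapD IH IH'.
    - by rewrite !(lmapZ, lmap_mon).
  rewrite mulrAC -lmapM [X in lmap _ _ X]mulrC -gE lext.unlock rmorph_sum mulr_suml.
  rewrite (big_morph _ (@ctD _ _ _ _) (ct0 _ _ _)).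
  have term k : ct (tr_rho Tr 'X) m (lmap (tr_rho Tr) idfun (lc (g a) k *: hl rho k c) *
       lmap (tr_rho Tr) idfun (hl rho (- beta_w a) (oppw c))) =
       tr_rho Tr (lc (g a) k) * (k == beta_w a)%:R.
    rewrite lmapZ -scalerAl ctZ; congr (_ * _).
    exact: (hf_dual qN hT k (beta_w a) ci).
  rewrite /=; under eq_bigr do rewrite term.
  by rewrite fsum_delta // => /lc_out ->; rewrite rmorph0.
rewrite tr_cf_mon // eq_sym; case: eqP => _; rewrite ?mul1r ?mul0r ?coef0 //.
Qed.

End Assembly.

(** * Weights and words cut out by the line *)

Section LineArithmetic.
Variables (R : realType) (p s : R).
Hypothesis p_irrational : forall r : rat, p <> ratr r.

Lemma line_c_bounds k : 0 <= line_c p s k < 1.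
Proof.
rewrite /line_c; set x := s - _; rewrite subr_ge0 floor_le /=.
by have := floorD1_gt x; rewrite intrD; lra.
Qed.

(** Equal fractional parts make p (k' - k) an integer, so p would be rational unless k = k'. *)
Lemma line_c_inj k k' : line_c p s k = line_c p s k' -> k = k'.
Proof.
move=> e; apply/eqP; apply: contraT => kk.
pose z : int := Num.floor (s - p * (k%:R - 1)) - Num.floor (s - p * (k'%:R - 1)).
have zE : p * (k'%:R - k%:R) = z%:~R by move: e; rewrite /line_c /z intrB => e; lra.
have d0 : (k'%:R - k%:R : R) != 0 by rewrite subr_eq0 eqr_nat eq_sym.
case: (@p_irrational (z%:~R / (k'%:R - k%:R))).
by rewrite fmorph_div /= ratr_int -zE rmorphB /= !ratr_nat mulfK.
Qed.

(** The origin of the translation by p: b_k and the two neighbouring fractional parts account for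
    one step of the line. *)
Lemma line_bc k : (line_b p s k)%:~R + line_c p s k - line_c p s k.+1 = p.
Proof.
rewrite /line_b /line_c intrB -natr1 addrK; ring.
Qed.

End LineArithmetic.

Lemma ratq_zmod : zmod_morphism ratq.
Proof. by move=> x y; rewrite /ratq polyCB rmorphB. Qed.
Lemma ratq_monoid : monoid_morphism ratq.
Proof. by split=> [|x y]; rewrite /ratq ?polyCM ?rmorphM ?rmorph1. Qed.
HB.instance Definition _ := GRing.isZmodMorphism.Build {poly rat} Qqt ratq ratq_zmod.
HB.instance Definition _ := GRing.isMonoidMorphism.Build {poly rat} Qqt ratq ratq_monoid.

Lemma ratq_inj : injective ratq.
Proof. by move=> x y /eqP; rewrite /ratq tofrac_eq => /eqP/polyC_inj. Qed.

(** A polynomial is its own expansion, with denominator 1. *)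
Lemma q_expansion_poly (P : {poly rat}) (h : nat -> rat) :
  (forall m, h m = P`_m) -> q_expansion (ratq P) h.
Proof.
move=> hP; exists P, 1; split; rewrite ?oner_neq0 ?rmorph1 ?divr1 // => m.
rewrite big_ord_recl coef1 mul1r subn0 big1 ?addr0 // => i _.
by rewrite coef1 mul0r.
Qed.

Theorem theorem5p3p1 (R : realType) (p s : R) (l : nat) (sigma : 'S_l)
    (p_gt0 : 0 < p) (p_irrational : forall r : rat, p <> ratr r)
    (l_ge1 : (1 <= l)%N)
    (sigma_order : forall i j : 'I_l,
      (sigma i < sigma j)%N = (line_c p s (l - i) < line_c p s (l - j)))
    (u v : nat) :
  let b := [seq line_b p s i | i <- iota 1 l] in
  series_eq
    (H_ser (wt l b + wt l (u%:Z :: nseq l.-1 0)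
                   - wt l (rcons (nseq l.-1 0) v%:Z)))
    (LLT_sum sigma b u v).
Proof.
case: l sigma l_ge1 sigma_order => // n sigma _ so b N lam.
pose c (i : 'I_n.+1) := line_c p s (n.+1 - i).
(* The negative of the reversed word with indices raised by one, from c_(l + 1) down to c_2. Its
   entries after the first are the negatives of c_l, ..., c_2, as [c_shift] requires, and [line_bc]
   gives [c_slope]. *)
pose c' (i : 'I_n.+1) := - line_c p s (n.+1 - i).+1.
pose Bw : weight n.+1 := wt n.+1 (rev b).
have ci : injective c.
  by move=> i j /(line_c_inj p_irrational) ij; apply: ord_inj; move: (ltn_ord i) (ltn_ord j) ij; lia.
have ci' : injective c'.
  move=> i j /oppr_inj/(line_c_inj p_irrational) ij; apply: ord_inj.
  by move: (ltn_ord i) (ltn_ord j) ij; lia.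
have cn : narrow c.
  by move=> i j; have := line_c_bounds p s (n.+1 - i); have := line_c_bounds p s (n.+1 - j); rewrite /c; lra.
have cn' : narrow c'.
  by move=> i j; have := line_c_bounds p s (n.+1 - i).+1; have := line_c_bounds p s (n.+1 - j).+1; rewrite /c'; lra.
have sE : sigma = std c by apply/esym/std_unique.
have BwE i : Bw i = line_b p s (n.+1 - i).
  rewrite ffunE nth_rev ?size_map ?size_iota // (nth_map 0%N) ?size_iota ?nth_iota; last 2 first.
  - by move: (ltn_ord i); lia.
  - by move: (ltn_ord i); lia.
  by congr line_b; move: (ltn_ord i); lia.
have c_shift (i : 'I_n) : c' (tl_ord i) = - c (hd_ord i).
  by rewrite /c' /c /= /bump /= add1n subSS -subSn // ltnW.
have c_slope k : (Bw k)%:~R + c k + c' k = p by rewrite BwE line_bc.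
have [P [PE PH]] := H_ser_LLT ratq_inj ci ci' cn cn' c_shift c_slope u v lam N.
have wtE : wt n.+1 b + wt n.+1 (u%:Z :: nseq n.+1.-1 0) - wt n.+1 (rcons (nseq n.+1.-1 0) v%:Z) = b_w Bw u v.
  apply/ffunP => i; have flipE k : flip k i = - k (rev_ord i) :> int by rewrite ffunE.
  rewrite /b_w flipE !(weightD, weightN) !weightMz BwE.
  have -> : wt n.+1 b i = line_b p s i.+1.
    by rewrite ffunE (nth_map 0%N) ?size_iota // nth_iota ?add1n.
  have -> : wt n.+1 (u%:Z :: nseq n.+1.-1 0) i = (nat_of_ord i == 0%N)%:Z * u.
    by rewrite ffunE; case: i {flipE} => -[|i] ii; rewrite /= ?mul1r // nth_nseq if_same mul0r.
  have -> : wt n.+1 (rcons (nseq n.+1.-1 0) v%:Z) i = (nat_of_ord i == n)%:Z * v.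
    rewrite ffunE nth_rcons size_nseq nth_nseq if_same /=.
    by move: (ltn_ord i); rewrite ltnS leq_eqVlt; case: eqP => [->|] //=; rewrite ?ltnn ?mul1r // mul0r => _ ->.
  have -> : eps ord0 (rev_ord i) = (nat_of_ord i == n)%:Z.
    by rewrite ffunE ord_eqE /=; congr (nat_of_bool _)%:Z; move: (ltn_ord i); lia.
  have -> : eps ord_max (rev_ord i) = (nat_of_ord i == 0%N)%:Z.
    by rewrite ffunE ord_eqE /=; congr (nat_of_bool _)%:Z; move: (ltn_ord i); lia.
  have -> : (n.+1 - rev_ord i = i.+1)%N by rewrite /=; move: (ltn_ord i); lia.
  by ring.
have beta_wE (a : n.-tuple 'I_N.+1) : Bw + wt n.+1 (- v%:Z :: rev [seq (nat_of_ord i)%:Z | i <- a]) = beta_w Bw v a.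
  congr (_ + _); apply/ffunP => i; rewrite weightD weightN weightMz ffunE.
  case: (unliftP ord0 i) => [j ->|->] /=.
    rewrite (@push_io _ (@tl_ord n)) ?ffunE; last exact: lift_inj.
    by rewrite (negPf (neq_lift _ _)) mul0r subr0 /bump /= ?add1n.
  rewrite (@push_z _ (@tl_ord n) ord0) ?ffunE => [|j]; last by rewrite eq_sym neq_lift.
  by rewrite eqxx mul1r sub0r.
have alpha_wE (a : n.-tuple 'I_N.+1) : wt n.+1 (rcons (rev [seq (nat_of_ord i)%:Z | i <- a]) (- u%:Z)) = alpha_w u a.
  apply/ffunP => i; rewrite weightD weightN weightMz ffunE nth_rcons size_rev size_map size_tuple.
  have [im|im] := eqVneq i ord_max.
    rewrite im /= ltnn eqxx (@push_z _ (@hd_ord n) ord_max) ?ffunE ?eqxx ?mul1r ?sub0r // => j.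
    by rewrite ord_eqE /= ltn_eqF.
  have ii : (i < n)%N by move: im (ltn_ord i); rewrite ord_eqE /=; lia.
  have -> : i = hd_ord (Ordinal ii) by apply: ord_inj.
  rewrite (@push_io _ (@hd_ord n)); last by move=> x y /(congr1 (@nat_of_ord _)) /= xy; apply: ord_inj.
  by rewrite !ffunE ord_eqE /= ii gtn_eqF // mul0r subr0.
have {}PE a : LLT qvar (std c) (beta_w Bw v a) (alpha_w u a) lam = ratq (P a) by exact: PE.
rewrite wtE; have -> : LLT_sum sigma b u v N lam = ratq (\sum_(a : n.-tuple 'I_N.+1 | (\sum_(x <- a) x)%N == N) P a).
  rewrite rmorph_sum /LLT_sum /=; apply: eq_bigr => a _.
  by rewrite -/Bw beta_wE alpha_wE sE PE.
exact: q_expansion_poly PH.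
Qed.
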